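(* Let $F\in L^2(0,\infty;H^{-2}(\Omega))$ and let $\psi_{0,h}\in S_h^0$ be the initial condition for the semi-discrete problem, such that $\|\nabla\psi_{0,h}\|\leq C\|\nabla\psi_0\|$. Then, for all $t\in(0,T]$ and for $0<\alpha<\frac{\nu\bar\lambda_1}{2}$, the semi-discrete solution $\psi_h$ satisfies $$\|\nabla\psi_h(t)\|^2+\beta e^{-2\alpha t}\int_0^t e^{2\alpha s}\|\Delta\psi_h(s)\|^2\,ds\leq Ce^{-2\alpha t}\|\nabla\psi_0\|^2+\frac{\mu^2}{\nu}\|F\|_{L^2(0,\infty;H^{-2}(\Omega))}^2,$$ where $\beta=\nu-\frac{2\alpha}{\bar\lambda_1}>0$. Moreover, $$\limsup_{t\to\infty}\|\Delta\psi_h(t)\|\leq\frac{\mu^2}{\nu}\|F\|_{L^2(0,\infty;H^{-2}(\Omega))} .$$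
   Context: $\Omega\subset\mathbb{R}^2$ is a bounded domain, $\nu>0$, $\mu>0$ are constants, $\psi_0\in H^1_0(\Omega)$. $(\cdot,\cdot)$ and $\|\cdot\|$ are the $L^2(\Omega)$ inner product (also duality pairing) and norm. $H^{-2}(\Omega)$ is the dual of $H^2_0(\Omega)$ with norm $\|\cdot\|_{-2}$ dual to $\|\Delta\cdot\|$. $\bar\lambda_1>0$ is the minimum eigenvalue of $-\Delta\phi=\bar\lambda\phi$ in $\Omega$ with homogeneous Dirichlet boundary condition. $C$ denotes a generic positive constant independent of $h$ and $t$, not necessarily the same at each occurrence. $\mathcal{T}_h$ is a shape regular partition of $\overline\Omega$ of mesh size $h$; $S_h\subset C^1(\Omega)\cap\mathcal{P}$ is a $C^1$-conforming finite element space of piecewise polynomials ($\mathcal P$ a piecewise polynomial space) of degree up to $k\ge3$, and $S_h^0=\{v\in S_h: v=\partial_{\mathbf n}v=0\text{ on }\partial\Omega\}\subset H^2_0(\Omega)$, which is finite dimensional. Set $a(v,w)=(\Delta v,\Delta w)$, $b_0(v,w)=-\frac12[(v_x,w)-(v,w_x)]$, $b(\psi;v,w)=(\Delta\psi,\,v_yw_x-v_xw_y)$. The semi-discrete problem is: find $\psi_h(t)\in S_h^0$ with $\psi_h(0)=\psi_{0,h}$ such that $$(\partial_t\nabla\psi_h,\nabla\chi)+\nu a(\psi_h,\chi)+b(\psi_h;\psi_h,\chi)+\mu b_0(\psi_h,\chi)=\mu(F,\chi)\quad\forall\chi\in S_h^0,\ t\in(0,T],$$ where $T>0$ is arbitrary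 (so that $\psi_h$ is defined for all $t>0$ in the last assertion). *)

(* Defs.v *)
From mathcomp Require Import all_boot all_order all_algebra.
From mathcomp Require Import all_classical all_reals all_analysis.

Set Implicit Arguments.
Unset Strict Implicit.
Unset Printing Implicit Defensive.

Import Order.TTheory GRing.Theory Num.Theory.
Import numFieldNormedType.Exports.

Local Open Scope classical_set_scope.
Local Open Scope ring_scope.

Definition mu2 {R : realType} := (@lebesgue_measure R \x @lebesgue_measure R)%E.

Section Plane.
Context {R : realType}.
Implicit Types (p q n : R * R) (A : set (R * R)).

Definition ex : R * R := (1, 0).
Definition ey : R * R := (0, 1).
Definition dot p q : R := p.1 * q.1 + p.2 * q.2.
(* The library norm on [R * R] is the max norm; [edist] is Euclidean. *)
Definition edist p q : R := Num.sqrt (dot (p - q) (p - q)).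
Definition ediam A : R := sup [set edist pq.1 pq.2 | pq in A `*` A].

Definition bounded_domain A : Prop :=
  [/\ open A, connected A, A !=set0 & bounded_set A].

(* [n] is the outward unit normal to [A] at [p]: near [p], the set [A] fills
   every strictly inner cone and misses every strictly outer cone around [n].
   It exists at the points where the boundary is an edge or a C^1 arc with [A]
   on one side, and not at the vertices of a polygon. *)
Definition outward_normal A p n : Prop :=
  dot n n = 1 /\
  forall e : R, 0 < e -> exists2 r : R, 0 < r &
    forall q, edist q p < r ->
      (dot (q - p) n < - e * edist q p -> A q) /\
      (e * edist q p < dot (q - p) n -> ~ A q).

End Plane.

Section FunctionSpaces.
Context {R : realType}.
Variable Omega : set (R * R).
Implicit Types (v w f g phi : R * R -> R) (e : R * R).

Definition L2 v : Prop :=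
  measurable_fun Omega v /\
  mu2.-integrable Omega (fun p => ((v p) ^+ 2)%:E).

Definition ip v w : R := \int[mu2]_(p in Omega) (v p * w p).
Definition l2norm v : R := Num.sqrt (ip v v).

Fixpoint iter_partial (s : seq bool) f : R * R -> R :=
  if s is b :: s' then 'D_(if b then ex else ey) (iter_partial s' f) else f.

Definition smooth f : Prop := forall (s : seq bool),
  continuous (iter_partial s f) /\
  forall p, derivable (iter_partial s f) p ex /\
            derivable (iter_partial s f) p ey.

(* C_c^oo(Omega) *)
Definition test_fun phi : Prop :=
  smooth phi /\
  exists K : set (R * R),
    [/\ compact K, K `<=` Omega & forall p, ~ K p -> phi p = 0].

Definition is_weak_deriv e v g : Prop :=
  L2 g /\ forall phi, test_fun phi -> ip v ('D_e phi) = - ip g phi.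

(* Some weak derivative of [v] in direction [e] (unique almost everywhere in
   [Omega]), and the zero function if there is none in L^2(Omega). *)
Definition wder e v : R * R -> R := xget (cst 0) [set g | is_weak_deriv e v g].

Definition H1 v : Prop :=
  L2 v /\ forall e, e = ex \/ e = ey -> exists g, is_weak_deriv e v g.
Definition H2 v : Prop := [/\ H1 v, H1 (wder ex v) & H1 (wder ey v)].

Definition H1norm v : R :=
  Num.sqrt (l2norm v ^+ 2 + l2norm (wder ex v) ^+ 2 + l2norm (wder ey v) ^+ 2).
Definition H2norm v : R :=
  Num.sqrt (l2norm v ^+ 2 + H1norm (wder ex v) ^+ 2 + H1norm (wder ey v) ^+ 2).

(* closures of C_c^oo(Omega) in H^1(Omega) and in H^2(Omega) *)
Definition H10 v : Prop :=
  H1 v /\ forall eps : R, 0 < eps ->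
    exists2 phi, test_fun phi & H1norm (v - phi) < eps.
Definition H20 v : Prop :=
  H2 v /\ forall eps : R, 0 < eps ->
    exists2 phi, test_fun phi & H2norm (v - phi) < eps.

Definition lap v : R * R -> R := wder ex (wder ex v) + wder ey (wder ey v).
Definition grad_ip v w : R :=
  ip (wder ex v) (wder ex w) + ip (wder ey v) (wder ey w).
Definition gradnorm v : R := Num.sqrt (grad_ip v v).

Definition dirichlet_eigenvalue (lam : R) : Prop :=
  exists phi, [/\ H10 phi, l2norm phi != 0 &
    forall v, H10 v -> grad_ip phi v = lam * ip phi v].
Definition min_dirichlet_eigenvalue (lam : R) : Prop :=
  dirichlet_eigenvalue lam /\
  forall lam', dirichlet_eigenvalue lam' -> lam <= lam'.

(* An element of H^{-2}(Omega) is represented by a functional on all functions,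
   of which only the values on H^2_0(Omega) matter. The bound forces it to
   respect equality almost everywhere. *)
Definition Hm2 (f : (R * R -> R) -> R) : Prop :=
  (forall (a : R) v w, H20 v -> H20 w -> f (a *: v + w) = a * f v + f w) /\
  exists M : R, forall v, H20 v -> `|f v| <= M * l2norm (lap v).
Definition Hm2norm (f : (R * R -> R) -> R) : R :=
  sup [set `|f v| | v in [set v | H20 v /\ l2norm (lap v) <= 1]].

Definition Hm2_simple (G : R -> (R * R -> R) -> R) : Prop :=
  exists (m : nat) (A : 'I_m -> set R) (f : 'I_m -> (R * R -> R) -> R),
    (forall i, measurable (A i) /\ Hm2 (f i)) /\
    forall t v, G t v = \sum_(i < m) \1_(A i) t * f i v.

(* the Bochner space L^2(0, oo; H^{-2}(Omega)) *)
Definition L2Hm2 (F : R -> (R * R -> R) -> R) : Prop :=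
  [/\ forall t, 0 < t -> Hm2 (F t),
      exists2 G : nat -> R -> (R * R -> R) -> R,
        forall n, Hm2_simple (G n) &
        {ae lebesgue_measure, forall t, 0 < t ->
           Hm2norm (fun v => G n t v - F t v) @[n --> \oo] --> (0 : R)} &
      lebesgue_measure.-integrable `]0, +oo[
        (fun t : R => (Hm2norm (F t) ^+ 2)%:E)].
Definition L2Hm2norm (F : R -> (R * R -> R) -> R) : R :=
  Num.sqrt (\int[lebesgue_measure]_(t in `]0, +oo[) (Hm2norm (F t) ^+ 2)).

End FunctionSpaces.

Section FiniteElements.
Context {R : realType}.
Variable Omega : set (R * R).
Implicit Types (v p : R * R -> R) (S : set (R * R -> R)).

(* [sigma] is the shape regularity constant: every element contains a disc
   whose radius is at least [sigma] times the diameter of the element. *)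
Record shape_regular_partition (sigma h : R) (N : nat)
    (K : 'I_N -> set (R * R)) : Prop := {
  elt_compact : forall i, compact (K i);
  elt_domain : forall i, connected (K i)° /\ closure (K i)° = K i;
  elt_boundary : forall i, mu2.-negligible (K i `\` (K i)°);
  elt_disjoint : forall i j, i != j -> (K i)° `&` (K j)° = set0;
  elt_cover : \bigcup_i K i = closure Omega;
  elt_shape : forall i, exists c, exists2 r : R, sigma * ediam (K i) <= r &
    0 < r /\ [set q | edist q c < r] `<=` K i;
  mesh_size : h = \big[Num.max/0]_(i < N) ediam (K i) }.

Definition polynomial2 (k : nat) p : Prop :=
  exists c : nat -> nat -> R, forall z, p z =
    \sum_(i < k.+1) \sum_(j < k.+1 | (i + j <= k)%N)
       c i j * z.1 ^+ i * z.2 ^+ j.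

Definition C1 v : Prop := forall z, Omega z -> forall e, e = ex \/ e = ey ->
  derivable v z e /\ {for z, continuous ('D_e v)}.

(* v = 0 and d_n v = 0 on the boundary; [v] is read on the closure of [Omega],
   so the normal derivative is the one-sided one, taken from inside. *)
Definition clamped v : Prop := forall z, (closure Omega `\` Omega) z ->
  v z = 0 /\
  forall n, outward_normal Omega z n ->
    s^-1 * (v z - v (z - s *: n)) @[s --> 0^'+] --> (0 : R).

Definition clamped_part S : set (R * R -> R) := S `&` [set v | clamped v].

(* A function on the closure of [Omega] is represented by its extension by 0.
   The last field, H^2-conformity under clamped conditions, is automatic on
   Lipschitz domains. *)
Record C1_fe_space (k N : nat) (K : 'I_N -> set (R * R)) S : Prop := {
  fes_0 : S (cst 0);
  fes_lin : forall (a : R) v w, S v -> S w -> S (a *: v + w);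
  fes_out : forall v, S v -> forall z, ~ closure Omega z -> v z = 0;
  fes_C1 : forall v, S v -> C1 v;
  fes_poly : forall v, S v -> forall i, exists2 p,
    polynomial2 k p & {in K i, v =1 p};
  fes_H20 : forall v, clamped_part S v -> H20 Omega v }.

End FiniteElements.

Section SemiDiscrete.
Context {R : realType}.
Variable Omega : set (R * R).
Implicit Types (psi v w : R * R -> R).

Local Notation "( v , w )_Om" := (ip Omega v w).
Local Notation dx := (wder Omega ex).
Local Notation dy := (wder Omega ey).

Definition a_form v w : R := (lap Omega v, lap Omega w)_Om.
Definition b0_form v w : R := - 2^-1 * ((dx v, w)_Om - (v, dx w)_Om).
Definition b_form psi v w : R :=
  (lap Omega psi, dy v * dx w - dx v * dy w)_Om.

(* [psit] is the time derivative on [0, T] of [psi], absolutely continuous with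
   values in the finite dimensional function space [V]; there the integral of
   [psit] may be taken point by point. *)
Definition time_derivative (V : set (R * R -> R)) (T : R)
    (psi psit : R -> R * R -> R) : Prop :=
  (forall t, 0 <= t <= T -> V (psi t) /\ V (psit t)) /\
  forall z : R * R,
    lebesgue_measure.-integrable `[0, T] (fun s : R => (psit s z)%:E) /\
    forall t, 0 <= t <= T ->
      psi t z = psi 0 z + \int[lebesgue_measure]_(s in `[0, t]) psit s z.

(* As [F] is only square integrable in time, the equation is required for almost
   every [t] in (0, T]. *)
Definition semidiscrete_solution (V : set (R * R -> R)) (nu mu : R)
    (F : R -> (R * R -> R) -> R) (psi0h : R * R -> R) (T : R)
    (psih : R -> R * R -> R) : Prop :=
  psih 0 = psi0h /\
  exists2 psit, time_derivative V T psih psit &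
    {ae lebesgue_measure, forall t, 0 < t <= T -> forall chi, V chi ->
       grad_ip Omega (psit t) chi + nu * a_form (psih t) chi
         + b_form (psih t) (psih t) chi + mu * b0_form (psih t) chi
       = mu * F t chi}.

End SemiDiscrete.

(* Main.v *)
Require Import Defs.
From mathcomp Require Import all_boot all_order all_algebra.
From mathcomp Require Import all_classical all_reals all_analysis.
From mathcomp Require Import measurable_realfun ring lra.
Set Implicit Arguments.
Unset Strict Implicit.
Unset Printing Implicit Defensive.
Import Order.TTheory GRing.Theory Num.Theory.
Import numFieldNormedType.Exports.
Local Open Scope classical_set_scope.
Local Open Scope ring_scope.

(* Tested with chi = psi_h(t), the two skew-symmetric terms of the scheme vanish.
   Bounding 2 mu (F, psi_h) by nu |Lap psi_h|^2 + (mu^2 / nu) |F|_{-2}^2 and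
   2 alpha |grad psi_h|^2 by (2 alpha / lam1) |Lap psi_h|^2, one gets for almost
   every t
     (e^{2 alpha t} |grad psi_h|^2)' + beta e^{2 alpha t} |Lap psi_h|^2
       <= (mu^2 / nu) e^{2 alpha t} |F|_{-2}^2,
   which is integrated in time; the product rule holds because psi_h has
   absolutely continuous coordinates in a nodal basis of the discrete space.

   The inequality lam1 |grad v|^2 <= |Lap v|^2 on H^2_0 follows from
   |grad v|^2 = - (Lap v, v) and the Poincaré inequality lam1 |v|^2 <= |grad v|^2.
   For the latter, take a minimising sequence of test functions for the Rayleigh
   quotient. Its averages over the cells of a fine grid converge along an
   ultrafilter, and the Poincaré inequality on each cell turns this into a fast
   Cauchy subsequence in L^2. The parallelogram law makes it Cauchy in H^1, and its
   limit is an eigenfunction whose eigenvalue is the infimum of the quotient.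

   For the last assertion take alpha = nu lam1 / 4: the convolution of |F|_{-2}^2
   with a decaying exponential tends to 0 by dominated convergence, hence so does
   |grad psi_h(t)|. As |Lap v| <= M |grad v| on the finite dimensional discrete
   space, with M depending on the mesh, |Lap psi_h(t)| tends to 0 as well. *)

(** * Semi-inner products *)

(** The hypothesis on [lam1] speaks of eigenvalues only, whereas the estimate needs [lam1] as a
    lower bound of the Rayleigh quotient on all of [H10]. The infimum of the quotient therefore has
    to be shown to be attained: only then is it an eigenvalue, to which the minimality of [lam1]
    applies. As [bounded_domain] assumes no regularity of the boundary, compactness is obtained from
    test functions, which extend by zero to a square containing [Omega].

    Functions are not identified almost everywhere and [wder] selects one weak derivative, so it is
    linear only up to null sets, and only on functions that have weak derivatives. Every form is
    thus treated as a positive semidefinite form on a subset of a module; its bilinearity rests on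
    the uniqueness of weak derivatives, that is, on the fundamental lemma of the calculus of
    variations.

    In the last assertion the right-hand side is nonnegative, so the bound follows once the limit is
    known to be 0. *)

Record semi_ip {R : realType} {E : lmodType R} (S : set E)
    (B : E -> E -> R) : Prop := {
  sip0 : S 0;
  sip_closed : forall (a : R) u v, S u -> S v -> S (a *: u + v);
  sipC : forall u v, S u -> S v -> B u v = B v u;
  sipL : forall (a : R) u v w, S u -> S v -> S w ->
    B (a *: u + v) w = a * B u w + B v w;
  sip_ge0 : forall u, S u -> 0 <= B u u }.

Section SemiInnerProduct.
Context {R : realType} {E : lmodType R} (S : set E) (B : E -> E -> R).
Hypothesis SB : semi_ip S B.
Implicit Types (u v w : E) (a b : R).

Definition sip_norm (C : E -> E -> R) u := Num.sqrt (C u u).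
Local Notation N := (sip_norm B).

Lemma sip_memD u v : S u -> S v -> S (u + v).
Proof. by move=> Su Sv; rewrite -[u]scale1r; exact: (sip_closed SB). Qed.

Lemma sip_memZ a u : S u -> S (a *: u).
Proof. by move=> Su; rewrite -[_ *: _]addr0; apply: (sip_closed SB) => //; exact: (sip0 SB). Qed.

Lemma sip_memN u : S u -> S (- u).
Proof. by move=> Su; rewrite -scaleN1r; exact: sip_memZ. Qed.

Lemma sip_memB u v : S u -> S v -> S (u - v).
Proof. by move=> Su Sv; apply: sip_memD => //; exact: sip_memN. Qed.

Lemma sip_mem_sum I (s : seq I) (P : pred I) (f : I -> E) :
  (forall i, S (f i)) -> S (\sum_(i <- s | P i) f i).
Proof.
move=> Sf; elim/big_ind : _ => // [|u v Su Sv]; [exact: (sip0 SB)|exact: sip_memD].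
Qed.

Lemma sipDl u v w : S u -> S v -> S w -> B (u + v) w = B u w + B v w.
Proof. by move=> Su Sv Sw; rewrite -{1}[u]scale1r (sipL SB)// mul1r. Qed.

Lemma sip0l w : S w -> B 0 w = 0.
Proof.
move=> Sw; have S0 := sip0 SB; have := sipDl S0 S0 Sw; rewrite addr0 => /eqP.
by rewrite -subr_eq subrr => /eqP.
Qed.

Lemma sipZl a u w : S u -> S w -> B (a *: u) w = a * B u w.
Proof.
move=> Su Sw; have S0 := sip0 SB.
by rewrite -[_ *: _]addr0 (sipL SB)// sip0l// addr0.
Qed.

Lemma sipNl u w : S u -> S w -> B (- u) w = - B u w.
Proof. by move=> Su Sw; rewrite -scaleN1r sipZl// mulN1r. Qed.

Lemma sipBl u v w : S u -> S v -> S w -> B (u - v) w = B u w - B v w.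
Proof. by move=> Su Sv Sw; rewrite sipDl// ?sipNl//; exact: sip_memN. Qed.

Lemma sipDr u v w : S u -> S v -> S w -> B w (u + v) = B w u + B w v.
Proof.
move=> Su Sv Sw; rewrite (sipC SB)//; last exact: sip_memD.
by rewrite sipDl// (sipC SB Su)// (sipC SB Sv).
Qed.

Lemma sipZr a u w : S u -> S w -> B w (a *: u) = a * B w u.
Proof.
by move=> Su Sw; rewrite (sipC SB)//; [rewrite sipZl// (sipC SB Su)|exact: sip_memZ].
Qed.

Lemma sipBr u v w : S u -> S v -> S w -> B w (u - v) = B w u - B w v.
Proof.
move=> Su Sv Sw; rewrite (sipC SB)//; last exact: sip_memB.
by rewrite sipBl// (sipC SB Su)// (sipC SB Sv).
Qed.

Lemma sip_suml I (s : seq I) (P : pred I) (f : I -> E) w :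
  (forall i, S (f i)) -> S w ->
  B (\sum_(i <- s | P i) f i) w = \sum_(i <- s | P i) B (f i) w.
Proof.
move=> Sf Sw; elim: s => [|i s ih]; first by rewrite !big_nil sip0l.
by rewrite !big_cons; case: ifP => // _; rewrite sipDl ?ih//; exact: sip_mem_sum.
Qed.

Lemma sip_sumr I (s : seq I) (P : pred I) (f : I -> E) w :
  (forall i, S (f i)) -> S w ->
  B w (\sum_(i <- s | P i) f i) = \sum_(i <- s | P i) B w (f i).
Proof.
move=> Sf Sw; rewrite (sipC SB)//; last exact: sip_mem_sum.
by rewrite sip_suml//; apply: eq_bigr => i _; rewrite (sipC SB).
Qed.

Lemma sip_normE u : S u -> N u ^+ 2 = B u u.
Proof. by move=> Su; rewrite sqr_sqrtr// (sip_ge0 SB). Qed.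

Lemma sip_norm_ge0 u : 0 <= N u. Proof. exact: sqrtr_ge0. Qed.

Lemma sip_sqD u v a : S u -> S v ->
  B (u + a *: v) (u + a *: v) = B u u + 2 * a * B u v + a ^+ 2 * B v v.
Proof.
move=> Su Sv; have Sav := sip_memZ a Sv; have Suav := sip_memD Su Sav.
rewrite sipDl// !sipDr// !sipZl// !sipZr// (sipC SB Sv Su); ring.
Qed.

Lemma sip_cauchy_schwarz u v : S u -> S v -> B u v ^+ 2 <= B u u * B v v.
Proof.
move=> Su Sv; have Bu := sip_ge0 SB Su; have Bv := sip_ge0 SB Sv.
have H a : 0 <= B u u + 2 * a * B u v + a ^+ 2 * B v v.
  rewrite -sip_sqD//; apply: (sip_ge0 SB); apply: sip_memD => //; exact: sip_memZ.
have [v0|vN0] := eqVneq (B v v) 0.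
  have [->|uvN0] := eqVneq (B u v) 0; first by rewrite expr0n mulr_ge0.
  (* With [B v v = 0] the polynomial in [a] is affine with nonzero slope; at this [a] it takes the
     value -1. *)
  have := H (- (B u u + 1) / (2 * B u v)).
  rewrite v0 mulr0 addr0.
  have -> : 2 * (- (B u u + 1) / (2 * B u v)) * B u v = - (B u u + 1) by field.
  lra.
have vp : 0 < B v v by rewrite lt_def vN0.
have := H (- B u v / B v v).
have -> : B u u + 2 * (- B u v / B v v) * B u v + (- B u v / B v v) ^+ 2 * B v v
  = B u u - B u v ^+ 2 / B v v by field.
by rewrite subr_ge0 ler_pdivrMr.
Qed.

Lemma sip_cauchy_schwarz_norm u v : S u -> S v -> `|B u v| <= N u * N v.
Proof.
move=> Su Sv; rewrite -sqrtrM ?(sip_ge0 SB)// -sqrtr_sqr.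
by rewrite ler_sqrt ?sip_cauchy_schwarz// mulr_ge0// (sip_ge0 SB).
Qed.

Lemma sip_normD u v : S u -> S v -> N (u + v) <= N u + N v.
Proof.
move=> Su Sv; rewrite -ler_sqr ?nnegrE ?addr_ge0 ?sip_norm_ge0//.
rewrite sip_normE; last exact: sip_memD.
rewrite sqrrD !sip_normE// -[v]scale1r sip_sqD// scale1r.
have := sip_cauchy_schwarz_norm Su Sv; have := ler_norm (B u v).
rewrite -mulr_natl; lra.
Qed.

Lemma sip_normZ a u : S u -> N (a *: u) = `|a| * N u.
Proof.
move=> Su; rewrite /sip_norm sipZl ?sipZr//; last exact: sip_memZ.
by rewrite mulrA -expr2 sqrtrM ?sqr_ge0// sqrtr_sqr.
Qed.

Lemma sip_norm_dist u v : S u -> S v -> `|N u - N v| <= N (u - v).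
Proof.
move=> Su Sv; have Suv := sip_memB Su Sv.
have h1 : N u <= N (u - v) + N v.
  by rewrite -[u in N u](subrK v); exact: sip_normD.
have h2 : N v <= N (u - v) + N u.
  have -> : N (u - v) = N (v - u).
    by rewrite -[u - v]opprB -[- (v - u)]scaleN1r sip_normZ ?normrN1 ?mul1r//; exact: sip_memB.
  by rewrite -[v in N v](subrK u); apply: sip_normD => //; exact: sip_memB.
by rewrite ler_norml; apply/andP; split; lra.
Qed.

(** The parallelogram law with the nonnegative term [B (u + v) (u + v)] dropped. *)
Lemma sip_parallelogram_le u v : S u -> S v ->
  B (u - v) (u - v) <= 2 * B u u + 2 * B v v.
Proof.
move=> Su Sv; have Sp := sip_memD Su Sv.
have := sip_ge0 SB Sp; rewrite -[u + v]addrC -[v + u]addrC.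
rewrite -{1 2}[v]scale1r -scaleN1r !sip_sqD//; lra.
Qed.

End SemiInnerProduct.

Lemma semi_ip_sub {R : realType} {E : lmodType R} (S S' : set E) B :
  semi_ip S B -> S' `<=` S -> S' 0 ->
  (forall (a : R) u v, S' u -> S' v -> S' (a *: u + v)) -> semi_ip S' B.
Proof.
move=> SB sub S0 Sl; split => // [u v /sub ? /sub ?|a u v w /sub ? /sub ? /sub ?|u /sub ?].
- exact: (sipC SB).
- exact: (sipL SB).
- exact: (sip_ge0 SB).
Qed.

Section MinimiserEigenvector.
Context {R : realType} {E : lmodType R} (S : set E) (B G : E -> E -> R) (m : R).
Hypotheses (SB : semi_ip S B) (SG : semi_ip S G).
Hypothesis mG : forall u, S u -> m * B u u <= G u u.

Lemma rayleigh_semi_ip : semi_ip S (fun u v => G u v - m * B u v).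
Proof.
split => [|a u v|u v Su Sv|a u v w Su Sv Sw|u Su].
- exact: (sip0 SB).
- exact: (sip_closed SB).
- by rewrite (sipC SB)// (sipC SG).
- rewrite (sipL SB)// (sipL SG)//; ring.
- by rewrite subr_ge0 mG.
Qed.

(** The form [G - m B] is positive semidefinite and vanishes at [(u, u)]; by Cauchy-Schwarz such a
    [u] is orthogonal to every [v]. This is the Euler-Lagrange equation, obtained without
    differentiating. *)
Lemma rayleigh_minimiser u : S u -> G u u = m * B u u ->
  forall v, S v -> G u v = m * B u v.
Proof.
move=> Su um v Sv; have := sip_cauchy_schwarz rayleigh_semi_ip Su Sv.
rewrite /= um subrr mul0r => h.
by apply/eqP; rewrite -subr_eq0 -sqrf_eq0 eq_le h sqr_ge0.
Qed.

End MinimiserEigenvector.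

(** * Finite dimensional spaces: domination of forms and nodal bases *)

Lemma ex_maximal_nat (P : nat -> Prop) (D : nat) :
  P 0%N -> (forall d, P d -> (d <= D)%N) -> exists2 d, P d & ~ P d.+1.
Proof.
move=> P0 PD; apply: contrapT => h.
have H d : P d by elim: d => // d Pd; apply: contrapT => nP; apply: h; exists d.
by have := PD _ (H D.+1); rewrite ltnn.
Qed.

Section FiniteDimension.
Context {R : realType} {E : lmodType R} (V : set E) (D : nat) (b : 'I_D -> E).
Hypothesis V0 : V 0.
Hypothesis Vlin : forall (a : R) u v, V u -> V v -> V (a *: u + v).
Hypothesis spanV : forall v, V v -> exists c : 'I_D -> R, v = \sum_i c i *: b i.

(** The [b i] only span: they need not lie in [V]. The coordinates of the [v i] form a matrix with
    [d] rows and [D] columns. A row vector in its left kernel is a vanishing combination of the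
    [v i], and applying [l j] to it returns the [j]-th entry, so the rows are independent. *)
Lemma dual_system_bound (d : nat) (v : 'I_d -> E) (l : 'I_d -> E -> R) :
  (forall i, V (v i)) ->
  (forall j (a : R) u w, V u -> V w -> l j (a *: u + w) = a * l j u + l j w) ->
  (forall i j, l j (v i) = (i == j)%:R) -> (d <= D)%N.
Proof.
move=> Vv llin lv; have /choice[A HA] := fun i => spanV (Vv i).
pose M : 'M[R]_(d, D) := \matrix_(i, k) A i k.
have l0 j : l j 0 = 0.
  have := llin j 1 0 0 V0 V0; rewrite scale1r addr0 mul1r => /eqP.
  by rewrite -subr_eq subrr => /eqP.
have comb (x : 'I_d -> R) : V (\sum_i x i *: v i) /\
    forall j, l j (\sum_i x i *: v i) = x j.
  have gen (s : seq 'I_d) : V (\sum_(i <- s) x i *: v i) /\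
      forall j, l j (\sum_(i <- s) x i *: v i) = \sum_(i <- s) x i * l j (v i).
    elim: s => [|i s [Vs ls]]; first by rewrite big_nil; split => // j; rewrite big_nil.
    rewrite big_cons; split => [|j]; first exact: Vlin.
    by rewrite big_cons llin// ls.
  have [? ls] := gen (index_enum 'I_d); split => // j; rewrite ls (bigD1 j)//= lv eqxx mulr1.
  by rewrite big1 ?addr0// => i /negbTE ij; rewrite lv ij mulr0.
suff : row_free M by rewrite -row_leq_rank => /leq_trans; apply; exact: rank_leq_col.
rewrite -kermx_eq0; apply/eqP/row_matrixP => i; rewrite row0.
set x := row i _; have xM : x *m M = 0.
  by apply/sub_kermxP; rewrite row_sub.
have sum0 : \sum_i x 0 i *: v i = 0.
  under eq_bigr do rewrite HA scaler_sumr.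
  rewrite exchange_big/= big1// => k _.
  under eq_bigr do rewrite scalerA.
  rewrite -scaler_suml; have /matrixP/(_ 0 k) := xM; rewrite !mxE.
  under eq_bigr do rewrite [M _ _]mxE.
  by move=> ->; rewrite scale0r.
apply/rowP => j; have [_ /(_ j) <-] := comb (fun i => x 0 i).
by rewrite sum0 l0 mxE.
Qed.

(** Take a [G]-orthonormal family [e] of maximal size. Once its components along [e] are removed,
    [v] leaves a remainder [w] orthogonal to [e]; were [G w w] nonzero, [w] could be normalised and
    added to the family. So [w] is null for [G], hence for [A], and the triangle inequality gives
    the constant, the sum of the [A]-norms of the [e i]. *)
Lemma semi_ip_dominated (G A : E -> E -> R) :
  semi_ip V G -> semi_ip V A -> (forall v, V v -> G v v = 0 -> A v v = 0) ->
  exists2 M : R, 0 <= M & forall v, V v -> sip_norm A v <= M * sip_norm G v.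
Proof.
move=> SG SA GA.
pose P d := exists2 e : 'I_d -> E, forall i, V (e i) &
  forall i j, G (e i) (e j) = (i == j)%:R.
have [|d [e Ve eG]|d [e Ve eG] maxd] := @ex_maximal_nat P D.
- by exists (fun=> 0) => // -[].
- apply: (@dual_system_bound d e (fun j v => G v (e j))) => // j a u w Vu Vw.
  exact: (sipL SG).
exists (\sum_i sip_norm A (e i)); first by apply: sumr_ge0 => i _; exact: sqrtr_ge0.
move=> v Vv.
pose w := v - \sum_i G v (e i) *: e i.
have VGe i : V (G v (e i) *: e i) by exact: (sip_memZ SG).
have Vs : V (\sum_i G v (e i) *: e i) by apply: (sip_mem_sum SG).
have Vw : V w by apply: (sip_memB SG).
have we j : G w (e j) = 0.
  rewrite (sipBl SG)// (sip_suml SG)// (bigD1 j)//=.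
  rewrite (sipZl SG)// eG eqxx mulr1 big1 ?addr0 ?subrr// => i /negbTE ij.
  by rewrite (sipZl SG)// eG ij mulr0.
have w0 : G w w = 0.
  apply: contrapT => /eqP wN0; apply: maxd.
  have wp : 0 < G w w by rewrite lt_def wN0 (sip_ge0 SG).
  pose u := (sip_norm G w)^-1 *: w.
  have np : 0 < sip_norm G w by rewrite sqrtr_gt0.
  exists (fun i => if unlift ord0 i is Some j then e j else u) => [i|i j].
    by case: (unliftP ord0 i) => [k|] _ //; exact: (sip_memZ SG).
  case: (unliftP ord0 i) => [i'|] ->; case: (unliftP ord0 j) => [j'|] ->.
  - by rewrite eG (inj_eq lift_inj).
  - by rewrite (sipZr SG)// (sipC SG)// we mulr0 eq_sym (negbTE (neq_lift _ _)).
  - by rewrite (sipZl SG)// we mulr0 (negbTE (neq_lift _ _)).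
  - rewrite (sipZl SG)// ?(sipZr SG)//; last exact: (sip_memZ SG).
    by rewrite eqxx -(sip_normE SG Vw) expr2 mulKf ?mulVf ?lt0r_neq0.
have -> : v = w + \sum_i G v (e i) *: e i by rewrite subrK.
apply: le_trans (sip_normD SA Vw Vs) _.
rewrite {1}/sip_norm (GA _ Vw w0) sqrtr0 add0r.
have tri (s : seq 'I_d) : sip_norm A (\sum_(i <- s) G v (e i) *: e i) <=
    (\sum_(i <- s) sip_norm A (e i)) * sip_norm G v.
  elim: s => [|i s ih]; first by rewrite !big_nil mul0r /sip_norm (sip0l SA)// sqrtr0.
  rewrite !big_cons mulrDl; apply: le_trans (sip_normD SA _ _) _ => //.
    exact: (sip_mem_sum SG).
  apply: lerD => //; rewrite (sip_normZ SA)// mulrC ler_wpM2l ?sqrtr_ge0//.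
  rewrite (le_trans (sip_cauchy_schwarz_norm SG Vv (Ve i)))//.
  by rewrite [X in _ * X]/sip_norm eG eqxx sqrtr1 mulr1.
by rewrite subrK; exact: tri.
Qed.

End FiniteDimension.

(** Coordinates that are point values are wanted because [time_derivative] is a condition at each
    point. Nodes are added while possible: if [v] differs from its interpolant at [x], the
    normalised difference [w] becomes the nodal function of [x], and each old [chi j] is corrected
    by [chi j x *: w] so as to vanish there. *)
Lemma nodal_basis {R : realType} (X : Type) (V : set (X -> R)) (D : nat)
    (b : 'I_D -> X -> R) :
  V 0 -> (forall (a : R) u v, V u -> V v -> V (a *: u + v)) ->
  (forall v, V v -> exists c : 'I_D -> R, v = \sum_i c i *: b i) ->
  exists (d : nat) (z : 'I_d -> X) (chi : 'I_d -> X -> R),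
    (forall i, V (chi i)) /\ forall v, V v -> v = \sum_i v (z i) *: chi i.
Proof.
move=> V0 Vlin spanV.
have VZ (a : R) u : V u -> V (a *: u).
  by move=> Vu; rewrite -[_ *: _]addr0; exact: Vlin.
have VB u v : V u -> V v -> V (u - v).
  by move=> Vu Vv; rewrite addrC -scaleN1r; exact: Vlin.
pose P d := exists z : 'I_d -> X, exists2 chi : 'I_d -> X -> R,
  forall i, V (chi i) & forall i j, chi i (z j) = (i == j)%:R.
have [|d [z [chi Vchi chiz]]|d [z [chi Vchi chiz]] maxd] := @ex_maximal_nat P D.
- have [x0|nX] := pselect (inhabited X).
    by case: x0 => x0; exists (fun=> x0); exists (fun=> 0) => // -[].
  by exists (fun i : 'I_0 => False_rect _ (notF (ltn_ord i))); exists (fun=> 0) => // -[].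
- exact: (@dual_system_bound _ _ V D b V0 Vlin spanV d chi (fun j v => v (z j))).
exists d, z, chi; split => // v Vv.
have Vs : V (\sum_i v (z i) *: chi i).
  elim/big_ind : _ => // [u w Vu Vw|i _]; last exact: VZ.
  by rewrite -[u]scale1r; exact: Vlin.
set s := \sum_i _ in Vs *; have Vw := VB _ _ Vv Vs.
have sE x : s x = \sum_i v (z i) * chi i x by rewrite /s fct_sumE.
have wz j : (v - s) (z j) = 0.
  rewrite (_ : (v - s) (z j) = v (z j) - s (z j))// sE (bigD1 j)//= chiz eqxx mulr1.
  rewrite big1 ?addr0 ?subrr// => i /negbTE ij.
  by rewrite chiz ij mulr0.
apply/funext => x; apply: contrapT => vsx; apply: maxd.
have wx : (v - s) x != 0 by rewrite subr_eq0; apply/eqP.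
pose w := ((v - s) x)^-1 *: (v - s).
have wE y : w y = ((v - s) x)^-1 * (v - s) y by [].
exists (fun i => if unlift ord0 i is Some j then z j else x).
exists (fun i => if unlift ord0 i is Some j then chi j - chi j x *: w else w) => [i|i j].
  by case: (unliftP ord0 i) => [k|] _; [apply: VB => //; apply: (VZ)|]; exact: VZ.
case: (unliftP ord0 i) => [i'|] ->; case: (unliftP ord0 j) => [j'|] ->.
- rewrite (_ : (_ - _) (z j') = chi i' (z j') - chi i' x * w (z j'))//.
  by rewrite wE wz !mulr0 subr0 chiz (inj_eq lift_inj).
- rewrite (_ : (_ - _) x = chi i' x - chi i' x * w x)// wE mulVf// mulr1 subrr.
  by rewrite eq_sym (negbTE (neq_lift _ _)).
- by rewrite wE wz mulr0 (negbTE (neq_lift _ _)).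
- by rewrite wE mulVf// eqxx.
Qed.

(** * Square integrable functions *)

Section SquareIntegrable.
Context d (T : measurableType d) (R : realType).
Variables (mu : {measure set T -> \bar R}) (D : set T).
Hypothesis mD : measurable D.
Implicit Types (f g h : T -> R).

(** [L2] and [ip] are, up to conversion, the instances at [mu2]; the general form also serves
    intervals of the line. *)
Definition sqint f : Prop :=
  measurable_fun D f /\ mu.-integrable D (fun x => ((f x) ^+ 2)%:E).
Definition sq_ip f g : R := \int[mu]_(x in D) (f x * g x).

Lemma sqint_mul f g : sqint f -> sqint g ->
  mu.-integrable D (EFin \o (fun x => f x * g x)).
Proof.
move=> [mf If] [mg Ig].
apply: (@le_integrable _ _ _ _ _ mD _
  (EFin \o (fun x => f x ^+ 2 + g x ^+ 2))).
- by apply/measurable_EFinP; exact: measurable_funM.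
- move=> x _; rewrite lee_fin normrM.
  rewrite [leRHS]ger0_norm ?addr_ge0 ?sqr_ge0//.
  rewrite -[f x ^+ 2]real_normK ?num_real// -[g x ^+ 2]real_normK ?num_real//.
  have := sqr_ge0 (`|f x| - `|g x|); have := normr_ge0 (f x); have := normr_ge0 (g x).
  nra.
- exact: (integrableD mD If Ig).
Qed.

Lemma sqint_lin (a : R) f g : sqint f -> sqint g -> sqint (a *: f + g).
Proof.
move=> sf sg; have fg := sqint_mul sf sg; case: sf => mf If; case: sg => mg Ig.
have maf : measurable_fun D (fun x => a * f x) by apply: measurable_funM.
split; first exact: measurable_funD.
rewrite (_ : (fun _ => _) = (fun x => (a ^+ 2)%:E * (f x ^+ 2)%:E +
    ((2 * a)%:E * (f x * g x)%:E + (g x ^+ 2)%:E))%E); last first.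
  apply/funext => x; rewrite -!EFinM -!EFinD; congr EFin.
  rewrite (_ : (a *: f + g) x = a * f x + g x)//; ring.
by apply: integrableD => //; [exact: integrableZl|apply: integrableD => //; exact: integrableZl].
Qed.

Lemma sqint0 : sqint 0.
Proof.
split; first exact: measurable_cst.
rewrite (_ : (fun _ => _) = cst 0%E); first exact: integrable0.
by apply/funext => x /=; rewrite expr0n.
Qed.

Lemma sq_semi_ip : semi_ip sqint sq_ip.
Proof.
split => [|a u v|u v _ _|a u v w su sv sw|u _].
- exact: sqint0.
- exact: sqint_lin.
- by apply: eq_Rintegral => x _; rewrite mulrC.
- rewrite /sq_ip -RintegralZl//; last exact: sqint_mul.
  rewrite -RintegralD//; last 2 first.
  + exact: (integrableZl mD a (sqint_mul su sw)).
  + exact: sqint_mul.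
  apply: eq_Rintegral => x _.
  by rewrite (_ : (a *: u + v) x = a * u x + v x)// mulrDl mulrA.
- by apply: Rintegral_ge0 => x _; rewrite -expr2 sqr_ge0.
Qed.

Lemma sq_ip_ae_eq f g h : sqint f -> sqint g -> sqint h ->
  ae_eq mu D f g -> sq_ip f h = sq_ip g h.
Proof.
move=> sf sg sh fg; congr fine; apply: ae_eq_integral => //.
- by have /measurable_int := sqint_mul sf sh.
- by have /measurable_int := sqint_mul sg sh.
- by apply: filterS fg => x + Dx => ->.
Qed.

Lemma sq_ip_eq0_ae f : sqint f -> sq_ip f f = 0 -> ae_eq mu D f (cst 0).
Proof.
move=> [mf If] f0.
have : ae_eq mu D (fun x => ((f x) ^+ 2)%:E) (cst 0%E).
  apply/ae_eq_integral_abs => //; first by have /measurable_int := If.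
  under eq_integral do rewrite gee0_abs ?lee_fin ?sqr_ge0//.
  rewrite -[LHS]fineK; last exact: integrable_fin_num.
  by congr EFin; rewrite -[RHS]f0; congr fine; apply: eq_integral => x _; rewrite expr2.
by apply: filterS => x + Dx => /(_ Dx) [] /eqP; rewrite sqrf_eq0 => /eqP.
Qed.

Hypothesis finD : (mu D < +oo)%E.

Lemma sqint_bounded f (M : R) : measurable_fun D f ->
  (forall x, D x -> `|f x| <= M) -> sqint f.
Proof.
move=> mf fM; split => //; apply: measurable_bounded_integrable => //.
  exact: measurable_funX.
exists (M ^+ 2); split; first exact: num_real.
move=> B MB x Dx; rewrite /= normrX (le_trans _ (ltW MB))//.
by rewrite ler_pXn2r ?nnegrE ?(le_trans _ (fM _ Dx)) ?fM.
Qed.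

Lemma sqint_cst (a : R) : sqint (cst a).
Proof. exact: (@sqint_bounded _ `|a|). Qed.

Lemma sqint_integrable f : sqint f -> mu.-integrable D (EFin \o f).
Proof.
move=> sf; have := sqint_mul sf (sqint_cst 1).
by congr (_.-integrable _ _); apply/funext => x /=; rewrite mulr1.
Qed.

(** The Riesz-Fischer theorem for a geometric rate. By Cauchy-Schwarz against the constant 1, of
    finite norm since [D] has finite measure, the increments have a summable sequence of L^1 norms,
    so the sequence converges almost everywhere. Fatou's lemma then keeps the same rate for the
    limit. *)
Lemma sqint_complete (f_ : nat -> T -> R) : (forall n, sqint (f_ n)) ->
  (forall n k, (n <= k)%N -> sip_norm sq_ip (f_ n - f_ k) <= 1 / 2 ^+ n) ->
  exists2 f, sqint f & forall n, sip_norm sq_ip (f_ n - f) <= 1 / 2 ^+ n.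
Proof.
move=> sf fc; have SI := sq_semi_ip.
have sB n k : sqint (f_ n - f_ k) by apply: (sip_memB SI).
have mfn n : measurable_fun D (f_ n) by case: (sf n).
pose h n x := `|(f_ n - f_ n.+1) x|%:E.
have mh n : measurable_fun D (h n).
  by apply/measurable_EFinP; apply: measurableT_comp => //; case: (sB n n.+1).
have h0 n x : D x -> (0 <= h n x)%E by move=> _; rewrite lee_fin.
pose M := sip_norm sq_ip (cst 1).
(* The bound is [M / 2 ^+ n], written in the shape of the terms of the halving series summed
   below. *)
have ih n : (\int[mu]_(x in D) h n x <= (M * 2 / 2 ^+ n.+1)%:E)%E.
  pose s : T -> R := fun x => `|(f_ n - f_ n.+1) x|.
  have ss : sqint s.
    have [m1 i1] := sB n n.+1; split; first exact: measurableT_comp.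
    apply: eq_integrable i1 => //= x _; congr EFin.
    by rewrite /s real_normK ?num_real.
  have -> : (\int[mu]_(x in D) h n x = (sq_ip s (cst 1))%:E)%E.
    rewrite /sq_ip /Rintegral; under [in RHS]eq_integral do rewrite mulr1.
    by rewrite fineK//; apply: integrable_fin_num => //; exact: (sqint_integrable ss).
  rewrite lee_fin (le_trans (ler_norm _))//.
  rewrite (le_trans (sip_cauchy_schwarz_norm SI ss (sqint_cst 1)))//.
  rewrite mulrC -mulrA ler_wpM2l ?sip_norm_ge0//.
  rewrite (_ : sip_norm sq_ip s = sip_norm sq_ip (f_ n - f_ n.+1)); last first.
    rewrite /sip_norm; congr Num.sqrt; apply: eq_Rintegral => x _.
    by rewrite /s -expr2 real_normK ?num_real// expr2.
  rewrite exprS invfM mulrA divff//.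
  by apply: fc.
have ihoo : mu.-integrable D (fun x => \sum_(n <oo) h n x)%E.
  apply/integrableP; split.
    apply: ge0_emeasurable_sum => // n x Dx _; exact: h0.
  under eq_integral => x xD.
    rewrite gee0_abs; last by apply: nneseries_ge0 => n _ _; apply: h0; rewrite inE in xD.
    over.
  rewrite integral_nneseries//.
  have /cvg_lim E := @cvg_geometric_eseries_half R (M * 2) 0.
  apply: (@le_lt_trans _ _ (M * 2 / 2 ^+ 0)%:E); last exact: ltry.
  rewrite -E//; apply: lee_nneseries => [n _ _|n _]; first by apply: integral_ge0 => x; exact: h0.
  by rewrite (le_trans (ih n))// addn1 natrX.
have cvae : {ae mu, forall x, D x -> cvgn (f_ ^~ x)}.
  have := integrable_ae mD ihoo; apply: filterS => x + Dx => /(_ Dx) sfin.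
  have cs : cvgn (series (fun n => f_ n.+1 x - f_ n x)).
    apply: normed_cvg; apply: nondecreasing_is_cvgn.
      by apply: nondecreasing_series => n _ _; rewrite normr_ge0. 
    exists (fine (\sum_(n <oo) h n x)%E) => _ [n _ <-].
    rewrite -lee_fin fineK// /series/= -sumEFin.
    rewrite (eq_bigr (fun k => h k x)) => [|k _]; last by rewrite /h distrC.
    by apply: nneseries_lim_ge => k _ _; exact: h0.
  have -> : f_ ^~ x = (fun n => f_ 0%N x + series (fun n => f_ n.+1 x - f_ n x) n).
    apply/funext => n; rewrite /series/= telescope_sumr//; ring.
  by apply: is_cvgD => //; exact: is_cvg_cst.
(* The upper limit is measurable on all of [D], including the null set where the sequence
   diverges. *)
pose f x := fine (limn_esup (fun n => (f_ n x)%:E)).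
have mf : measurable_fun D f.
  apply: measurableT_comp => //; apply: measurable_fun_limn_esup => n.
  exact/measurable_EFinP.
have fcv : {ae mu, forall x, D x -> f_ ^~ x @ \oo --> f x}.
  apply: filterS cvae => x + Dx => /(_ Dx) /cvg_ex[l fl].
  suff -> : f x = l by [].
  rewrite /f; have /cvg_limn_einf_sup[_ ->]// : (fun n => (f_ n x)%:E) @ \oo --> l%:E.
  by apply: cvg_EFin => //; exact: nearW.
(* Fatou's lemma in [k]: almost everywhere the integrand is the lower limit of the squares of
   [f_ n - f_ k], whose integrals are bounded as soon as [n <= k]. *)
have key n : (\int[mu]_(x in D) (((f_ n - f) x) ^+ 2)%:E <= ((1 / 2 ^+ n) ^+ 2)%:E)%E.
  rewrite (@ge0_ae_eq_integral _ _ _ mu D _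
      (fun x => limn_einf (fun k => (((f_ n - f_ k) x) ^+ 2)%:E)))//; last first.
  - apply: filterS fcv => x + Dx => /(_ Dx) fl; apply/esym.
    apply: (cvg_limn_einf_sup _).1; apply: cvg_EFin; first exact: nearW.
    rewrite (_ : fine \o _ = (fun k => (f_ n x - f_ k x) ^+ 2))//.
    rewrite (_ : (f_ n - f) x = f_ n x - f x)//.
    by apply: cvgM; apply: cvgB => //; exact: cvg_cst.
  - move=> x Dx; rewrite limn_einf_lim; apply: lime_ge; first exact: is_cvg_einfs.
    by apply: nearW => k; apply: le_ereal_inf_tmp => _ [j _ <-]; rewrite lee_fin sqr_ge0.
  - by move=> x Dx; rewrite lee_fin sqr_ge0.
  - rewrite /limn_einf; apply: measurableT_comp => //.
    apply: measurable_fun_limn_esup => k; apply: measurableT_comp => //.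
    by apply/measurable_EFinP; apply: measurable_funX; case: (sB n k).
  - by apply/measurable_EFinP; apply: measurable_funX; apply: measurable_funB.
  apply: (le_trans (fatou mu mD _ _)).
  - by move=> k; apply/measurable_EFinP; apply: measurable_funX; case: (sB n k).
  - by move=> k x Dx; rewrite lee_fin sqr_ge0.
  rewrite limn_einf_lim; apply: lime_le; first exact: is_cvg_einfs.
  exists n => // k /= nk; apply: (@le_trans _ _ (\int[mu]_(x in D) (((f_ n - f_ k) x) ^+ 2)%:E)%E).
    by apply: ereal_inf_lbound; exists k => /=.
  rewrite -[leLHS]fineK; last by apply: integrable_fin_num => //; case: (sB n k).
  rewrite lee_fin -ler_sqrt ?sqr_ge0// sqrtr_sqr.
  rewrite [leRHS]ger0_norm ?divr_ge0 ?exprn_ge0//.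
  apply: le_trans (fc _ _ nk); rewrite /sip_norm /sq_ip.
  by under [in leRHS]eq_Rintegral do rewrite -expr2.
have sBf n : sqint (f_ n - f).
  split; first exact: measurable_funB.
  apply/integrableP; split.
    by apply/measurable_EFinP; apply: measurable_funX; apply: measurable_funB.
  under eq_integral do rewrite gee0_abs ?lee_fin ?sqr_ge0//.
  by apply: le_lt_trans (key n) _; rewrite ltry.
exists f => [|n].
  have -> : f = f_ 0%N - (f_ 0%N - f) by rewrite opprB addrCA subrr addr0.
  exact: (sip_memB SI).
rewrite -[leRHS]ger0_norm ?divr_ge0 ?exprn_ge0// -sqrtr_sqr /sip_norm ler_sqrt ?sqr_ge0//.
rewrite -lee_fin; apply: le_trans (key n).
rewrite /sq_ip /Rintegral fineK; last exact: (integrable_fin_num mD (sqint_mul (sBf n) (sBf n))).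
by under eq_integral do rewrite -expr2.
Qed.

End SquareIntegrable.

(* The measurable space on which [mu2] is a measure; its sigma-algebra is
   convertible to the default one on [R * R], but not syntactically equal to it. *)
Notation line R := (g_sigma_algebraType R.-ocitv.-measurable).
Notation plane R := (line R * line R)%type.

(** * Boxes with rational corners and measurability of open sets *)

Section Boxes.
Context {R : realType}.
Implicit Types (a b c d : R) (A : set (R * R)).

Definition obox a b c d : set (R * R) := `]a, b[ `*` `]c, d[.
Definition cbox a b c d : set (R * R) := `[a, b] `*` `[c, d].

Definition rat_quadruple := ((rat * rat) * (rat * rat))%type.
Definition rat_obox (q : rat_quadruple) :=
  obox (ratr q.1.1) (ratr q.1.2) (ratr q.2.1) (ratr q.2.2).
Definition rat_cbox (q : rat_quadruple) :=
  cbox (ratr q.1.1) (ratr q.1.2) (ratr q.2.1) (ratr q.2.2).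

(** Rational corners make the family countable; asking for the closed box inside [A] provides the
    compact support of the bump functions built on it. *)
Lemma open_rat_box A p : open A -> A p ->
  exists2 q, rat_obox q p & rat_cbox q `<=` A.
Proof.
move=> oA Ap; have /nbhs_ballP[e /= e0 eA] : nbhs p A by exact: open_nbhs_nbhs.
have itv (x : R) : exists a b : rat, [/\ x - e < ratr a, ratr a < x, x < ratr b & ratr b < x + e].
  have /rat_in_itvoo[a] : x - e < x by rewrite gtrBl.
  rewrite in_itv/= => /andP[? ?].
  have /rat_in_itvoo[b] : x < x + e by rewrite ltrDl.
  by rewrite in_itv/= => /andP[? ?]; exists a, b.
have [a [b [a1 a2 b1 b2]]] := itv p.1; have [c [d [c1 c2 d1 d2]]] := itv p.2.
exists ((a, b), (c, d)).
  by split; rewrite /= in_itv/=; apply/andP.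
move=> z [/=]; rewrite !in_itv/= => /andP[z1 z2] /andP[z3 z4]; apply: eA.
by split; rewrite -ball_normE/= ltr_distl; apply/andP; split; lra.
Qed.

Lemma open_bigcup_rat_box A : open A ->
  A = \bigcup_(n : nat) (if @unpickle rat_quadruple n is Some q then
    (if pselect (rat_cbox q `<=` A) then rat_obox q else set0) else set0).
Proof.
move=> oA; apply/seteqP; split => [p Ap|p [n _]].
  have [q pq qA] := open_rat_box oA Ap.
  by exists (pickle q); [exact: I|rewrite pickleK; case: pselect].
case: unpickle => // q; case: pselect => // qA [p1 p2]; apply: qA; split.
  by move: p1 => /=; exact: subset_itv_oo_cc.
by move: p2 => /=; exact: subset_itv_oo_cc.
Qed.

Lemma measurable_obox a b c d : @measurable _ (plane R) (obox a b c d).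
Proof. by apply: measurableX => //; exact: measurable_itv. Qed.

Lemma measurable_cbox a b c d : @measurable _ (plane R) (cbox a b c d).
Proof. by apply: measurableX => //; exact: measurable_itv. Qed.

Lemma open_measurable2 A : open A -> @measurable _ (plane R) A.
Proof.
move=> oA; rewrite (open_bigcup_rat_box oA); apply: bigcupT_measurable => n.
case: unpickle => [q|]; last exact: measurable0.
by case: (pselect _) => ?; [exact: measurable_obox|exact: measurable0].
Qed.

Lemma continuous_measurable_fun2 (f : R * R -> R) : continuous f ->
  @measurable_fun _ _ (plane R) (line R) setT f.
Proof.
move=> cf; apply: (measurability _ (RGenOInfty.measurableE R)) => // _ [_ [x ->] <-].
rewrite setTI; apply: open_measurable2; exact: open_comp.
Qed.

Lemma mu2_cbox a b c d : a <= b -> c <= d ->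
  mu2 (cbox a b c d) = ((b - a) * (d - c))%:E.
Proof.
move=> ab cd; have itvE x y : x <= y -> @lebesgue_measure R `[x, y]%classic = (y - x)%:E.
  move=> xy; rewrite lebesgue_measure_itv/= lte_fin.
  by case: ltgtP xy => // -> _; rewrite subrr.
transitivity (@lebesgue_measure R `[a, b]%classic * @lebesgue_measure R `[c, d]%classic)%E.
  exact: product_measure1E.
by rewrite !itvE// EFinM.
Qed.

Lemma bounded_sub_cbox A : bounded_set A ->
  exists2 L : R, 0 < L & A `<=` cbox (- L) L (- L) L.
Proof.
move=> [M [_ MA]]; exists (`|M| + 1); first by rewrite ltr_pwDr.
move=> z Az; have /MA : M < `|M| + 1 by rewrite ltr_pwDr ?ler_norm.
move=> /(_ _ Az) /=; rewrite prod_normE ge_max => /andP[z1 z2].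
by split => /=; rewrite in_itv/= -ler_norml.
Qed.

Lemma mu2_bounded_lty A : @measurable _ (plane R) A -> bounded_set A -> (mu2 A < +oo)%E.
Proof.
move=> mA /bounded_sub_cbox[L L0 AL].
apply: (@le_lt_trans _ _ (mu2 (cbox (- L) L (- L) L))).
  by apply: le_measure => //; rewrite inE//; exact: measurable_cbox.
by rewrite mu2_cbox ?ltry// ge0_cp// ltW.
Qed.

End Boxes.

(** * Bump functions and the fundamental lemma *)

Section Theta.
Context {R : realType}.
Implicit Types (x y : R).

(** Differentiation maps [theta k] to a combination of [theta k.+1] and [theta k.+2]. The smoothness
    of exp(-1/x) at the origin thus reduces to one derivative of each member of the family. *)
Definition theta (k : nat) x : R := if 0 < x then x^-1 ^+ k * expR (- x^-1) else 0.

Lemma theta_ge0 k x : 0 <= theta k x.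
Proof.
rewrite /theta; case: ifPn => // x0.
by rewrite mulr_ge0 ?expR_ge0// exprn_ge0// invr_ge0 ltW.
Qed.

(** A single term of the exponential series at [x^-1], that of degree [k.+1], gives the bound. It is
    applied to the difference quotient of [theta k] at 0, which is [theta k.+1] on the right. *)
Lemma theta_le_linear k x : 0 <= x -> theta k x <= (k.+1)`!%:R * x.
Proof.
rewrite /theta => x0; case: ifPn => [xp|_]; last by rewrite mulr_ge0.
have xV0 : 0 <= x^-1 by rewrite invr_ge0.
rewrite expRN ler_pdivrMr ?expR_gt0//.
have := expR_ge1Dxn k xV0; set E := expR _ => h.
apply: (@le_trans _ _ ((k.+1)`!%:R * x * (x^-1 ^+ k.+1 / (k.+1)`!%:R))).
  have f0 : (k.+1)`!%:R != 0 :> R by rewrite pnatr_eq0 -lt0n fact_gt0.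
  rewrite [leLHS](_ : _ = (k.+1)`!%:R * x * (x^-1 ^+ k.+1 / (k.+1)`!%:R))//.
  by rewrite exprS [X in _ * X]mulrC mulrACA divff// mul1r mulVKf// lt0r_neq0.
by rewrite ler_wpM2l ?mulr_ge0//; lra.
Qed.

Lemma is_derive_theta k x :
  is_derive x (1 : R) (theta k) (- k%:R * theta k.+1 x + theta k.+2 x).
Proof.
have [x0|x0|->] := ltgtP x 0.
- rewrite /theta !ifN -?leNgt ?(ltW x0)// mulr0 addr0.
  apply: (@near_eq_is_derive _ _ _ (cst 0)).
  by near=> y; rewrite ifN// -leNgt ltW//; near: y; exact: lt_nbhsl.
- apply: (@near_eq_is_derive _ _ _ (fun y => y^-1 ^+ k * expR (- y^-1))).
    by near=> y; rewrite /theta ifT//; near: y; exact: lt_nbhsr.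
  have xN0 : x != 0 by rewrite lt0r_neq0.
  have dV : is_derive x (1 : R) (fun y => y^-1) (- x ^- 2).
    have := @is_deriveV _ (id : R -> R) x 1 1 xN0 (is_derive_id _ _).
    by rewrite /GRing.scale/= mulr1.
  have dk : is_derive x (1 : R) (fun y => y^-1 ^+ k) (k%:R * x^-1 ^+ k.-1 * (- x ^- 2)).
    have := @is_derive1_comp _ (fun y => y ^+ k) (fun y => y^-1) x (k%:R * x^-1 ^+ k.-1) _ _ dV.
    apply; apply: DeriveDef; first exact: exprn_derivable.
    by rewrite exp_derive /GRing.scale/= mulr1 mulr_natl.
  have dE : is_derive x (1 : R) (fun y => expR (- y^-1)) (expR (- x^-1) * x ^- 2).
    have := @is_derive1_comp _ expR (fun y => - y^-1) x _ _ (is_derive_expR _) (is_deriveN dV).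
    by rewrite opprK.
  have dM := is_deriveM dk dE.
  apply: (is_derive_eq dM); rewrite /theta x0.
  rewrite /GRing.scale/=.
  case: k {dk dM} => [|k].
    by rewrite !mul0r mulr0 addr0 oppr0 mul0r add0r expr0 mul1r -exprVn mulrC.
  rewrite -!exprVn/= !exprS; ring.
rewrite /theta ltxx mulr0 addr0.
have lim0 : (fun h => h^-1 *: ((theta k \o shift 0) (h *: 1) - theta k 0)) @ 0^' --> (0 : R).
  apply/cvgr0Pnorm_le => e e0; near=> h.
  have hN0 : h != 0 by near: h; exact: nbhs_dnbhs_neq.
  rewrite /= /theta ltxx subr0 addr0 /GRing.scale/= mulr1.
  case: ifPn => [h0|_]; last by rewrite mulr0 normr0 ltW.
  rewrite (_ : h^-1 * _ = theta k.+1 h); last by rewrite /theta h0 exprS mulrA.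
  rewrite ger0_norm ?theta_ge0// (le_trans (theta_le_linear _ (ltW h0)))//.
  rewrite mulrC -ler_pdivlMr ?ltr0n ?fact_gt0//.
  apply: (le_trans (ler_norm _)); near: h; apply: dnbhs0_le.
  by rewrite divr_gt0 ?ltr0n ?fact_gt0.
apply: DeriveDef; first by apply/cvg_ex; exists 0.
exact: cvg_lim lim0.
Unshelve. all: by end_near. Qed.

Lemma continuous_theta k : continuous (theta k).
Proof.
move=> x; apply: differentiable_continuous; apply/derivable1_diffP.
by have [] := is_derive_theta k x.
Qed.

Lemma theta0_le1 x : theta 0 x <= 1.
Proof.
rewrite /theta; case: ifPn => // x0; rewrite expr0 mul1r expR_le1 oppr_le0.
by rewrite invr_ge0 ltW.
Qed.

Lemma theta0_cvg1 x : 0 < x -> theta 0 (n%:R * x) @[n --> \oo] --> (1 : R).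
Proof.
move=> x0; rewrite -[X in _ --> X]expR0.
apply: (@cvg_trans _ (expR (- (n%:R * x)^-1) @[n --> \oo])).
  apply: near_eq_cvg; near=> n.
  have h : 0 < n%:R * x by rewrite mulr_gt0// ltr0n; near: n; exact: nbhs_infty_gt.
  by rewrite /theta h expr0 mul1r.
have h : (fun n : nat => (n%:R * x)^-1) @ \oo --> (0 : R).
  rewrite (_ : (fun _ => _) = (fun n : nat => x^-1 * n%:R^-1)); last first.
    by apply/funext=> n; rewrite invfM mulrC.
  rewrite -[X in _ --> X](mulr0 x^-1); apply: cvgM; first exact: cvg_cst.
  by rewrite -cvg_shiftS; exact: cvg_harmonic.
have hN : (fun n : nat => - (n%:R * x)^-1) @ \oo --> (0 : R).
  by rewrite -[X in _ --> X]oppr0; exact: cvgN.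
exact: (cvg_comp _ _ hN (@continuous_expR R 0)).
Unshelve. all: by end_near. Qed.

End Theta.

(** * Partial derivatives and smooth bumps on boxes *)

Section PartialDerivatives.
Context {R : realType}.
Implicit Types (f g : R * R -> R) (p : R * R) (e : R * R).

Definition axis e : Prop := e = ex \/ e = ey.

Let quot (f : R * R -> R) p e h := h^-1 *: ((f \o shift p) (h *: e) - f p).

Let quot_ex f x y : quot f (x, y) ex =
  fun h => h^-1 *: (((fun t => f (t, y)) \o shift x) (h *: (1 : R)) - f (x, y)).
Proof.
apply/funext => h; rewrite /quot/= /shift/=; congr (_ *: (f _ - _)).
by apply: injective_projections => //=; rewrite /GRing.scale/= mulr0 add0r.
Qed.

Let quot_ey f x y : quot f (x, y) ey =
  fun h => h^-1 *: (((fun t => f (x, t)) \o shift y) (h *: (1 : R)) - f (x, y)).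
Proof.
apply/funext => h; rewrite /quot/= /shift/=; congr (_ *: (f _ - _)).
by apply: injective_projections => //=; rewrite /GRing.scale/= mulr0 add0r.
Qed.

Lemma is_derive_exE f x y df :
  is_derive (x, y) ex f df <-> is_derive x (1 : R) (fun t => f (t, y)) df.
Proof.
by split => -[h1 h2]; apply: DeriveDef; move: h1 h2;
  rewrite /derivable /derive -/(quot f (x, y) ex) quot_ex.
Qed.

Lemma is_derive_eyE f x y df :
  is_derive (x, y) ey f df <-> is_derive y (1 : R) (fun t => f (x, t)) df.
Proof.
by split => -[h1 h2]; apply: DeriveDef; move: h1 h2;
  rewrite /derivable /derive -/(quot f (x, y) ey) quot_ey.
Qed.

End PartialDerivatives.

Section BumpAlgebra.
Context {R : realType}.
Implicit Types (f g : R * R -> R) (p : R * R) (e : R * R).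

(** A syntactic class of continuous functions stable under both partial derivatives: smoothness, a
    statement on all lists of directions, follows by induction on the list. *)
Inductive bump_algebra : (R * R -> R) -> Prop :=
| bump_x k (s a : R) : bump_algebra (fun p => theta k (s * (p.1 - a)))
| bump_y k (s a : R) : bump_algebra (fun p => theta k (s * (p.2 - a)))
| bump_cst c : bump_algebra (fun=> c)
| bump_add f g : bump_algebra f -> bump_algebra g -> bump_algebra (fun p => f p + g p)
| bump_mul f g : bump_algebra f -> bump_algebra g -> bump_algebra (fun p => f p * g p).

Lemma bump_continuous f : bump_algebra f -> continuous f.
Proof.
elim=> [k s a|k s a|c|{}f g _ cf _ cg|{}f g _ cf _ cg] p.
- apply: (@continuous_comp _ _ _ (fun p : R * R => s * (p.1 - a)) (theta k));
    last exact: continuous_theta.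
  by apply: cvgM; [exact: cvg_cst|apply: cvgB; [exact: cvg_fst|exact: cvg_cst]].
- apply: (@continuous_comp _ _ _ (fun p : R * R => s * (p.2 - a)) (theta k));
    last exact: continuous_theta.
  by apply: cvgM; [exact: cvg_cst|apply: cvgB; [exact: cvg_snd|exact: cvg_cst]].
- exact: cvg_cst.
- by apply: cvgD; [exact: cf|exact: cg].
- by apply: cvgM; [exact: cf|exact: cg].
Qed.

Let is_derive_affine (s a x : R) : is_derive x (1 : R) (fun t => s * (t - a)) s.
Proof.
have := @is_deriveZ _ _ _ (fun t : R => t - a) s x 1 1 _.
rewrite /GRing.scale/= mulr1; apply.
have := @is_deriveB _ _ _ (id : R -> R) (cst a) x 1 1 0 (is_derive_id _ _) (is_derive_cst _ _ _).
by rewrite subr0.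
Qed.

Let theta_affine k (s a x : R) : is_derive x (1 : R) (fun t => theta k (s * (t - a)))
  ((- k%:R * theta k.+1 (s * (x - a)) + theta k.+2 (s * (x - a))) * s).
Proof.
exact: (@is_derive1_comp _ (theta k) (fun t => s * (t - a)) x _ _
  (is_derive_theta _ _) (is_derive_affine s a x)).
Qed.

Lemma bump_derivable f e : axis e -> bump_algebra f ->
  exists2 g, bump_algebra g & forall p, is_derive p e f (g p).
Proof.
move=> ae; elim=> {f} [k s a|k s a|c|f g bf [f' bf' df] bg [g' bg' dg]|
  f g bf [f' bf' df] bg [g' bg' dg]].
- case: ae => ->.
  + exists (fun p => ((fun=> - k%:R) p * theta k.+1 (s * (p.1 - a)) +
       theta k.+2 (s * (p.1 - a))) * s).
      by do !constructor.
    by case=> x y; apply/is_derive_exE; exact: theta_affine.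
  + exists (fun=> 0); first by constructor.
    by case=> x y; apply/is_derive_eyE => /=; exact: is_derive_cst.
- case: ae => ->.
  + exists (fun=> 0); first by constructor.
    by case=> x y; apply/is_derive_exE => /=; exact: is_derive_cst.
  + exists (fun p => ((fun=> - k%:R) p * theta k.+1 (s * (p.2 - a)) +
       theta k.+2 (s * (p.2 - a))) * s).
      by do !constructor.
    by case=> x y; apply/is_derive_eyE; exact: theta_affine.
- by exists (fun=> 0); [constructor|move=> p; exact: is_derive_cst].
- exists (fun p => f' p + g' p); first by constructor.
  by move=> p; exact: is_deriveD.
- exists (fun p => f p * g' p + g p * f' p); first by do !constructor.
  by move=> p; exact: is_deriveM.
Qed.

Lemma bump_smooth f : bump_algebra f -> smooth f.
Proof.
move=> bf s; suff bs : bump_algebra (iter_partial s f).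
  split; first exact: bump_continuous.
  have [g _ dg] := bump_derivable (or_introl erefl) bs.
  have [h _ dh] := bump_derivable (or_intror erefl) bs.
  by move=> p; split; [have [] := dg p|have [] := dh p].
elim: s => //= b s bs.
have ab : axis (if b then ex else ey : R * R) by case: b; [left|right].
have [g bg dg] := bump_derivable ab bs.
by rewrite (_ : 'D_ _ _ = g)//; apply/funext => p; have [_] := dg p.
Qed.

(** Each factor has the shape of a generator of [bump_algebra]; the sign of [- n%:R] makes it vanish
    to the right of [b], or above [d]. For growing [n] the product tends to the indicator of the
    open box while staying between 0 and 1. *)
Definition box_bump (a b c d : R) (n : nat) (p : R * R) : R :=
  theta 0 (n%:R * (p.1 - a)) * theta 0 (- n%:R * (p.1 - b)) *
  (theta 0 (n%:R * (p.2 - c)) * theta 0 (- n%:R * (p.2 - d))).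

Lemma box_bump_smooth a b c d n : smooth (box_bump a b c d n).
Proof. by apply: bump_smooth; do !constructor. Qed.

Lemma box_bump_ge0 a b c d n p : 0 <= box_bump a b c d n p.
Proof. by rewrite !mulr_ge0 ?theta_ge0. Qed.

Lemma box_bump_le1 a b c d n p : box_bump a b c d n p <= 1.
Proof.
by rewrite -[leRHS]mulr1 ler_pM// ?mulr_ge0 ?theta_ge0//
  -[leRHS]mulr1 ler_pM// ?theta_ge0 ?theta0_le1.
Qed.

Let theta_npos k (n : nat) (x : R) : x <= 0 -> theta k (n%:R * x) = 0.
Proof. by move=> x0; rewrite /theta ifN// -leNgt mulr_ge0_le0. Qed.

Lemma box_bump_out a b c d n p : ~ obox a b c d p -> box_bump a b c d n p = 0.
Proof.
move=> H; rewrite /box_bump !mulNr -!mulrN !opprB.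
have [h1|h1] := leP p.1 a.
  by rewrite [X in X * _ * _]theta_npos ?subr_le0// !mul0r.
have [h2|h2] := leP b p.1.
  by rewrite [X in _ * X * _]theta_npos ?subr_le0// mulr0 mul0r.
have [h3|h3] := leP p.2 c.
  by rewrite [X in _ * (X * _)]theta_npos ?subr_le0// mul0r mulr0.
have [h4|h4] := leP d p.2.
  by rewrite [X in _ * (_ * X)]theta_npos ?subr_le0// !mulr0.
by exfalso; apply: H; split; rewrite /= in_itv/=; apply/andP.
Qed.

Lemma box_bump_cvg a b c d p :
  box_bump a b c d n p @[n --> \oo] --> (\1_(obox a b c d) p : R).
Proof.
have [H|H] := pselect (obox a b c d p); last first.
  rewrite indicE memNset//; under eq_fun do rewrite box_bump_out//.
  exact: cvg_cst.
rewrite indicE mem_set//; case: H => /=; rewrite !in_itv/= => /andP[h1 h2] /andP[h3 h4].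
have -> : (fun n => box_bump a b c d n p) = (fun n : nat =>
    theta 0 (n%:R * (p.1 - a)) * theta 0 (n%:R * (b - p.1)) *
    (theta 0 (n%:R * (p.2 - c)) * theta 0 (n%:R * (d - p.2)))).
  by apply/funext => n; rewrite /box_bump !mulNr -!mulrN !opprB.
have -> : (1%N%:R : R) = 1 * 1 * (1 * 1) by rewrite !mulr1.
by apply: cvgM; apply: cvgM; apply: theta0_cvg1; rewrite subr_gt0.
Qed.

Lemma box_bump_test (Omega : set (R * R)) a b c d n : cbox a b c d `<=` Omega ->
  test_fun Omega (box_bump a b c d n).
Proof.
move=> KO; split; first exact: box_bump_smooth.
exists (cbox a b c d); split => // [|p pK].
  by apply: compact_setX; exact: segment_compact.
apply: box_bump_out; apply: contra_not pK => -[p1 p2].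
by split; [exact: subset_itv_oo_cc p1|exact: subset_itv_oo_cc p2].
Qed.

End BumpAlgebra.

Section FundamentalLemma.
Context {R : realType}.
Implicit Types (f g : R * R -> R) (A : set (R * R)).
Local Notation mu := (@mu2 R).

Definition oboxes : set (set (R * R)) :=
  [set A | exists a b c d, A = obox a b c d].

Lemma obox_setI (a b c d a' b' c' d' : R) :
  obox a b c d `&` obox a' b' c' d' =
  obox (Num.max a a') (Num.min b b') (Num.max c c') (Num.min d d').
Proof.
have E (x y x' y' z : R) : (z \in `]Num.max x x', Num.min y y'[) =
    (z \in `]x, y[) && (z \in `]x', y'[).
  by rewrite !in_itv/= gt_max lt_min andbACA.
apply/seteqP; split => p; rewrite /obox/= !E => -[].
  by move=> [-> ->] [-> ->].
by move=> /andP[-> ->] /andP[-> ->].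
Qed.

Lemma oboxes_setI : setI_closed oboxes.
Proof.
move=> _ _ [a [b [c [d ->]]]] [a' [b' [c' [d' ->]]]].
by rewrite obox_setI; do 4 eexists; reflexivity.
Qed.

(** For the reverse inclusion it suffices that both coordinates are measurable for the generated
    sigma-algebra: the preimage of an open interval is a strip, a countable union of open boxes. *)
Lemma measurable_oboxesE : @measurable _ (plane R) = <<s oboxes >>.
Proof.
apply/seteqP; split; last first.
  apply: smallest_sub; first exact: sigma_algebra_measurable.
  by move=> _ [a [b [c [d ->]]]]; exact: measurable_obox.
pose T := g_sigma_algebraType oboxes.
have itvT : `]-oo, +oo[%classic = \bigcup_(n : nat) (`](- n%:R), n%:R[%classic : set R).
  apply/seteqP; split => // x _; exists (Num.bound `|x|) => //=; rewrite in_itv/= -ltr_norml.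
  by rewrite archi_boundP.
suff mid : measurable_fun [set: T] (fun x : T => x : (R * R)%type).
  by move=> A mA; have := mid measurableT A mA; rewrite setTI preimage_id.
apply/measurable_fun_pairP; split;
  apply: (measurability _ (RGenOpens.measurableE R)) => // _ [_ [a [b ->] <-]];
  rewrite setTI.
- rewrite (_ : _ @^-1` _ = \bigcup_n (obox a b (- n%:R) n%:R)).
    by apply: bigcupT_measurable => n; apply: sub_sigma_algebra; do 4 eexists; reflexivity.
  rewrite -setX_bigcupr -itvT.
  by apply/seteqP; split => [p /= ?|p []//]; split.
- rewrite (_ : _ @^-1` _ = \bigcup_n (obox (- n%:R) n%:R a b)).
    by apply: bigcupT_measurable => n; apply: sub_sigma_algebra; do 4 eexists; reflexivity.
  rewrite -setX_bigcupl -itvT.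
  by apply/seteqP; split => [p /= ?|p []//]; split.
Qed.

(** The sets [A] for which the integral over [A] within [D] vanishes form a Dynkin class containing
    the open boxes, which are stable under intersection. The vanishing of the integral over [D]
    itself is what closes the class under complement. *)
Lemma integral_box_eq0_ae (D : set (R * R)) f : @measurable _ (plane R) D ->
  mu.-integrable D (EFin \o f) -> (\int[mu]_(p in D) (f p)%:E = 0)%E ->
  (forall a b c d, (\int[mu]_(p in D `&` obox a b c d) (f p)%:E = 0)%E) ->
  ae_eq mu D f (cst 0).
Proof.
move=> mD If fD0 fbox.
have all0 A : @measurable _ (plane R) A -> (\int[mu]_(p in D `&` A) (f p)%:E = 0)%E.
  rewrite measurable_oboxesE; move: A.
  apply: (@dynkin_induction _ (plane R) oboxes
    (fun A => (\int[mu]_(p in D `&` A) (f p)%:E = 0)%E)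
    measurable_oboxesE oboxes_setI); rewrite ?setIT//.
  - by move=> _ [a [b [c [d ->]]]].
  - move=> B mB B0; have := fD0; rewrite -{1}[D](setUIDK D B).
    rewrite integral_setU//= ?B0 ?add0e ?setDE//; first exact: measurableI.
    + exact: measurableD.
    + by rewrite setUIDK; apply/measurable_int: If.
    + by apply/disj_setPS => x [[_ ?] []].
  - move=> F mF tF F0; rewrite setI_bigcupr integral_bigcup//.
    + by rewrite eseries0.
    + by move=> i j _ _ [x [[_ Fi] [_ Fj]]]; apply: tF => //; exists x.
    + by move=> k; exact: (measurableI _ _ mD (mF k)).
    + apply: integrableS If => //; last by move=> x [k _ []].
      by apply: bigcupT_measurable => k; exact: (measurableI _ _ mD (mF k)).
have : ae_eq mu D (EFin \o f) (cst 0%E).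
  apply: integral_ae_eq => // E ED mE.
  by rewrite integral0 -(all0 E mE); congr integral; rewrite setIidr.
by apply: filterS => p + Dp => /(_ Dp)[].
Qed.


Lemma indic_box_integral (D : set (R * R)) g a b c d :
  (\int[mu]_(p in D) (g p * \1_(obox a b c d) p)%:E =
   \int[mu]_(p in D `&` obox a b c d) (g p)%:E)%E.
Proof.
rewrite [RHS]integral_mkcondr; apply: eq_integral => p _.
rewrite patchE indicE; case: ifPn => _; first by rewrite mulr1.
by rewrite mulr0.
Qed.

Section Vanishing.
Variables (Omega : set (R * R)) (g : R * R -> R).
Hypotheses (oO : open Omega) (finO : (mu Omega < +oo)%E) (Lg : L2 Omega g).
Hypothesis g0 : forall phi, test_fun Omega phi -> ip Omega g phi = 0.

Let mO : @measurable _ (plane R) Omega := open_measurable2 oO.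

Let ig : mu.-integrable Omega (EFin \o g).
Proof. exact: (@sqint_integrable _ _ _ mu Omega mO finO g Lg). Qed.

Let mg : @measurable_fun _ _ (plane R) (line R) Omega g := proj1 Lg.

Let mbump (f : R * R -> R) : continuous f ->
  @measurable_fun _ _ (plane R) (line R) Omega f.
Proof. by move=> /continuous_measurable_fun2; exact: measurable_funTS. Qed.

(** The bumps of the box are test functions tending to its indicator, and [g] dominates its products
    with them. *)
Lemma integral_box_eq0 a b c d : cbox a b c d `<=` Omega ->
  (\int[mu]_(p in obox a b c d) (g p)%:E = 0)%E.
Proof.
move=> QO; have OQ : Omega `&` obox a b c d = obox a b c d.
  apply/setIidPr => p [p1 p2]; apply: QO.
  by split; [exact: subset_itv_oo_cc p1|exact: subset_itv_oo_cc p2].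
rewrite -OQ -indic_box_integral.
pose f_ n p := (g p * box_bump a b c d n p)%:E.
have cb n : continuous (box_bump a b c d n).
  by have /(_ [::])[] := box_bump_smooth a b c d n.
have if_ n : mu.-integrable Omega (f_ n).
  apply: (@le_integrable _ _ _ mu Omega mO _ (EFin \o g)) => //.
    by apply/measurable_EFinP; apply: measurable_funM => //; exact: mbump.
  move=> p _; rewrite /f_/= lee_fin normrM [X in _ * X]ger0_norm ?box_bump_ge0//.
  by rewrite ler_piMr// box_bump_le1.
have f_0 n : (\int[mu]_(p in Omega) f_ n p = 0)%E.
  rewrite -[LHS]fineK; last exact: (integrable_fin_num mO (if_ n)).
  by congr EFin; apply: (g0 (box_bump_test n QO)).
have mi : @measurable_fun _ _ (plane R) (line R) Omega (fun p => g p * \1_(obox a b c d) p).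
  apply: measurable_funM => //; apply: measurable_indic; exact: measurable_obox.
have H1 : {ae mu, forall p, Omega p ->
    f_ ^~ p @ \oo --> (g p * \1_(obox a b c d) p)%:E}.
  apply: aeW => p Op; apply: cvg_EFin; first exact: nearW.
  by apply: cvgM; [exact: cvg_cst|exact: box_bump_cvg].
have H2 : {ae mu, forall p n, Omega p -> (`|f_ n p| <= (abse \o (EFin \o g)) p)%E}.
  apply: aeW => p n _; rewrite /f_/= lee_fin normrM [X in _ * X]ger0_norm ?box_bump_ge0//.
  by rewrite ler_piMr// box_bump_le1.
have [_ _] := @dominated_convergence _ _ _ mu Omega mO f_
  (fun p => (g p * \1_(obox a b c d) p)%:E) (abse \o (EFin \o g))
  (fun n => measurable_int _ (if_ n)) (proj2 (measurable_EFinP _ _) mi) H1 (integrable_abse ig) H2.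
have -> : [sequence (\int[mu]_(x in Omega) f_ n x)%E]_n = cst 0%E.
  by apply/funext => n /=; rewrite f_0.
by move=> /cvg_lim <- //; rewrite lim_cst.
Qed.

(** Countably many rational boxes with closure in [Omega] cover it. On each one [g] vanishes almost
    everywhere, since its integral over every smaller box does, and a countable union of null sets
    is null. *)
Lemma test_orthogonal_ae0 : ae_eq mu Omega g (cst 0).
Proof.
pose Q (q : rat_quadruple) p := rat_cbox q `<=` Omega -> rat_obox q p -> g p = 0.
have aeQ : {ae mu, forall (p : plane R) (n : nat),
    if @unpickle rat_quadruple n is Some q then Q q p else True}.
  apply/ae_foralln => n; case: unpickle => [q|]; last exact: aeW.
  have [qO|nqO] := pselect (rat_cbox q `<=` Omega); last by apply: aeW => p.
  have qO' : rat_obox q `<=` Omega.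
    move=> p [p1 p2]; apply: qO.
    by split; [exact: subset_itv_oo_cc p1|exact: subset_itv_oo_cc p2].
  have mq : @measurable _ (plane R) (rat_obox q) by exact: measurable_obox.
  have iq : mu.-integrable (rat_obox q) (EFin \o g).
    exact: (integrableS mO mq qO' ig).
  have Qbox a b c d : (\int[mu]_(p in rat_obox q `&` obox a b c d) (g p)%:E = 0)%E.
    rewrite obox_setI; apply: integral_box_eq0 => p [/=]; rewrite !in_itv/=.
    rewrite !ge_max !le_min => /andP[/andP[h1 _] /andP[h2 _]] /andP[/andP[h3 _] /andP[h4 _]].
    by apply: qO; split; rewrite /= in_itv/=; apply/andP.
  have := @integral_box_eq0_ae (rat_obox q) g mq iq (integral_box_eq0 qO) Qbox.
  by apply: filterS => p gp _ /gp.
move: aeQ; apply: filterS => p Qp Op.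
have [q qp qO] := open_rat_box oO Op.
by have := Qp (pickle q); rewrite pickleK; apply.
Qed.

End Vanishing.

End FundamentalLemma.

(** * The Poincaré inequality on boxes *)

Section RealFubini.
Context {R : realType}.
Local Notation mu := (@mu2 R).
Local Notation leb := (@lebesgue_measure R).
Variables (I J : set R) (f : R * R -> R).
Hypotheses (mI : @measurable _ (line R) I) (mJ : @measurable _ (line R) J).
Hypothesis If : mu.-integrable (I `*` J) (EFin \o f).

Let mIJ : @measurable _ (plane R) (I `*` J). Proof. exact: measurableX. Qed.

Let g : plane R -> \bar R := (EFin \o f) \_ (I `*` J).

Let ig : mu.-integrable setT g.
Proof. by apply/(integrable_mkcond _ mIJ). Qed.

(** Integrability of each slice ensures that the real inner integral, a [fine], agrees everywhere
    with the extended one. The library theorem is applied to the extension of [f] by zero to the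
    whole plane. *)
Lemma Rfubini21 : (forall y, J y -> leb.-integrable I (fun x => (f (x, y))%:E)) ->
  leb.-integrable J (fun y => (\int[leb]_(x in I) f (x, y))%:E) /\
  \int[mu]_(p in I `*` J) f p = \int[leb]_(y in J) \int[leb]_(x in I) f (x, y).
Proof.
move=> Iy.
pose G (y : line R) := ((fun y => (\int[leb]_(x in I) f (x, y))%:E) \_ J) y.
have GE : fubini_G leb g = G.
  apply/funext => y; rewrite /fubini_G /G patchE; case: ifPn => [|/negP] yJ.
    rewrite inE in yJ; rewrite fineK; last exact: (integrable_fin_num mI (Iy y yJ)).
    rewrite [RHS]integral_mkcond; apply: eq_integral => x _.
    rewrite /g !patchE; congr (if _ then _ else _).
    by apply/idP/idP; rewrite !inE; [case|split].
  rewrite -[RHS](integral0 leb setT); apply: eq_integral => x _.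
  rewrite /g patchE memNset// => -[_ /= Jy]; apply: yJ; exact/mem_set.
split.
  apply/(integrable_mkcond _ mJ); rewrite -[X in leb.-integrable _ X]/G -GE.
  have mg := measurable_int _ ig.
  apply/integrableP; split.
    exact: (@measurable_fubini_G _ _ (line R) (line R) R leb leb g ig).
  apply: le_lt_trans ((@integrable21ltyP _ _ (line R) (line R) R leb leb g mg).1 ig).
  apply: ge0_le_integral => //.
  - apply: measurableT_comp => //.
    exact: (@measurable_fubini_G _ _ (line R) (line R) R leb leb g ig).
  - apply: (@measurable_fun_fubini_tonelli_G _ _ (line R) (line R) R leb (abse \o g)) => [|z];
      last exact: abse_ge0.
    exact: measurableT_comp.
  - move=> y _; apply: le_abse_integral => //.
    exact: measurable_fun_pair1.
have := @integral21_prod_meas1 _ _ (line R) (line R) R leb leb g ig.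
rewrite GE /G -integral_mkcond => H.
by rewrite /Rintegral H [in LHS]integral_mkcond.
Qed.

Lemma Rfubini12 : (forall x, I x -> leb.-integrable J (fun y => (f (x, y))%:E)) ->
  leb.-integrable I (fun x => (\int[leb]_(y in J) f (x, y))%:E) /\
  \int[mu]_(p in I `*` J) f p = \int[leb]_(x in I) \int[leb]_(y in J) f (x, y).
Proof.
move=> Ix.
pose F (x : line R) := ((fun x => (\int[leb]_(y in J) f (x, y))%:E) \_ I) x.
have FE : fubini_F leb g = F.
  apply/funext => x; rewrite /fubini_F /F patchE; case: ifPn => [|/negP] xI.
    rewrite inE in xI; rewrite fineK; last exact: (integrable_fin_num mJ (Ix x xI)).
    rewrite [RHS]integral_mkcond; apply: eq_integral => y _.
    rewrite /g !patchE; congr (if _ then _ else _).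
    by apply/idP/idP; rewrite !inE; [case|split].
  rewrite -[RHS](integral0 leb setT); apply: eq_integral => y _.
  rewrite /g patchE memNset// => -[/= Ix' _]; apply: xI; exact/mem_set.
split.
  apply/(integrable_mkcond _ mI); rewrite -[X in leb.-integrable _ X]/F -FE.
  exact: (@integrable_fubini_F _ _ (line R) (line R) R leb leb g ig).
have := @integral12_prod_meas1 _ _ (line R) (line R) R leb leb g ig.
rewrite FE /F -integral_mkcond => H.
by rewrite /Rintegral H [in LHS]integral_mkcond.
Qed.

End RealFubini.

Lemma Rintegral_subset d (T : measurableType d) (R : realType)
    (mu : {measure set T -> \bar R}) (A B : set T) (f : T -> R) :
  measurable A -> measurable B -> mu.-integrable B (EFin \o f) ->
  A `<=` B -> (forall x, B x -> 0 <= f x) ->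
  \int[mu]_(x in A) f x <= \int[mu]_(x in B) f x.
Proof.
move=> mA mB iB AB f0; rewrite fine_le//.
- exact: (integrable_fin_num mA (integrableS mB mA AB iB)).
- exact: (integrable_fin_num mB iB).
- by apply: ge0_subset_integral => //; exact: measurable_int iB.
Qed.

Section Interval.
Context {R : realType}.
Local Notation leb := (@lebesgue_measure R).
Implicit Types (f : R -> R) (a b c : R).

Lemma lebesgue_measure_co a b : a <= b -> leb `[a, b[%classic = (b - a)%:E.
Proof.
move=> ab; rewrite lebesgue_measure_itv/= lte_fin.
by case: ltgtP ab => // -> _; rewrite subrr.
Qed.

Lemma Rintegral_co_cst a b c : a <= b -> \int[leb]_(x in `[a, b[) c = c * (b - a).
Proof.
move=> ab; rewrite Rintegral_cst//; congr (_ * _).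
by rewrite (_ : _ `[a, b[%classic = (b - a)%:E)//; exact: lebesgue_measure_co.
Qed.

Lemma continuous_integrable_co f a b : continuous f ->
  leb.-integrable `[a, b[ (EFin \o f).
Proof.
move=> cf; apply: (@integrableS _ _ _ leb `[a, b]%classic) => //.
  by move=> x /=; exact: subset_itv_co_cc.
apply: continuous_compact_integrable; first exact: segment_compact.
exact: continuous_subspaceT.
Qed.

Lemma continuous_sqint_co f a b : continuous f -> sqint leb `[a, b[ f.
Proof.
move=> cf; split; last first.
  by apply: (@continuous_integrable_co (fun x => f x ^+ 2)) => x; apply: cvgM; exact: cf.
by apply: measurable_funTS; exact: continuous_measurable_fun.
Qed.

Lemma FTC2_co (F f : R -> R) a b : a <= b -> continuous f ->
  (forall x, is_derive x (1 : R) F (f x)) ->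
  \int[leb]_(x in `[a, b[) f x = F b - F a.
Proof.
rewrite le_eqVlt => /predU1P[<-|ab] cf dF; first by rewrite set_itvco0 Rintegral_set0 subrr.
have cF : continuous F.
  move=> x; apply: differentiable_continuous; apply/derivable1_diffP.
  by have [] := dF x.
rewrite Rintegral_itv_bndo_bndc; last exact: continuous_integrable_co.
rewrite /Rintegral (@continuous_FTC2 _ f F a b)//.
- exact: continuous_subspaceT.
- split => [x _||]; first by have [] := dF x.
    by apply: cvg_at_right_filter; exact: cF.
  by apply: cvg_at_left_filter; exact: cF.
- by move=> x _; rewrite derive1E; have [] := dF x.
Qed.

(* The mean minimises the mean square deviation, so that any [c] bounds it. *)
Lemma mean_square_deviation f a b c : a < b -> sqint leb `[a, b[ f ->
  \int[leb]_(x in `[a, b[) f x ^+ 2 <=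
  (b - a)^-1 * (\int[leb]_(x in `[a, b[) f x) ^+ 2 +
  \int[leb]_(x in `[a, b[) (f x - c) ^+ 2.
Proof.
move=> ab sf; have mD : measurable (`[a, b[%classic : set (line R)) by exact: measurable_itv.
have finD : (leb `[a, b[%classic < +oo)%E by rewrite lebesgue_measure_co ?ltry// ltW.
have if1 := sqint_integrable mD finD sf.
have if2 : leb.-integrable `[a, b[ (EFin \o (fun x => f x ^+ 2)) by case: sf.
have ic k : leb.-integrable `[a, b[ (EFin \o cst k).
  exact: (sqint_integrable mD finD (sqint_cst mD finD k)).
set m := \int[leb]_(x in `[a, b[) f x.
have -> : \int[leb]_(x in `[a, b[) (f x - c) ^+ 2 =
    \int[leb]_(x in `[a, b[) f x ^+ 2 + (- (2 * c) * m + c ^+ 2 * (b - a)).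
  under eq_Rintegral => x _.
    rewrite (_ : (f x - c) ^+ 2 = f x ^+ 2 + (- (2 * c) * f x + cst (c ^+ 2) x));
      last by rewrite /=; ring.
    over.
  have i1 : leb.-integrable `[a, b[ (EFin \o (fun x => - (2 * c) * f x)).
    exact: (integrableZl mD (- (2 * c)) if1).
  rewrite RintegralD//; last exact: (integrableD mD i1 (ic _)).
  rewrite RintegralD//.
  by rewrite RintegralZl// Rintegral_co_cst ?ltW.
have d0 : 0 < b - a by rewrite subr_gt0.
have -> : (b - a)^-1 * m ^+ 2 + (\int[leb]_(x in `[a, b[) f x ^+ 2 +
   (- (2 * c) * m + c ^+ 2 * (b - a))) =
  \int[leb]_(x in `[a, b[) f x ^+ 2 + (b - a)^-1 * (m - c * (b - a)) ^+ 2.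
  by field; rewrite lt0r_neq0.
by rewrite lerDl mulr_ge0 ?sqr_ge0// invr_ge0 ltW.
Qed.

Lemma Rintegral_sqr_le f a b : a <= b -> sqint leb `[a, b[ f ->
  (\int[leb]_(x in `[a, b[) f x) ^+ 2 <= (b - a) * \int[leb]_(x in `[a, b[) f x ^+ 2.
Proof.
move=> ab sf; have mD : measurable (`[a, b[%classic : set (line R)) by exact: measurable_itv.
have finD : (leb `[a, b[%classic < +oo)%E by rewrite lebesgue_measure_co ?ltry.
have := sip_cauchy_schwarz (sq_semi_ip leb mD) (sqint_cst mD finD 1) sf.
have -> : sq_ip leb `[a, b[ (cst 1) f = \int[leb]_(x in `[a, b[) f x.
  by apply: eq_Rintegral => x _; rewrite mul1r.
have -> : sq_ip leb `[a, b[ (cst 1) (cst 1) = b - a.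
  by rewrite -[RHS]mul1r -Rintegral_co_cst//; apply: eq_Rintegral => x _; rewrite mulr1.
by [].
Qed.

Lemma increment_sqr_le (F f : R -> R) a b x : continuous f ->
  (forall x, is_derive x (1 : R) F (f x)) -> a <= x <= b ->
  (F x - F a) ^+ 2 <= (b - a) * \int[leb]_(x in `[a, b[) f x ^+ 2.
Proof.
move=> cf dF /andP[ax xb]; rewrite -(FTC2_co ax cf dF).
apply: le_trans (Rintegral_sqr_le ax (continuous_sqint_co a x cf)) _.
have cf2 : continuous (fun x => f x ^+ 2) by move=> y; apply: cvgM; exact: cf.
apply: ler_pM => //; rewrite ?subr_ge0 ?lerD2r//.
  by apply: Rintegral_ge0 => y _; rewrite sqr_ge0.
apply: Rintegral_subset => //; [exact: continuous_integrable_co| |by move=> *; exact: sqr_ge0].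
by move=> y /=; rewrite !in_itv/= => /andP[-> /lt_le_trans->].
Qed.

End Interval.

Section BoxIntegral.
Context {R : realType}.
Local Notation mu := (@mu2 R).
Local Notation leb := (@lebesgue_measure R).
Implicit Types (f u : R * R -> R) (a b c d : R).

Lemma leb_co_lty a b : (leb `[a, b[%classic < +oo)%E.
Proof. by rewrite lebesgue_measure_itv/=; case: ifP => _; rewrite ?ltry// -EFinB ltry. Qed.

(** Half-open, so that cutting a box yields disjoint boxes of the same kind that cover it
    exactly. *)
Definition hbox a b c d : set (R * R) := `[a, b[ `*` `[c, d[.

Lemma measurable_hbox a b c d : @measurable _ (plane R) (hbox a b c d).
Proof. by apply: measurableX => //; exact: measurable_itv. Qed.

Lemma hbox_sub_cbox a b c d : hbox a b c d `<=` cbox a b c d.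
Proof. by move=> p [p1 p2]; split; [exact: subset_itv_co_cc p1|exact: subset_itv_co_cc p2]. Qed.

Lemma mu2_hbox_lty a b c d : (mu (hbox a b c d) < +oo)%E.
Proof.
apply: mu2_bounded_lty; first exact: measurable_hbox.
have /compact_bounded[M [Mr MK]] : compact (cbox a b c d).
  by apply: compact_setX; exact: segment_compact.
by exists M; split => // x Mx p /hbox_sub_cbox; exact: MK.
Qed.

Lemma continuous_bounded_hbox f a b c d : continuous f ->
  exists2 M : R, 0 <= M & forall p, hbox a b c d p -> `|f p| <= M.
Proof.
move=> cf; have cK : compact (cbox a b c d).
  by apply: compact_setX; exact: segment_compact.
have /compact_bounded[M [_ MK]] : compact (f @` cbox a b c d).
  by apply: continuous_compact => //; exact: continuous_subspaceT.
exists (`|M| + 1) => [|p /hbox_sub_cbox Kp]; first by rewrite addr_ge0.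
by apply: (MK (`|M| + 1)); [rewrite ltr_pwDr// ler_norm|exists p].
Qed.

Lemma continuous_sqint_hbox f a b c d : continuous f -> sqint mu (hbox a b c d) f.
Proof.
move=> cf; have [M _ fM] := continuous_bounded_hbox a b c d cf.
apply: (@sqint_bounded _ (plane R) R mu (hbox a b c d) (measurable_hbox _ _ _ _)
  (mu2_hbox_lty _ _ _ _) f M) => //.
exact: (measurable_funTS (continuous_measurable_fun2 cf)).
Qed.

Lemma continuous_integrable_hbox f a b c d : continuous f ->
  mu.-integrable (hbox a b c d) (EFin \o f).
Proof.
move=> cf; exact: (@sqint_integrable _ (plane R) R mu (hbox a b c d)
  (measurable_hbox _ _ _ _) (mu2_hbox_lty _ _ _ _) f (continuous_sqint_hbox _ _ _ _ cf)).
Qed.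

Lemma continuous_slice1 f (y : R) : continuous f -> continuous (fun x => f (x, y)).
Proof.
move=> cf x; apply: (@continuous_comp _ _ _ (fun x => (x, y)) f); last exact: cf.
exact: (cvg_pair (f := id) (g := cst y) (G := nbhs x) (H := nbhs y) cvg_id (cvg_cst y)).
Qed.

Lemma continuous_slice2 f (x : R) : continuous f -> continuous (fun y => f (x, y)).
Proof.
move=> cf y; apply: (@continuous_comp _ _ _ (fun y => (x, y)) f); last exact: cf.
exact: (cvg_pair (f := cst x) (g := id) (G := nbhs x) (H := nbhs y) (cvg_cst x) cvg_id).
Qed.

Lemma hbox_fubini21 f a b c d : continuous f ->
  leb.-integrable `[c, d[ (fun y => (\int[leb]_(x in `[a, b[) f (x, y))%:E) /\
  \int[mu]_(p in hbox a b c d) f p =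
  \int[leb]_(y in `[c, d[) \int[leb]_(x in `[a, b[) f (x, y).
Proof.
move=> cf; apply: Rfubini21; [exact: measurable_itv|exact: measurable_itv| |].
  exact: continuous_integrable_hbox.
by move=> y _; apply: continuous_integrable_co; exact: continuous_slice1.
Qed.

Lemma hbox_fubini12 f a b c d : continuous f ->
  leb.-integrable `[a, b[ (fun x => (\int[leb]_(y in `[c, d[) f (x, y))%:E) /\
  \int[mu]_(p in hbox a b c d) f p =
  \int[leb]_(x in `[a, b[) \int[leb]_(y in `[c, d[) f (x, y).
Proof.
move=> cf; apply: Rfubini12; [exact: measurable_itv|exact: measurable_itv| |].
  exact: continuous_integrable_hbox.
by move=> x _; apply: continuous_integrable_co; exact: continuous_slice2.
Qed.

Lemma continuous_sqr f : continuous f -> continuous (fun p => f p ^+ 2).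
Proof. by move=> cf p; apply: cvgM; exact: cf. Qed.

Section Poincare.
Variables (u u1 u2 : R * R -> R) (a c h : R).
Hypotheses (h0 : 0 < h) (cu : continuous u) (c1 : continuous u1) (c2 : continuous u2).
Hypothesis d1 : forall p, is_derive p ex u (u1 p).
Hypothesis d2 : forall p, is_derive p ey u (u2 p).
Let I : set R := `[a, (a + h)[%classic.
Let J : set R := `[c, (c + h)[%classic.
Let Q := hbox a (a + h) c (c + h).
Let U y := \int[leb]_(x in I) u (x, y).

Let mI : @measurable _ (line R) I. Proof. exact: measurable_itv. Qed.
Let mJ : @measurable _ (line R) J. Proof. exact: measurable_itv. Qed.
Let hle : 0 <= h. Proof. exact: ltW. Qed.
Let ah : a < a + h. Proof. by rewrite ltrDl. Qed.
Let ch : c < c + h. Proof. by rewrite ltrDl. Qed.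
Let ahE : a + h - a = h. Proof. by rewrite addrC addKr. Qed.
Let chE : c + h - c = h. Proof. by rewrite addrC addKr. Qed.

Let sU : sqint leb J U.
Proof.
have [M M0 uM] := continuous_bounded_hbox a (a + h) c (c + h) cu.
apply: (@sqint_bounded _ (line R) R leb J mJ _ U (M * h)).
- exact: leb_co_lty.
- have [+ _] := hbox_fubini21 a (a + h) c (c + h) cu.
  by move/measurable_int => /measurable_EFinP.
move=> y Jy; rewrite /U.
have iu : leb.-integrable I (EFin \o (fun x => u (x, y))).
  by apply: continuous_integrable_co; exact: continuous_slice1.
apply: le_trans (le_normr_Rintegral mI iu) _.
rewrite -[X in M * X]ahE -Rintegral_co_cst; last exact: ltW.
apply: le_Rintegral => //.
- exact: (integrable_norm iu).
- by apply: (@continuous_integrable_co _ (cst M)) => x; exact: cvg_cst.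
- by move=> x Ix; exact: uM.
Qed.

Let inner_y y : \int[leb]_(x in I) u (x, y) ^+ 2 <=
  h^-1 * U y ^+ 2 + h ^+ 2 * \int[leb]_(x in I) u1 (x, y) ^+ 2.
Proof.
have cuy := continuous_slice1 (y := y) cu.
apply: le_trans (mean_square_deviation (u (a, y)) ah (continuous_sqint_co a (a + h) cuy)) _.
rewrite ahE lerD2l; set K := \int[leb]_(x in I) _ ^+ 2.
rewrite (_ : h ^+ 2 * K = (h * K) * (a + h - a)); last by rewrite ahE; ring.
rewrite -Rintegral_co_cst; last exact: ltW.
apply: le_Rintegral => //.
- apply: (@continuous_integrable_co _ (fun x => (u (x, y) - u (a, y)) ^+ 2)).
  by move=> x; apply: cvgM; apply: cvgB; [exact: cuy|exact: cvg_cst|exact: cuy|exact: cvg_cst].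
- by apply: (@continuous_integrable_co _ (cst _)) => x; exact: cvg_cst.
move=> x; rewrite /= in_itv/= => /andP[ax xah].
rewrite /K -[X in X * _]ahE.
apply: (@increment_sqr_le R (fun x => u (x, y)) (fun x => u1 (x, y))).
- exact: continuous_slice1.
- by move=> z; apply/is_derive_exE; exact: d1.
- by rewrite ax ltW.
Qed.

Let U_increment y : J y -> (U y - U c) ^+ 2 <= h ^+ 2 * \int[mu]_(p in Q) u2 p ^+ 2.
Proof.
move=> Jy.
have cuy := continuous_slice1 (y := y) cu.
have cuc := continuous_slice1 (y := c) cu.
have cd : continuous (fun x => u (x, y) - u (x, c)).
  by move=> x; apply: cvgB; [exact: cuy|exact: cuc].
rewrite /U -RintegralB//; [|exact: continuous_integrable_co..].
apply: le_trans (Rintegral_sqr_le (ltW ah) (continuous_sqint_co a (a + h) cd)) _.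
rewrite ahE expr2 -mulrA ler_wpM2l//.
have [i2 ->] := hbox_fubini12 a (a + h) c (c + h) (continuous_sqr c2).
rewrite -RintegralZl//; apply: le_Rintegral => //.
- apply: (@continuous_integrable_co _ (fun x => (u (x, y) - u (x, c)) ^+ 2)).
  by move=> x; apply: cvgM; exact: cd.
- exact: (integrableZl mI h i2).
move=> x Ix; rewrite -[X in X * _]chE.
apply: (@increment_sqr_le R (fun y => u (x, y)) (fun y => u2 (x, y))).
- exact: continuous_slice2.
- by move=> z; apply/is_derive_eyE; exact: d2.
- by move: Jy; rewrite /J/= in_itv/= => /andP[-> /ltW].
Qed.

(** Two one-dimensional steps. On each horizontal line, the deviation from the value at the left end
    is bounded through [u1], leaving [h^-1 * U y ^+ 2]. The line integrals [U] are then treated in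
    the same way in [y], their increments being bounded through [u2]. The factor [h ^- 2] is the
    inverse of the area. *)
Lemma box_poincare :
  \int[mu]_(p in Q) u p ^+ 2 <= h ^- 2 * (\int[mu]_(p in Q) u p) ^+ 2 +
  h ^+ 2 * (\int[mu]_(p in Q) u1 p ^+ 2 + \int[mu]_(p in Q) u2 p ^+ 2).
Proof.
have [iu2 ->] := hbox_fubini21 a (a + h) c (c + h) (continuous_sqr cu).
have [i1 E1] := hbox_fubini21 a (a + h) c (c + h) (continuous_sqr c1).
have [iU EU] := hbox_fubini21 a (a + h) c (c + h) cu.
have iU2 : leb.-integrable J (EFin \o (fun y => U y ^+ 2)) by case: sU.
have iZ1 : leb.-integrable J (EFin \o (fun y => h^-1 * U y ^+ 2)).
  exact: (integrableZl mJ h^-1 iU2).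
have iZ2 : leb.-integrable J
    (EFin \o (fun y => h ^+ 2 * \int[leb]_(x in I) u1 (x, y) ^+ 2)).
  exact: (integrableZl mJ (h ^+ 2) i1).
apply: (@le_trans _ _ (\int[leb]_(y in J)
    (h^-1 * U y ^+ 2 + h ^+ 2 * \int[leb]_(x in I) u1 (x, y) ^+ 2))).
  by apply: le_Rintegral => //; exact: (integrableD mJ iZ1 iZ2).
rewrite RintegralD// RintegralZl// RintegralZl// -E1.
have fin : (leb J < +oo)%E by exact: leb_co_lty.
have step : \int[leb]_(y in J) U y ^+ 2 <=
    h^-1 * (\int[mu]_(p in Q) u p) ^+ 2 + h ^+ 3 * \int[mu]_(p in Q) u2 p ^+ 2.
  apply: le_trans (mean_square_deviation (U c) ch sU) _.
  rewrite chE EU lerD2l; set K := \int[mu]_(p in Q) _.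
  rewrite (_ : h ^+ 3 * K = (h ^+ 2 * K) * (c + h - c)); last by rewrite chE; ring.
  have sUc : sqint leb J (U - cst (U c)).
    exact: (sip_memB (sq_semi_ip leb mJ) sU (sqint_cst mJ fin _)).
  rewrite -Rintegral_co_cst; last exact: ltW.
  apply: le_Rintegral => //; first by case: sUc.
  by apply: (@continuous_integrable_co _ (cst _)) => x; exact: cvg_cst.
have : h^-1 * \int[leb]_(y in J) U y ^+ 2 <= h^-1 *
    (h^-1 * (\int[mu]_(p in Q) u p) ^+ 2 + h ^+ 3 * \int[mu]_(p in Q) u2 p ^+ 2).
  by rewrite ler_wpM2l// invr_ge0 ltW.
move=> H.
rewrite [leRHS](_ : _ = h^-1 *
    (h^-1 * (\int[mu]_(p in Q) u p) ^+ 2 + h ^+ 3 * \int[mu]_(p in Q) u2 p ^+ 2) +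
    h ^+ 2 * \int[mu]_(p in Q) u1 p ^+ 2); first by rewrite lerD2r.
by field; rewrite lt0r_neq0.
Qed.

End Poincare.
End BoxIntegral.

(** * Dyadic subdivision of a square *)

Section Cells.
Context {R : realType}.
Local Notation mu := (@mu2 R).
Implicit Types (f u : R * R -> R) (a b c d h : R) (p : R * R).

Definition cell h p : set (R * R) := hbox p.1 (p.1 + h) p.2 (p.2 + h).

Lemma hbox_split1 f a b b' c d : continuous f -> a <= b -> b <= b' ->
  \int[mu]_(p in hbox a b' c d) f p =
  \int[mu]_(p in hbox a b c d) f p + \int[mu]_(p in hbox b b' c d) f p.
Proof.
move=> cf ab bb'; have E : hbox a b' c d = hbox a b c d `|` hbox b b' c d.
  apply/seteqP; split => [p [/=]|p [] [/=]]; rewrite !in_itv/=.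
  - move=> /andP[h1 h2] h3; have [h4|h4] := ltP p.1 b; [left|right];
      by split => //=; rewrite in_itv/= ?h1 ?h4.
  - by move=> /andP[h1 h2] h3; split => //=; rewrite in_itv/= h1 (lt_le_trans h2).
  - by move=> /andP[h1 h2] h3; split => //=; rewrite in_itv/= h2 (le_trans ab).
rewrite E Rintegral_setU//; try exact: measurable_hbox.
  by rewrite -E; exact: continuous_integrable_hbox.
apply/disj_setPS => p [[/= + _] [/= + _]]; rewrite !in_itv/= => /andP[_ h1] /andP[h2 _].
by move: (lt_le_trans h1 h2); rewrite ltxx.
Qed.

Lemma hbox_split2 f a b c d d' : continuous f -> c <= d -> d <= d' ->
  \int[mu]_(p in hbox a b c d') f p =
  \int[mu]_(p in hbox a b c d) f p + \int[mu]_(p in hbox a b d d') f p.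
Proof.
move=> cf cd dd'; have E : hbox a b c d' = hbox a b c d `|` hbox a b d d'.
  apply/seteqP; split => [p [/=]|p [] [/=]]; rewrite !in_itv/=.
  - move=> h3 /andP[h1 h2]; have [h4|h4] := ltP p.2 d; [left|right];
      by split => //=; rewrite in_itv/= ?h1 ?h4.
  - by move=> h3 /andP[h1 h2]; split => //=; rewrite in_itv/= h1 (lt_le_trans h2).
  - by move=> h3 /andP[h1 h2]; split => //=; rewrite in_itv/= h2 (le_trans cd).
rewrite E Rintegral_setU//; try exact: measurable_hbox.
  by rewrite -E; exact: continuous_integrable_hbox.
apply/disj_setPS => p [[/= _ +] [/= _ +]]; rewrite !in_itv/= => /andP[_ h1] /andP[h2 _].
by move: (lt_le_trans h1 h2); rewrite ltxx.
Qed.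

(** A square is represented by its lower left corner. *)
Definition quarters h p : seq (R * R) :=
  [:: p; (p.1 + h, p.2); (p.1, p.2 + h); (p.1 + h, p.2 + h)].

Lemma cell_split f h p : continuous f -> 0 <= h ->
  \int[mu]_(z in cell (h + h) p) f z =
  \sum_(q <- quarters h p) \int[mu]_(z in cell h q) f z.
Proof.
move=> cf h0; rewrite /quarters !big_cons big_nil addr0 /cell /= !addrA.
have le1 x : x <= x + h by rewrite lerDl.
rewrite (hbox_split1 p.2 (p.2 + h + h) cf (le1 p.1) (le1 _)).
rewrite (hbox_split2 p.1 (p.1 + h) cf (le1 p.2) (le1 _)).
rewrite (hbox_split2 (p.1 + h) (p.1 + h + h) cf (le1 p.2) (le1 _)).
by rewrite addrACA !addrA.
Qed.

Fixpoint cells (n : nat) h p : seq (R * R) :=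
  if n is n'.+1 then flatten [seq cells n' (h / 2) q | q <- quarters (h / 2) p]
  else [:: p].

(** At depth [n] the four quarters have the same final side as the whole square at depth [n.+1], so
    their inequalities carry equal coefficients and add up. The gradient receives an arbitrarily
    small factor while the remaining term sees finitely many averages: this is the source of
    compactness. *)
Lemma cells_poincare u u1 u2 n h p : 0 < h ->
  continuous u -> continuous u1 -> continuous u2 ->
  (forall q, is_derive q ex u (u1 q)) -> (forall q, is_derive q ey u (u2 q)) ->
  \int[mu]_(z in cell h p) u z ^+ 2 <=
  (h / 2 ^+ n) ^- 2 * (\sum_(q <- cells n h p) (\int[mu]_(z in cell (h / 2 ^+ n) q) u z) ^+ 2) +
  (h / 2 ^+ n) ^+ 2 *
    (\int[mu]_(z in cell h p) u1 z ^+ 2 + \int[mu]_(z in cell h p) u2 z ^+ 2).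
Proof.
move=> + cu c1 c2 d1 d2; elim: n h p => [|n ih] h p h0.
  by rewrite expr0 divr1 /= big_seq1; exact: box_poincare.
have h20 : 0 < h / 2 by rewrite divr_gt0.
have hE : h = h / 2 + h / 2 by rewrite [LHS]splitr.
have side : h / 2 / 2 ^+ n = h / 2 ^+ n.+1 by rewrite exprS invfM mulrA.
have split f : continuous f -> \int[mu]_(z in cell h p) f z =
    \sum_(q <- quarters (h / 2) p) \int[mu]_(z in cell (h / 2) q) f z.
  by move=> cf; rewrite {1}hE cell_split// ltW.
rewrite !split; try exact: continuous_sqr.
rewrite (_ : cells n.+1 h p = flatten [seq cells n (h / 2) q | q <- quarters (h / 2) p])//.
rewrite big_flatten big_map -big_split !mulr_sumr -big_split.
by apply: ler_sum => q _; have := ih (h / 2) q h20; rewrite side.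
Qed.

End Cells.

(** * Sobolev spaces *)

Section SumForms.
Context {R : realType} {E : lmodType R} (S : set E) (B C : E -> E -> R).

Lemma semi_ip_add : semi_ip S B -> semi_ip S C ->
  semi_ip S (fun u v => B u v + C u v).
Proof.
move=> SB SC; split => [|a u v|u v Su Sv|a u v w Su Sv Sw|u Su].
- exact: (sip0 SB).
- exact: (sip_closed SB).
- by rewrite (sipC SB)// (sipC SC).
- by rewrite (sipL SB)// (sipL SC)// mulrDr addrACA.
- by rewrite addr_ge0 ?(sip_ge0 SB) ?(sip_ge0 SC).
Qed.

End SumForms.

(** * Test functions and integration by parts *)

Section TestFunctions.
Context {R : realType}.
Local Notation mu := (@mu2 R).
Implicit Types (phi psi f g u v w : R * R -> R) (e p : R * R).

Lemma smooth_continuous phi : smooth phi -> continuous phi.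
Proof. by move=> /(_ [::])[]. Qed.

Lemma smooth_is_derive phi e p : axis e -> smooth phi ->
  is_derive p e phi ('D_e phi p).
Proof. by move=> ae /(_ [::])[_ /(_ p)[/= d1 d2]]; case: ae => ->; exact/derivableP. Qed.

(** [iter_partial] applies the head of the list last, so a derivative taken first sits at the end of
    the list. *)
Lemma iter_partial_rcons s b phi : iter_partial (rcons s b) phi =
  iter_partial s ('D_(if b then ex else ey) phi).
Proof. by elim: s => //= b' s ->. Qed.

Lemma smooth_partial phi e : axis e -> smooth phi -> smooth ('D_e phi).
Proof.
move=> ae sphi s.
have [b ->] : exists b : bool, e = if b then ex else ey.
  by case: ae => ->; [exists true|exists false].
by rewrite -iter_partial_rcons; exact: sphi.
Qed.

Lemma derive_lin (a : R) f g e p : derivable f p e -> derivable g p e ->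
  derivable (a *: f + g) p e /\ 'D_e (a *: f + g) p = a *: 'D_e f p + 'D_e g p.
Proof.
move=> df dg; have daf : derivable (a *: f) p e by exact: derivableZ.
split; first exact: derivableD.
by rewrite deriveD// deriveZ.
Qed.

Lemma iter_partial_lin (a : R) f g s : smooth f -> smooth g ->
  iter_partial s (a *: f + g) = a *: iter_partial s f + iter_partial s g.
Proof.
move=> sf sg; elim: s => //= b s ->; apply/funext => p.
have [_ /(_ p)[d1 d2]] := sf s; have [_ /(_ p)[d3 d4]] := sg s.
by case: b; rewrite (derive_lin a _ _).2.
Qed.

Lemma smooth_lin (a : R) f g : smooth f -> smooth g -> smooth (a *: f + g).
Proof.
move=> sf sg s; rewrite iter_partial_lin//.
have [cf df] := sf s; have [cg dg] := sg s; split => p.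
  by apply: cvgD; [apply: cvgZr; exact: cf|exact: cg].
have [d1 d2] := df p; have [d3 d4] := dg p.
by split; exact: (derive_lin a _ _).1.
Qed.

Lemma smooth0 : smooth (0 : R * R -> R).
Proof.
move=> s; suff -> : iter_partial s (0 : R * R -> R) = 0.
  by split => p; [exact: cvg_cst|split; exact: derivable_cst].
by elim: s => //= b s ->; apply/funext => p; exact: derive_cst.
Qed.

Lemma derive_out (K : set (R * R)) f e p : closed K -> (forall q, ~ K q -> f q = 0) ->
  ~ K p -> 'D_e f p = 0.
Proof.
move=> cK f0 Kp; rewrite (@near_eq_derive _ _ _ f (cst 0)) ?derive_cst//.
have : nbhs p (~` K) by apply: open_nbhs_nbhs; split => //; exact: closed_openC.
by apply: filterS => q /f0.
Qed.

Variable Omega : set (R * R).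
Hypotheses (oO : open Omega) (bO : bounded_set Omega).

Let mO : @measurable _ (plane R) Omega. Proof. exact: open_measurable2. Qed.

Lemma test0 : test_fun Omega 0.
Proof. by split; [exact: smooth0|exists set0; split => //; exact: compact0]. Qed.

Lemma test_lin (a : R) phi psi : test_fun Omega phi -> test_fun Omega psi ->
  test_fun Omega (a *: phi + psi).
Proof.
move=> [s1 [K1 [c1 O1 z1]]] [s2 [K2 [c2 O2 z2]]]; split; first exact: smooth_lin.
exists (K1 `|` K2); split => [||p /not_orP[h1 h2]].
- exact: compactU.
- by rewrite subUset.
- by rewrite (_ : (_ + _) p = a * phi p + psi p)// z1// z2// mulr0 addr0.
Qed.

Lemma test_partial phi e : axis e -> test_fun Omega phi -> test_fun Omega ('D_e phi).
Proof.
move=> ae [sphi [K [cK KO phi0]]]; split; first exact: smooth_partial.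
exists K; split => // p Kp; apply: derive_out Kp => //.
by apply: compact_closed cK; exact: norm_hausdorff.
Qed.

Lemma test_continuous phi : test_fun Omega phi -> continuous phi.
Proof. by move=> [/smooth_continuous]. Qed.

Lemma test_is_derive phi e p : axis e -> test_fun Omega phi ->
  is_derive p e phi ('D_e phi p).
Proof. by move=> ae [sphi _]; exact: smooth_is_derive. Qed.

Lemma test_out phi p : test_fun Omega phi -> ~ Omega p -> phi p = 0.
Proof. by move=> [_ [K [_ KO phi0]]] Op; apply: phi0 => /KO. Qed.

(** The margin 1 makes the inequalities strict: a function vanishing off [Omega] is then zero on the
    four sides of the square. *)
Lemma bounded_sub_hbox : exists2 L : R, 0 < L & forall p, Omega p -> 
  [/\ - L < p.1, p.1 < L, - L < p.2 & p.2 < L].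
Proof.
have [L L0 OL] := bounded_sub_cbox bO; exists (L + 1); first by rewrite addr_gt0.
move=> p /OL [/=]; rewrite !in_itv/= => /andP[h1 h2] /andP[h3 h4].
by split; lra.
Qed.

Lemma Rintegral_support (A B : set (R * R)) f :
  (forall p, ~ A p -> f p = 0) -> (forall p, ~ B p -> f p = 0) ->
  \int[mu]_(p in A) f p = \int[mu]_(p in B) f p.
Proof.
move=> fA fB; rewrite Rintegral_mkcond [RHS]Rintegral_mkcond.
congr (Rintegral _ _); apply/funext => p; rewrite !patchE.
case: ifPn => [_|/negP pA]; case: ifPn => [_|/negP pB] //.
  by apply: fB => Bp; apply: pB; exact: mem_set.
by apply/esym/fA => Ap; apply: pA; exact: mem_set.
Qed.

Lemma finO : (mu Omega < +oo)%E. Proof. exact: mu2_bounded_lty. Qed.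

Lemma test_L2 phi : test_fun Omega phi -> L2 Omega phi.
Proof.
move=> tphi; have cphi := test_continuous tphi.
have [L L0 OL] := bounded_sub_hbox.
have [M M0 phiM] := continuous_bounded_hbox (- L) L (- L) L cphi.
apply: (@sqint_bounded _ (plane R) R mu Omega mO finO phi M) => [|p Op].
  exact: (measurable_funTS (continuous_measurable_fun2 cphi)).
by have [h1 h2 h3 h4] := OL p Op; apply: phiM; split; rewrite /= in_itv/= ltW.
Qed.

(** On a square around [Omega], Fubini's theorem integrates first in the direction [e]; by the
    fundamental theorem of calculus each line contributes a difference of two boundary values, both
    zero. *)
Lemma integral_partial_eq0 f df e : axis e ->
  continuous f -> continuous df -> (forall p, is_derive p e f (df p)) ->
  (forall p, ~ Omega p -> f p = 0) -> (forall p, ~ Omega p -> df p = 0) ->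
  \int[mu]_(p in Omega) df p = 0.
Proof.
move=> ae cf cdf fdf f0 df0; have [L L0 OL] := bounded_sub_hbox.
have LL : - L <= L by lra.
rewrite (@Rintegral_support _ (hbox (- L) L (- L) L))//; last first.
  move=> p h; apply: df0 => /OL [h1 h2 h3 h4]; apply: h.
  by split; rewrite /= in_itv/= ltW.
have side p : p.1 = L \/ p.1 = - L \/ p.2 = L \/ p.2 = - L -> f p = 0.
  by move=> h; apply: f0 => /OL [h1 h2 h3 h4]; lra.
case: ae => ae; subst e.
- rewrite (hbox_fubini21 _ _ _ _ cdf).2.
  rewrite -[RHS](mul0r (L - - L)) -(Rintegral_co_cst 0 LL); apply: eq_Rintegral => y _.
  have dl x : is_derive x (1 : R) (fun x => f (x, y)) (df (x, y)) by apply/is_derive_exE.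
  rewrite (@FTC2_co _ (fun x => f (x, y)) (fun x => df (x, y)) _ _ LL (continuous_slice1 cdf) dl).
  by rewrite !side ?subrr//=; tauto.
- rewrite (hbox_fubini12 _ _ _ _ cdf).2.
  rewrite -[RHS](mul0r (L - - L)) -(Rintegral_co_cst 0 LL); apply: eq_Rintegral => x _.
  have dl y : is_derive y (1 : R) (fun y => f (x, y)) (df (x, y)) by apply/is_derive_eyE.
  rewrite (@FTC2_co _ (fun y => f (x, y)) (fun y => df (x, y)) _ _ LL (continuous_slice2 cdf) dl).
  by rewrite !side ?subrr//=; tauto.
Qed.

Lemma test_ibp phi psi e : axis e -> test_fun Omega phi -> test_fun Omega psi ->
  ip Omega phi ('D_e psi) = - ip Omega ('D_e phi) psi.
Proof.
move=> ae t1 t2; apply/eqP; rewrite -addr_eq0; apply/eqP.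
have i1 := @sqint_mul _ (plane R) R mu Omega mO _ _ (test_L2 t1) (test_L2 (test_partial ae t2)).
have i2 := @sqint_mul _ (plane R) R mu Omega mO _ _ (test_L2 (test_partial ae t1)) (test_L2 t2).
rewrite /ip -RintegralD//.
apply: (@integral_partial_eq0 (fun p => phi p * psi p) _ e ae).
- by move=> p; apply: cvgM; [exact: (test_continuous t1)|exact: (test_continuous t2)].
- have c1 := test_continuous (test_partial ae t1); have c2 := test_continuous (test_partial ae t2).
  move=> p; apply: cvgD; apply: cvgM; [exact: (test_continuous t1)|exact: c2|exact: c1|].
  exact: (test_continuous t2).
- move=> p; have d1 := test_is_derive p ae t1; have d2 := test_is_derive p ae t2.
  by apply: (is_derive_eq (is_deriveM d1 d2)); rewrite /GRing.scale/= [in X in _ + X]mulrC.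
- by move=> p Op; rewrite (test_out t1 Op) mul0r.
- by move=> p Op; rewrite (test_out t1 Op) (test_out t2 Op) mul0r mulr0 addr0.
Qed.

End TestFunctions.

(** * Weak derivatives and the forms on H^1 and H^2 *)

Section Sobolev.
Context {R : realType}.
Local Notation mu := (@mu2 R).
Variable Omega : set (R * R).
Hypotheses (oO : open Omega) (bO : bounded_set Omega).
Implicit Types (phi psi f g k u v w : R * R -> R) (e p : R * R).

Let mO : @measurable _ (plane R) Omega. Proof. exact: open_measurable2. Qed.
Let fO : (mu Omega < +oo)%E. Proof. exact: finO. Qed.

Local Notation L2 := (L2 Omega).
Local Notation ip := (ip Omega).
Local Notation wder := (wder Omega).
Local Notation H1 := (H1 Omega).
Local Notation H2 := (H2 Omega).
Local Notation H10 := (H10 Omega).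
Local Notation H20 := (H20 Omega).
Local Notation test := (test_fun Omega).
Local Notation weak := (is_weak_deriv Omega).
Local Notation lap := (lap Omega).
Local Notation l2norm := (l2norm Omega).
Local Notation gradnorm := (gradnorm Omega).
Local Notation grad_ip := (grad_ip Omega).
Local Notation "f =ae g" := (ae_eq mu Omega f g) (at level 70).

Lemma L2_semi_ip : semi_ip L2 ip.
Proof. exact: (@sq_semi_ip _ (plane R) R mu Omega mO). Qed.

Lemma ip_ae f g h : L2 f -> L2 g -> L2 h -> f =ae g -> ip f h = ip g h.
Proof. exact: (@sq_ip_ae_eq _ (plane R) R mu Omega mO). Qed.

Lemma ip_ae2 f f' g g' : L2 f -> L2 f' -> L2 g -> L2 g' -> f =ae f' -> g =ae g' ->
  ip f g = ip f' g'.
Proof.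
move=> Lf Lf' Lg Lg' ff' gg'; rewrite (ip_ae Lf Lf' Lg ff').
by rewrite (sipC L2_semi_ip)// (ip_ae Lg Lg' Lf' gg') (sipC L2_semi_ip).
Qed.

Lemma test_axis_L2 phi e : axis e -> test phi -> L2 ('D_e phi).
Proof. by move=> ae tp; exact: (test_L2 oO bO (test_partial ae tp)). Qed.

Lemma weak_unique v e g g' : weak e v g -> weak e v g' -> g =ae g'.
Proof.
move=> [Lg wg] [Lg' wg'].
have Ld : L2 (g - g') by exact: (sip_memB L2_semi_ip).
have : g - g' =ae cst 0.
  apply: (test_orthogonal_ae0 oO fO Ld) => phi tphi; have Lp := test_L2 oO bO tphi.
  by rewrite (sipBl L2_semi_ip)//; apply/eqP; rewrite subr_eq0 -eqr_opp -wg// -wg'.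
apply: filterS => p + Op => /(_ Op) h; apply/eqP; rewrite -subr_eq0; apply/eqP; exact: h.
Qed.

Lemma wderP v e : (exists g, weak e v g) -> weak e v (wder e v).
Proof. by move=> h; exact: (@xgetPex _ (cst 0) [set g | weak e v g]). Qed.

Lemma weak_ae v v' e g : L2 v -> L2 v' -> axis e -> v =ae v' -> weak e v g -> weak e v' g.
Proof.
move=> Lv Lv' ae vv' [Lg wg]; split => // phi tphi.
by rewrite -wg//; apply/esym/ip_ae => //; exact: test_axis_L2.
Qed.

Lemma weak_lin (a : R) v w e g k : axis e -> L2 v -> L2 w -> weak e v g -> weak e w k ->
  weak e (a *: v + w) (a *: g + k).
Proof.
move=> ae Lv Lw [Lg wg] [Lk wk]; split; first exact: (sip_closed L2_semi_ip).
move=> phi tphi; have Lp := test_L2 oO bO tphi; have LD := test_axis_L2 ae tphi.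
by rewrite !(sipL L2_semi_ip)// wg// wk// mulrN opprD.
Qed.

Lemma weak_test phi e : axis e -> test phi -> weak e phi ('D_e phi).
Proof.
move=> ae tphi; split; first exact: test_axis_L2.
by move=> psi tpsi; exact: test_ibp.
Qed.

Lemma H1_L2 v : H1 v -> L2 v. Proof. by case. Qed.

Lemma H1_weak v e : axis e -> H1 v -> weak e v (wder e v).
Proof. by move=> ae [_ /(_ e ae) h]; exact: wderP. Qed.

Lemma H1_wder_L2 v e : axis e -> H1 v -> L2 (wder e v).
Proof. by move=> ae /(H1_weak ae)[]. Qed.

Lemma H1_ae v v' : L2 v' -> v =ae v' -> H1 v -> H1 v'.
Proof.
move=> Lv' vv' [Lv wv]; split => // e ae; have [g wg] := wv e ae.
by exists g; exact: weak_ae wg.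
Qed.

Lemma wder_ae v v' e : axis e -> v =ae v' -> H1 v -> H1 v' -> wder e v =ae wder e v'.
Proof.
move=> ae vv' hv hv'; have wv := H1_weak ae hv; have wv' := H1_weak ae hv'.
by apply: weak_unique wv'; apply: weak_ae wv => //; exact: H1_L2.
Qed.

Lemma H1_lin (a : R) u v : H1 u -> H1 v -> H1 (a *: u + v).
Proof.
move=> hu hv; split; first by apply: (sip_closed L2_semi_ip); exact: H1_L2.
move=> e ae; exists (a *: wder e u + wder e v); apply: weak_lin => //;
  [exact: (H1_L2 hu)|exact: (H1_L2 hv)|exact: H1_weak..].
Qed.

Lemma wder_lin (a : R) u v e : axis e -> H1 u -> H1 v ->
  wder e (a *: u + v) =ae a *: wder e u + wder e v.
Proof.
move=> ae hu hv; apply: (@weak_unique (a *: u + v) e).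
  by apply: H1_weak => //; exact: H1_lin.
apply: weak_lin => //; [exact: (H1_L2 hu)|exact: (H1_L2 hv)|exact: H1_weak..].
Qed.

Lemma wder_test phi e : axis e -> test phi -> wder e phi =ae 'D_e phi.
Proof.
move=> ae tphi; have w := weak_test ae tphi; apply: (weak_unique _ w).
by apply: wderP; exists ('D_e phi).
Qed.

Lemma H1_test phi : test phi -> H1 phi.
Proof.
move=> tphi; split; first exact: test_L2.
by move=> e ae; exists ('D_e phi); exact: weak_test.
Qed.

Lemma H1_0 : H1 0. Proof. exact: (H1_test (test0 Omega)). Qed.

Lemma wder_semi_ip e : axis e -> semi_ip H1 (fun u v => ip (wder e u) (wder e v)).
Proof.
move=> ae; have S := L2_semi_ip; split => [|a u v|u v hu hv|a u v w hu hv hw|u hu].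
- exact: H1_0.
- exact: H1_lin.
- exact: (sipC S (H1_wder_L2 ae hu) (H1_wder_L2 ae hv)).
- have Lu := H1_wder_L2 ae hu; have Lv := H1_wder_L2 ae hv; have Lw := H1_wder_L2 ae hw.
  have Luv := H1_wder_L2 ae (H1_lin a hu hv).
  apply: etrans (sipL S a Lu Lv Lw).
  exact: (ip_ae Luv (sip_closed S a Lu Lv) Lw (wder_lin a ae hu hv)).
- by apply: (sip_ge0 S); exact: H1_wder_L2.
Qed.

Let axex : axis (ex : R * R). Proof. by left. Qed.
Let axey : axis (ey : R * R). Proof. by right. Qed.

Lemma grad_semi_ip : semi_ip H1 grad_ip.
Proof. by apply: semi_ip_add; exact: wder_semi_ip. Qed.

Lemma ip_semi_ip_H1 : semi_ip H1 ip.
Proof.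
apply: (semi_ip_sub L2_semi_ip); [exact: H1_L2|exact: H1_0|exact: H1_lin].
Qed.

Definition h1_ip u v := ip u v + grad_ip u v.

Lemma h1_semi_ip : semi_ip H1 h1_ip.
Proof. by apply: semi_ip_add; [exact: ip_semi_ip_H1|exact: grad_semi_ip]. Qed.

Lemma l2norm_sqr v : L2 v -> l2norm v ^+ 2 = ip v v.
Proof. exact: (sip_normE L2_semi_ip). Qed.

Lemma gradnorm_sqr v : H1 v -> gradnorm v ^+ 2 = grad_ip v v.
Proof. exact: (sip_normE grad_semi_ip). Qed.

Lemma H1norm_sqr v : H1 v -> H1norm Omega v ^+ 2 = h1_ip v v.
Proof.
move=> hv; rewrite /H1norm sqr_sqrtr ?addr_ge0 ?sqr_ge0//.
rewrite [X in _ + X](l2norm_sqr (H1_wder_L2 axey hv)).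
rewrite [X in _ + X + _](l2norm_sqr (H1_wder_L2 axex hv)).
by rewrite [X in X + _ + _](l2norm_sqr (H1_L2 hv)) -addrA.
Qed.

Lemma H1normE v : H1 v -> H1norm Omega v = sip_norm h1_ip v.
Proof. by move=> hv; rewrite /sip_norm -H1norm_sqr// sqrtr_sqr ger0_norm// sqrtr_ge0. Qed.

Lemma H10_H1 v : H10 v -> H1 v. Proof. by case. Qed.

Lemma H10_test phi : test phi -> H10 phi.
Proof.
move=> tphi; split; first exact: H1_test.
move=> eps eps0; exists phi => //; rewrite subrr H1normE; last exact: H1_0.
by rewrite /sip_norm (sip0l h1_semi_ip) ?sqrtr0//; exact: H1_0.
Qed.

Lemma H10_lin (a : R) u v : H10 u -> H10 v -> H10 (a *: u + v).
Proof.
move=> [hu au] [hv av]; split; first exact: H1_lin.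
move=> eps eps0; pose d := eps / (`|a| + 2).
have a2 : 0 < `|a| + 2 by rewrite ltr_wpDl.
have d0 : 0 < d by rewrite divr_gt0.
have [phi tphi nphi] := au _ d0; have [psi tpsi npsi] := av _ d0.
exists (a *: phi + psi); first exact: test_lin.
have hp := H1_test tphi; have hq := H1_test tpsi; have S := h1_semi_ip.
have hup : H1 (u - phi) by exact: (sip_memB S).
have hvq : H1 (v - psi) by exact: (sip_memB S).
rewrite (_ : _ - _ = a *: (u - phi) + (v - psi)); last first.
  by rewrite scalerBr opprD addrACA.
rewrite H1normE; last exact: H1_lin.
apply: le_lt_trans (sip_normD S (sip_memZ S a hup) hvq) _.
rewrite (sip_normZ S)// -!H1normE//.
have n1 := ler_wpM2l (normr_ge0 a) (ltW nphi).
have n2 : H1norm Omega (v - psi) < 2 * d by apply: (lt_trans npsi); rewrite ltr_pMl// ltr1n.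
apply: (lt_le_trans (ler_ltD n1 n2)).
by rewrite -mulrDl /d mulrC divfK// lt0r_neq0.
Qed.

Lemma H10_0 : H10 0. Proof. exact: (H10_test (test0 Omega)). Qed.

Lemma ip_semi_ip_H10 : semi_ip H10 ip.
Proof.
apply: (semi_ip_sub ip_semi_ip_H1); [exact: H10_H1|exact: H10_0|exact: H10_lin].
Qed.

Lemma grad_semi_ip_H10 : semi_ip H10 grad_ip.
Proof.
apply: (semi_ip_sub grad_semi_ip); [exact: H10_H1|exact: H10_0|exact: H10_lin].
Qed.

Lemma H1norm_ge v : H1 v -> l2norm v <= H1norm Omega v /\ gradnorm v <= H1norm Omega v.
Proof.
move=> hv; have i0 := sip_ge0 ip_semi_ip_H1 hv; have g0 := sip_ge0 grad_semi_ip hv.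
rewrite H1normE// /sip_norm /l2norm /gradnorm /h1_ip.
by split; apply: ler_wsqrtr; rewrite (lerDl, lerDr).
Qed.

Lemma H10_approx v eps : H10 v -> 0 < eps ->
  exists2 phi, test phi & l2norm (v - phi) < eps /\ gradnorm (v - phi) < eps.
Proof.
move=> [hv av] e0; have [phi tphi nphi] := av _ e0; exists phi => //.
have h : H1 (v - phi) by apply: (sip_memB h1_semi_ip) => //; exact: H1_test.
by have [h1 h2] := H1norm_ge h; split; exact: le_lt_trans nphi.
Qed.

Lemma H2_H1 v : H2 v -> H1 v. Proof. by case. Qed.

Lemma H2_wder v e : axis e -> H2 v -> H1 (wder e v).
Proof. by move=> ae [_ h1 h2]; case: ae => ->. Qed.

(** The derivative of the combination is only almost everywhere the combination of the derivatives;
    membership in [H1] is carried over by [H1_ae]. *)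
Lemma H2_lin (a : R) u v : H2 u -> H2 v -> H2 (a *: u + v).
Proof.
move=> hu hv; have h1u := H2_H1 hu; have h1v := H2_H1 hv.
have h1uv := H1_lin a h1u h1v.
have W e : axis e -> H1 (wder e (a *: u + v)).
  move=> ae; have h := H1_lin a (H2_wder ae hu) (H2_wder ae hv).
  apply: H1_ae h; first exact: H1_wder_L2.
  by apply: ae_eq_sym; exact: wder_lin.
by split => //; exact: W.
Qed.

Lemma lap_L2 v : H2 v -> L2 (lap v).
Proof.
move=> hv; apply: (sip_memD L2_semi_ip); apply: H1_wder_L2 => //; exact: H2_wder.
Qed.

Lemma lap_lin (a : R) u v : H2 u -> H2 v -> lap (a *: u + v) =ae a *: lap u + lap v.
Proof.
move=> hu hv; have huv := H2_lin a hu hv.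
have W e : axis e -> wder e (wder e (a *: u + v)) =ae
    a *: wder e (wder e u) + wder e (wder e v).
  move=> ae; have h := H1_lin a (H2_wder ae hu) (H2_wder ae hv).
  have A : wder e (wder e (a *: u + v)) =ae wder e (a *: wder e u + wder e v).
    apply: (wder_ae ae (wder_lin a ae (H2_H1 hu) (H2_H1 hv)) _ h).
    exact: H2_wder.
  exact: (ae_eq_trans A (wder_lin a ae (H2_wder ae hu) (H2_wder ae hv))).
move: (W _ axex) (W _ axey); apply: filterS2 => p h1 h2 Op.
have aux (x y z t : R) : a * x + y + (a * z + t) = a * (x + z) + (y + t).
  by rewrite mulrDr addrACA.
exact: (etrans (f_equal2 (fun x y : R => x + y) (h1 Op) (h2 Op)) (aux _ _ _ _)).
Qed.

Lemma H2_0 : H2 0.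
Proof.
have ax0 e : axis e -> H1 (wder e 0).
  move=> ae; have := H1_test (test_partial ae (test0 Omega)); apply: H1_ae.
    by apply: H1_wder_L2 => //; exact: H1_0.
  by apply: ae_eq_sym; exact: (wder_test ae (test0 Omega)).
by split; [exact: H1_0|exact: ax0..].
Qed.

Lemma lap_semi_ip : semi_ip H2 (fun u v => ip (lap u) (lap v)).
Proof.
have S := L2_semi_ip; split => [|a u v|u v hu hv|a u v w hu hv hw|u hu].
- exact: H2_0.
- exact: H2_lin.
- exact: (sipC S (lap_L2 hu) (lap_L2 hv)).
- have Lu := lap_L2 hu; have Lv := lap_L2 hv; have Lw := lap_L2 hw.
  apply: etrans (sipL S a Lu Lv Lw).
  exact: (ip_ae (lap_L2 (H2_lin a hu hv)) (sip_closed S a Lu Lv) Lw (lap_lin a hu hv)).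
- exact: (sip_ge0 S (lap_L2 hu)).
Qed.

Lemma l2norm_le_H1norm v : l2norm v <= H1norm Omega v.
Proof.
rewrite -[leLHS]ger0_norm ?sqrtr_ge0// -sqrtr_sqr; apply: ler_wsqrtr.
by rewrite -addrA lerDl addr_ge0// sqr_ge0.
Qed.

Lemma H20_H10 v : H20 v -> H10 v.
Proof.
move=> [hv av]; split; first exact: H2_H1.
move=> eps e0; have [phi tphi] := av _ e0; exists phi => //.
have h : H1 (v - phi).
  by apply: (sip_memB h1_semi_ip); [exact: H2_H1|exact: H1_test].
apply: le_lt_trans; last eassumption.
apply: ler_wsqrtr; set A := l2norm _ ^+ 2.
apply: lerD; [apply: lerD => //|]; rewrite lerXn2r ?nnegrE ?sqrtr_ge0//.
  by apply: l2norm_le_H1norm.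
by apply: l2norm_le_H1norm.
Qed.


(** Against a test function the identity is the definition of the weak derivatives of [wder e v].
    Both sides are continuous in their second argument for the H^1 norm, and test functions
    approximate [v] in that norm. *)
Lemma green v : H2 v -> H10 v -> grad_ip v v = - ip (lap v) v.
Proof.
move=> hv h10; have h1 := H2_H1 hv; have S := L2_semi_ip; have Lv := H1_L2 h1.
have Ll := lap_L2 hv.
have G phi : test phi -> grad_ip v phi = - ip (lap v) phi.
  move=> tphi; have Lp := test_L2 oO bO tphi.
  have W e : axis e -> ip (wder e v) (wder e phi) = - ip (wder e (wder e v)) phi.
    move=> ae; have Lw := H1_wder_L2 ae h1.
    have Lwp := H1_wder_L2 ae (H1_test tphi); have LD := test_axis_L2 ae tphi.
    rewrite (sipC S Lw Lwp) (ip_ae Lwp LD Lw (wder_test ae tphi)) (sipC S LD Lw).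
    by have [_ ->] := H1_weak ae (H2_wder ae hv).
  apply: etrans (f_equal2 (fun x y : R => x + y) (W ex axex) (W ey axey)) _.
  rewrite -opprD; congr (- _); apply/esym.
  exact: (sipDl S (H1_wder_L2 axex (H2_wder axex hv)) (H1_wder_L2 axey (H2_wder axey hv)) Lp).
apply/eqP; rewrite -subr_eq0 opprK -normr_le0; apply/ler_addgt0Pr => eps e0.
(* An approximation within [eps / M] in both norms costs at most the first two summands times
   [eps / M]; the summand 1 keeps [M] positive. *)
rewrite add0r; pose M := gradnorm v + l2norm (lap v) + 1.
have M0 : 0 < M by rewrite ltr_wpDl// addr_ge0// sqrtr_ge0.
have [phi tphi [n1 n2]] := H10_approx h10 (divr_gt0 e0 M0).
have hp := H1_test tphi; have hvp : H1 (v - phi) by exact: (sip_memB h1_semi_ip).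
have Lp := H1_L2 hp; have Lvp := H1_L2 hvp.
have -> : grad_ip v v + ip (lap v) v = grad_ip v (v - phi) + ip (lap v) (v - phi).
  have e1 := sipBr grad_semi_ip h1 hp h1; have e2 := sipBr S Lv Lp Ll.
  by rewrite e1 e2 (G _ tphi) opprK addrACA subrr addr0.
apply: le_trans (ler_normD _ _) _.
apply: (@le_trans _ _ (gradnorm v * (eps / M) + l2norm (lap v) * (eps / M))).
  apply: lerD.
    apply: le_trans (sip_cauchy_schwarz_norm grad_semi_ip h1 hvp) _.
    by rewrite ler_wpM2l ?sqrtr_ge0// ltW.
  apply: le_trans (sip_cauchy_schwarz_norm S Ll Lvp) _.
  by rewrite ler_wpM2l ?sqrtr_ge0// ltW.
rewrite -mulrDl mulrCA -[leRHS]mulr1; apply: (ler_wpM2l (ltW e0)).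
by rewrite (ler_pdivrMr _ _ M0) mul1r lerDl.
Qed.

End Sobolev.

(** * The ground state of the Dirichlet Laplacian *)

Section UltraLimit.
Context {R : realType}.

(** The limit is the supremum of the [x] that [U]-almost all terms exceed or equal; the ultrafilter
    property turns the failure of a lower bound slightly above it into an upper bound. A single
    ultrafilter serves all bounded sequences at once, so no diagonal extraction is needed. *)
Lemma ultra_bounded_cauchy (U : set_system nat) (a : nat -> R) (M : R) :
  UltraFilter U -> (forall k, `|a k| <= M) ->
  forall e, 0 < e -> exists2 B, U B & forall j k, B j -> B k -> `|a j - a k| <= e.
Proof.
move=> UU aM e e0; pose P := [set x : R | U [set k | x <= a k]].
have P0 : P (- M).
  apply: (@filterS _ U _ setT) => [k _ /=|]; last exact: filterT.
  by have := aM k; rewrite ler_norml => /andP[].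
have Pub x : P x -> x <= M.
  move=> Px; have [k /= xk] := filter_ex Px.
  by apply: (le_trans xk); have := aM k; rewrite ler_norml => /andP[].
have sP : has_sup P by split; [exists (- M)|exists M => x; exact: Pub].
have e20 : 0 < e / 2 by rewrite divr_gt0.
have [x Px lx] := sup_adherent e20 sP.
exists ([set k | x <= a k] `&` ~` [set k | sup P + e / 2 <= a k]).
  apply: filterI => //.
  case: (in_ultra_setVsetC [set k | sup P + e / 2 <= a k] UU) => // h.
  by have := sup_upper_bound sP h; rewrite gerDl leNgt e20.
move=> j k [/= hj1 /negP +] [/= hk1 /negP +]; rewrite -!ltNge => hj2 hk2.
by rewrite ler_norml; apply/andP; split; lra.
Qed.

End UltraLimit.

Section GroundState.
Context {R : realType} {E : lmodType R} (T S : set E) (B G : E -> E -> R).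
Hypotheses (SB : semi_ip S B) (SG : semi_ip S G).
Hypotheses (TS : T `<=` S) (T0 : T 0).
Hypothesis Tlin : forall (a : R) u v, T u -> T v -> T (a *: u + v).
Hypothesis dense : forall v e, S v -> 0 < e ->
  exists2 u, T u & sip_norm B (v - u) < e /\ sip_norm G (v - u) < e.
Hypothesis nontrivial : exists2 v, S v & B v v != 0.
(** The Rellich property in quantitative form: up to a small multiple of the energy [G], the form
    [B] is controlled by finitely many bounded functionals. *)
Hypothesis precompact : forall e, 0 < e ->
  exists (I : Type) (s : seq I) (l : I -> E -> R) (c : I -> R),
  [/\ forall i u, T u -> `|l i u| <= c i * sip_norm B u,
      forall i u v, T u -> T v -> l i (u - v) = l i u - l i v &
      forall u, T u -> B u u <= \sum_(i <- s) l i u ^+ 2 + e * G u u].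
Hypothesis closed_embedding : forall w : nat -> E, (forall i, T (w i)) ->
  (forall i k, (i <= k)%N -> sip_norm B (w i - w k) <= 1 / 2 ^+ i /\
                             sip_norm G (w i - w k) <= 1 / 2 ^+ i) ->
  exists2 u, S u & forall i, sip_norm B (u - w i) <= 2 / 2 ^+ i /\
                             sip_norm G (u - w i) <= 2 / 2 ^+ i.

Let TB : semi_ip T B. Proof. exact: semi_ip_sub SB TS T0 Tlin. Qed.
Let TG : semi_ip T G. Proof. exact: semi_ip_sub SG TS T0 Tlin. Qed.

Lemma le0_geometric (x c : R) : (forall i, x <= c / 2 ^+ i) -> x <= 0.
Proof.
move=> xc; have := @cvg_geometric R c 2^-1; rewrite ger0_norm ?invr_ge0// => h.
have {}h : geometric c 2^-1 @ \oo --> (0 : R) by apply: h; rewrite invf_lt1// ltr1n.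
apply: (cvgr_to_ge h); apply: nearW => i; rewrite /geometric/= exprVn.
exact: xc.
Qed.

Lemma sip_normalise v : T v -> B v v != 0 ->
  T ((sip_norm B v)^-1 *: v) /\
  B ((sip_norm B v)^-1 *: v) ((sip_norm B v)^-1 *: v) = 1.
Proof.
move=> Tv vN0; have Tv' := sip_memZ TB (sip_norm B v)^-1 Tv; split => //.
have n0 : sip_norm B v != 0.
  by apply: contra vN0 => /eqP h; rewrite -(sip_normE TB Tv) h expr0n.
by rewrite (sipZl TB)// (sipZr TB)// -(sip_normE TB Tv) expr2 mulKf// mulVf.
Qed.

Let values : set R := [set G u u | u in [set u | T u /\ B u u = 1]].

Let values_inf : has_inf values.
Proof.
split; last by exists 0 => _ [u [Tu _] <-]; exact: (sip_ge0 TG).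
have [v Sv vN0] := nontrivial.
have n0 : 0 < sip_norm B v by rewrite sqrtr_gt0 lt_def vN0 (sip_ge0 SB).
have [u Tu [nu _]] := dense Sv n0.
have uN0 : B u u != 0.
  apply/eqP => u0; have := sip_normD SB (sip_memB SB Sv (TS Tu)) (TS Tu).
  by rewrite subrK [X in _ + X]/sip_norm u0 sqrtr0 addr0 leNgt nu.
have [h1 h2] := sip_normalise Tu uN0.
by eexists; exists ((sip_norm B u)^-1 *: u).
Qed.

Let m := inf values.

Let m_ge0 : 0 <= m.
Proof.
apply: lb_le_inf; first by case: values_inf.
by move=> _ [u [Tu _] <-]; exact: (sip_ge0 TG).
Qed.

Let m_leT u : T u -> m * B u u <= G u u.
Proof.
move=> Tu; have [u0|uN0] := eqVneq (B u u) 0; first by rewrite u0 mulr0 (sip_ge0 TG).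
have [h1 h2] := sip_normalise Tu uN0.
have := ge_inf values_inf.2 (ex_intro2 _ _ _ (conj h1 h2) erefl).
rewrite -/m (sipZl TG)// (sipZr TG)// mulrA -expr2 exprVn (sip_normE TB)//.
by rewrite mulrC ler_pdivlMr// lt_def uN0 (sip_ge0 TB).
Qed.

Let m_leS v : S v -> m * B v v <= G v v.
Proof.
move=> Sv; rewrite -(sip_normE SB Sv) -(sip_normE SG Sv).
rewrite -[m]sqr_sqrtr// -exprMn lerXn2r ?nnegrE ?mulr_ge0 ?sqrtr_ge0//.
apply/ler_addgt0Pr => e e0.
(* An error [d] in both norms costs [Num.sqrt m * d + d], which is [e]. *)
pose d := e / (Num.sqrt m + 1).
have m1 : 0 < Num.sqrt m + 1 by rewrite ltr_wpDl// sqrtr_ge0.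
have [u Tu [nB nG]] := dense Sv (divr_gt0 e0 m1).
have Su := TS Tu; have Svu := sip_memB SB Sv Su.
have h1 : sip_norm B v <= sip_norm B (v - u) + sip_norm B u.
  by rewrite -[in leLHS](subrK u v); exact: (sip_normD SB).
have h2 : sip_norm G u <= sip_norm G (v - u) + sip_norm G v.
  have := sip_norm_dist SG Su Sv; rewrite (_ : sip_norm G (u - v) = sip_norm G (v - u)).
    by move=> /(le_trans (ler_norm _)); rewrite lerBlDr.
  by rewrite -[u - v]opprB -[- (v - u)]scaleN1r (sip_normZ SG)// normrN1 mul1r.
have h3 : Num.sqrt m * sip_norm B u <= sip_norm G u.
  by rewrite /sip_norm -sqrtrM//; apply: ler_wsqrtr; exact: m_leT.
apply: (le_trans (ler_wpM2l (sqrtr_ge0 m) h1)).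
have h4 := ler_wpM2l (sqrtr_ge0 m) (ltW nB).
have h5 : Num.sqrt m * (e / (Num.sqrt m + 1)) + e / (Num.sqrt m + 1) = e.
  by rewrite -{2}[e / _]mul1r -mulrDl mulrCA divff ?mulr1// lt0r_neq0.
have h6 := ltW nG.
rewrite mulrDr; lra.
Qed.

Let Q u v := G u v - m * B u v.
Let SQ : semi_ip S Q. Proof. exact: rayleigh_semi_ip. Qed.

Let QG u : S u -> sip_norm Q u <= sip_norm G u.
Proof.
by move=> Su; apply: ler_wsqrtr; rewrite /Q gerBl mulr_ge0// (sip_ge0 SB).
Qed.

(** The semidefinite form [Q = G - m B] has norm at most [1 / 2 ^+ k] at the [k]-th term of a
    normalised minimising sequence. Along an ultrafilter the sequence is Cauchy for [B] by
    [precompact], and for [Q] by the parallelogram law, hence for [G = Q + m B]. A limit [u] has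
    [B u u = 1] and [Q u u = 0], and [rayleigh_minimiser] applies. *)
Lemma ground_state : exists m u, [/\ S u, B u u = 1,
  forall v, S v -> G u v = m * B u v & forall v, S v -> m * B v v <= G v v].
Proof.
have /choice[phi phiP] k : exists phi, [/\ T phi, B phi phi = 1 &
    G phi phi <= m + (1 / 2 ^+ k) ^+ 2].
  have e0 : 0 < (1 / 2 ^+ k : R) ^+ 2 by rewrite exprn_gt0// divr_gt0// exprn_gt0.
  have [_ [u [Tu u1] <-] hu] := inf_adherent e0 values_inf.
  by exists u; split => //; exact: ltW.
have Tphi k : T (phi k) by case: (phiP k).
have Sphi k : S (phi k) by exact: TS.
have B1 k : B (phi k) (phi k) = 1 by case: (phiP k).
have Qphi k : sip_norm Q (phi k) <= 1 / 2 ^+ k.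
  have [_ _ h] := phiP k; have p0 : 0 <= 1 / 2 ^+ k :> R by rewrite divr_ge0// exprn_ge0.
  rewrite -[leRHS]ger0_norm// -sqrtr_sqr; apply: ler_wsqrtr.
  by rewrite /Q B1 mulr1 lerBlDl.
have Gphi k : G (phi k) (phi k) <= m + 1.
  have [_ _ /le_trans] := phiP k; apply; rewrite lerD2l expr_le1// ?divr_ge0 ?exprn_ge0//.
  by rewrite ler_pdivrMr ?exprn_gt0// mul1r exprn_ege1// ler1n.
have [U [UU Uoo]] := @ultraFilterLemma nat \oo _.
have tail i : U [set k | (i <= k)%N] by apply: Uoo; exists i.
have cauchyB e : 0 < e -> exists2 D, U D &
    forall j k, D j -> D k -> B (phi j - phi k) (phi j - phi k) <= e.
  (* Every term has energy at most [m + 1], so a difference of two has energy at most [4 * (m + 1)];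
     the gradient part of [precompact] is then at most [e / 2]. *)
  move=> e0; pose M := 4 * (m + 1).
  have M0 : 0 < M by rewrite mulr_gt0// ltr_wpDl.
  have e2 : 0 < e / 2 by rewrite divr_gt0.
  have [I [s [l [c [lc lB BG]]]]] := precompact (divr_gt0 e2 M0).
  have fam (d : R) : 0 < d -> exists2 D, U D & forall j k, D j -> D k ->
      \sum_(i <- s) l i (phi j - phi k) ^+ 2 <= d.
    elim: s {BG} d => [|i s ih] d d0.
      by exists setT => [|j k _ _]; [exact: filterT|rewrite big_nil ltW].
    have d2 : 0 < d / 2 by rewrite divr_gt0.
    have [D1 UD1 H1] := ih _ d2.
    have lM k : `|l i (phi k)| <= c i.
      by apply: le_trans (lc i _ (Tphi k)) _; rewrite /sip_norm B1 sqrtr1 mulr1.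
    have sd : 0 < Num.sqrt (d / 2) by rewrite sqrtr_gt0.
    have [D2 UD2 H2] := ultra_bounded_cauchy UU lM sd.
    exists (D1 `&` D2) => [|j k [j1 j2] [k1 k2]]; first exact: filterI.
    rewrite big_cons [d]splitr lerD ?H1// lB//.
    rewrite -[leRHS](sqr_sqrtr (ltW d2)) -real_normK ?num_real//.
    by rewrite lerXn2r ?nnegrE ?normr_ge0 ?sqrtr_ge0// H2.
  have [D UD HD] := fam _ e2; exists D => // j k Dj Dk.
  have Tjk := sip_memB TB (Tphi j) (Tphi k).
  apply: le_trans (BG _ Tjk) _; rewrite [leRHS]splitr lerD ?HD//.
  rewrite mulrAC ler_pdivrMr// ler_pM2l//.
  apply: le_trans (sip_parallelogram_le SG (Sphi j) (Sphi k)) _.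
  have := Gphi j; have := Gphi k; rewrite /M; lra.
have cauchyG i : exists2 D, U D & forall j k, D j -> D k ->
    sip_norm B (phi j - phi k) <= 1 / 2 ^+ i /\ sip_norm G (phi j - phi k) <= 1 / 2 ^+ i.
  pose r : R := 1 / 2 ^+ i; have r0 : 0 < r by rewrite divr_gt0// exprn_gt0.
  have r20 : 0 < r ^+ 2 by rewrite exprn_gt0.
  have m20 : 0 < 2 * (m + 1) by rewrite mulr_gt0// ltr_wpDl.
  (* On [D] the form [B] of a difference is at most [r ^+ 2], and [m] times it at most [r ^+ 2 / 2].
     From the index [i.+2] on, the [Q]-norms are at most [r / 4], so [Q] of a difference is at most
     [r ^+ 2 / 4]; the sum stays below [r ^+ 2]. *)
  have [D UD HD] := cauchyB _ (divr_gt0 r20 m20).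
  exists (D `&` [set k | (i.+2 <= k)%N]) => [|j k [Dj /= ij] [Dk /= ik]].
    by apply: filterI => //; exact: tail.
  have Sjk := sip_memB SB (Sphi j) (Sphi k).
  have hB := HD j k Dj Dk.
  have hB' : B (phi j - phi k) (phi j - phi k) * (2 * (m + 1)) <= r ^+ 2.
    by rewrite -ler_pdivlMr.
  have B0 := sip_ge0 SB Sjk.
  have mB0 : 0 <= m * B (phi j - phi k) (phi j - phi k) by rewrite mulr_ge0.
  have half k' : (i.+2 <= k')%N -> sip_norm Q (phi k') <= r / 4.
    move=> ik'; apply: le_trans (Qphi k') _.
    rewrite /r -mulrA ler_pM2l// -invfM lef_pV2 ?posrE ?mulr_gt0 ?exprn_gt0//.
    rewrite (_ : 2 ^+ i * 4 = 2 ^+ i.+2); last by rewrite !exprS; ring.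
    by rewrite ler_weXn2l// ler1n.
  have hQ : Q (phi j - phi k) (phi j - phi k) <= r ^+ 2 / 4.
    apply: le_trans (sip_parallelogram_le SQ (Sphi j) (Sphi k)) _.
    rewrite -!(sip_normE SQ)//.
    have q2 k' : (i.+2 <= k')%N -> sip_norm Q (phi k') ^+ 2 <= (r / 4) ^+ 2.
      by move=> ik'; rewrite lerXn2r ?nnegrE ?sqrtr_ge0 ?divr_ge0 ?(ltW r0)// half.
    have := q2 j ij; have := q2 k ik; rewrite expr_div_n; lra.
  have rE x : x <= r ^+ 2 -> Num.sqrt x <= 1 / 2 ^+ i.
    by move=> /ler_wsqrtr; rewrite sqrtr_sqr gtr0_norm.
  split; apply: rE; first by nra.
  move: hQ; rewrite /Q lerBlDr => /le_trans; apply; nra.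
have /choice[D HD] i : exists D, U D /\ forall j k, D j -> D k ->
    sip_norm B (phi j - phi k) <= 1 / 2 ^+ i /\ sip_norm G (phi j - phi k) <= 1 / 2 ^+ i.
  by have [D] := cauchyG i; exists D.
(* The index [n i] lies in all of [D 0], ..., [D i], so that for [i <= k] both [n i] and [n k] lie
   in [D i]. *)
have /choice[n Hn] i : exists n, (i <= n)%N /\ forall i', (i' <= i)%N -> D i' n.
  suff UDi : U [set k | forall i', (i' <= i)%N -> D i' k].
    by have [k [/= ik Dk]] := filter_ex (filterI (tail i) UDi); exists k.
  elim: i => [|i ih].
    by have [U0 _] := HD 0%N; apply: filterS U0 => k D0 i'; rewrite leqn0 => /eqP ->.
  have [Ui _] := HD i.+1; apply: filterS (filterI ih Ui) => k [Dk Dik] i'.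
  by rewrite leq_eqVlt => /predU1P[->//|]; rewrite ltnS; exact: Dk.
have [i k ik|u Su uw] := @closed_embedding (phi \o n) (fun i => Tphi _).
  have [_ Di] := Hn i; have [_ Dk] := Hn k; have [_ H] := HD i.
  by apply: H; [exact: Di|exact: Dk].
have Bu : B u u = 1.
  rewrite -(sip_normE SB Su); suff -> : sip_norm B u = 1 by rewrite expr1n.
  apply/eqP; rewrite -subr_eq0 -normr_le0; apply: (@le0_geometric _ 2) => i.
  have N1 : sip_norm B (phi (n i)) = 1 by rewrite /sip_norm B1 sqrtr1.
  by have := sip_norm_dist SB Su (Sphi (n i)); rewrite N1 => /le_trans; apply; have [] := uw i.
have Qu : G u u = m * B u u.
  apply/eqP; rewrite -subr_eq0 -/(Q u u) -(sip_normE SQ Su) sqrf_eq0.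
  rewrite eq_le sqrtr_ge0 andbT; apply: (@le0_geometric _ 3) => i.
  have Suw := sip_memB SB Su (Sphi (n i)).
  have h := sip_normD SQ Suw (Sphi (n i)); rewrite subrK in h.
  apply: le_trans h _; have [_ hG] := uw i.
  have hQ := le_trans (QG Suw) hG.
  have [ni _] := Hn i.
  have hn : sip_norm Q (phi (n i)) <= 1 / 2 ^+ i.
    apply: le_trans (Qphi _) _; rewrite ler_pM2l// lef_pV2 ?posrE ?exprn_gt0//.
    by rewrite ler_weXn2l// ler1n.
  have -> : 3 / 2 ^+ i = 2 / 2 ^+ i + 1 / 2 ^+ i :> R by rewrite -mulrDl; congr (_ / _); ring.
  exact: lerD.
exists m, u; split => //; exact: (rayleigh_minimiser SB SG m_leS Su Qu).
Qed.

End GroundState.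

(** * The Dirichlet form on test functions and its ground state *)

Section DirichletEigenvalue.
Context {R : realType}.
Local Notation mu := (@mu2 R).
Variable Omega : set (R * R).
Hypotheses (oO : open Omega) (bO : bounded_set Omega).
Implicit Types (phi psi f g u v w : R * R -> R) (e p : R * R).

Let mO : @measurable _ (plane R) Omega. Proof. exact: open_measurable2. Qed.
Let fO : (mu Omega < +oo)%E. Proof. exact: finO. Qed.
Let axex : axis (ex : R * R). Proof. by left. Qed.
Let axey : axis (ey : R * R). Proof. by right. Qed.
Local Notation test := (test_fun Omega).
Local Notation ip := (ip Omega).
Local Notation grad_ip := (grad_ip Omega).
Local Notation l2norm := (l2norm Omega).
Let S := L2_semi_ip oO.

Lemma grad_ip_test u : test u ->
  grad_ip u u = ip ('D_ex u) ('D_ex u) + ip ('D_ey u) ('D_ey u).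
Proof.
move=> tu; have hu := H1_test oO bO tu.
have W e : axis e -> ip (wder Omega e u) (wder Omega e u) = ip ('D_e u) ('D_e u).
  move=> ae; have L1 := H1_wder_L2 ae hu; have L2 := test_axis_L2 oO bO ae tu.
  have E := wder_test oO bO ae tu; exact: (ip_ae2 oO L1 L2 L1 L2 E E).
exact: (f_equal2 (fun x y : R => x + y) (W ex axex) (W ey axey)).
Qed.

Lemma indic_L2 (A : set (R * R)) : @measurable _ (plane R) A -> L2 Omega (\1_A : R * R -> R).
Proof.
move=> mA; apply: (@sqint_bounded _ (plane R) R mu Omega mO fO _ 1) => [|p _].
  exact: (@measurable_indic _ (plane R) R Omega A mA).
by rewrite indicE; case: (_ \in _); rewrite ?normr1 ?normr0.
Qed.

(** On the square of side [h], which contains [Omega], test functions extend by zero and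
    [cells_poincare] applies with cells of side [d], where [d ^+ 2 <= eps]. The functionals are the
    integrals over the cells divided by [d], the square root of the area of a cell, so that their
    squares are exactly the terms of that sum. *)
Lemma test_precompact (eps : R) : 0 < eps ->
  exists (I : Type) (s : seq I) (l : I -> (R * R -> R) -> R) (c : I -> R),
  [/\ forall i u, test u -> `|l i u| <= c i * sip_norm ip u,
      forall i u v, test u -> test v -> l i (u - v) = l i u - l i v &
      forall u, test u -> ip u u <= \sum_(i <- s) l i u ^+ 2 + eps * grad_ip u u].
Proof.
move=> e0; have [L L0 OL] := bounded_sub_hbox bO.
pose h := L + L; have h0 : 0 < h by rewrite addr_gt0.
have [n hn] : exists n, (h / 2 ^+ n) ^+ 2 <= eps.
  have H : geometric h 2^-1 @ \oo --> (0 : R).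
    by apply: cvg_geometric; rewrite ger0_norm ?invr_ge0// invf_lt1// ltr1n.
  have se : 0 < Num.sqrt eps by rewrite sqrtr_gt0.
  have /cvgr0Pnorm_le/(_ _ se)[n _ /(_ n (leqnn n))] := H.
  rewrite /geometric/= exprVn => hn; exists n.
  rewrite -[leRHS](sqr_sqrtr (ltW e0)) -real_normK ?num_real//.
  by rewrite lerXn2r ?nnegrE ?sqrtr_ge0.
pose d := h / 2 ^+ n; have d0 : 0 < d by rewrite divr_gt0// exprn_gt0.
pose chi (q : R * R) : R * R -> R := \1_(cell d q).
have Lchi q : L2 Omega (chi q) by apply: indic_L2; exact: measurable_hbox.
exists (R * R)%type, (cells n h (- L, - L)), (fun q u => d^-1 * ip (chi q) u),
  (fun q => d^-1 * l2norm (chi q)).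
split => [q u tu|q u v tu tv|u tu].
- have Lu := test_L2 oO bO tu.
  have dV : 0 <= d^-1 by rewrite invr_ge0 ltW.
  rewrite normrM ger0_norm// -mulrA; apply: (ler_wpM2l dV).
  exact: (sip_cauchy_schwarz_norm S (Lchi q) Lu).
- have Lu := test_L2 oO bO tu; have Lv := test_L2 oO bO tv.
  by rewrite (sipBr S Lu Lv (Lchi q)) mulrBr.
have cu := test_continuous tu.
have t1 := test_partial axex tu; have t2 := test_partial axey tu.
have supp f : test f -> ip f f = \int[mu]_(z in cell h (- L, - L)) f z ^+ 2.
  move=> tf; apply: Rintegral_support => p.
    by move=> Op; rewrite (test_out tf Op) mulr0.
  move=> Cp; suff -> : f p = 0 by rewrite mulr0.
  apply: (test_out tf) => /OL[h1 h2 h3 h4].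
  apply: Cp; rewrite /cell /h /= !addKr.
  by split; rewrite /= in_itv/= ltW.
have chiE q : \int[mu]_(z in cell d q) u z = ip (chi q) u.
  rewrite Rintegral_mkcond [RHS]Rintegral_mkcond; congr (Rintegral _ _).
  apply/funext => p; rewrite !patchE /chi indicE.
  case: (p \in cell d q); rewrite ?mul0r ?mul1r; case: ifPn => // pO.
  by apply: (test_out tu) => Op; move: pO; rewrite mem_set.
have := @cells_poincare R u ('D_ex u) ('D_ey u) n h (- L, - L) h0 cu (test_continuous t1)
  (test_continuous t2) (fun q => test_is_derive q axex tu) (fun q => test_is_derive q axey tu).
rewrite -(supp u tu) -(supp _ t1) -(supp _ t2) -grad_ip_test// -/d => H.
apply: le_trans H _; apply: lerD.
  rewrite mulr_sumr; apply: ler_sum => q _.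
  by rewrite (chiE q) [leRHS]exprMn [in leRHS]exprVn.
by apply: ler_wpM2r hn; apply: (sip_ge0 (grad_semi_ip oO bO)); exact: H1_test.
Qed.

(** The functions and both of their partial derivatives converge in L^2 by [sqint_complete].
    Integration by parts passes to the limit, so the limits of the derivatives are weak derivatives
    of [u]; the [w i] themselves are the approximants required by [H10]. *)
Lemma H10_closed (w : nat -> R * R -> R) : (forall i, test (w i)) ->
  (forall i k, (i <= k)%N -> sip_norm ip (w i - w k) <= 1 / 2 ^+ i /\
                             sip_norm grad_ip (w i - w k) <= 1 / 2 ^+ i) ->
  exists2 u, H10 Omega u & forall i, sip_norm ip (u - w i) <= 2 / 2 ^+ i /\
                             sip_norm grad_ip (u - w i) <= 2 / 2 ^+ i.
Proof.
move=> tw cw; have Lw i := test_L2 oO bO (tw i).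
have hw i := H1_test oO bO (tw i).
have symm f g : L2 Omega f -> L2 Omega g -> l2norm (f - g) = l2norm (g - f).
  move=> Lf Lg; rewrite -[f - g]opprB -[- (g - f)]scaleN1r.
  by rewrite -[LHS]/(sip_norm ip _) (sip_normZ S) ?normrN1 ?mul1r//; exact: (sip_memB S).
have [u Lu wu] := @sqint_complete _ (plane R) R mu Omega mO fO w Lw
  (fun i k ik => (cw i k ik).1).
have LD e i (ae : axis e) := test_axis_L2 oO bO ae (tw i).
have partial_cauchy e : axis e -> forall i k, (i <= k)%N ->
    sip_norm ip ('D_e (w i) - 'D_e (w k)) <= 1 / 2 ^+ i.
  move=> ae i k ik; apply: le_trans (cw i k ik).2.
  have hd := sip_memB (grad_semi_ip oO bO) (hw i) (hw k).
  have tik : test (w i - w k).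
    by rewrite addrC -scaleN1r; exact: test_lin.
  have DE : 'D_e (w i - w k) = 'D_e (w i) - 'D_e (w k).
    apply/funext => p; have [d1 _] := test_is_derive p ae (tw i).
    by have [d2 _] := test_is_derive p ae (tw k); rewrite deriveB.
  rewrite -DE; apply: ler_wsqrtr; rewrite grad_ip_test//.
  have ge f : L2 Omega f -> 0 <= ip f f by exact: (sip_ge0 S).
  have a0 := ge _ (test_axis_L2 oO bO axex tik).
  have b0 := ge _ (test_axis_L2 oO bO axey tik).
  by case: ae => ->; [exact: (ler_wpDr b0 (lexx _))|exact: (ler_wpDl a0 (lexx _))].
have lim_partial e : axis e -> exists2 g, is_weak_deriv Omega e u g &
    forall i, l2norm ('D_e (w i) - g) <= 1 / 2 ^+ i.
  move=> ae; have [g Lg wg] := @sqint_complete _ (plane R) R mu Omega mO fO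
    (fun i => 'D_e (w i)) (fun i => LD e i ae) (partial_cauchy e ae).
  exists g => //; split => // psi tpsi.
  have Lpsi := test_L2 oO bO tpsi; have LDpsi := test_axis_L2 oO bO ae tpsi.
  apply/eqP; rewrite -subr_eq0 opprK -normr_le0.
  apply: (@le0_geometric R _ (l2norm ('D_e psi) + l2norm psi)) => i.
  have h := test_ibp oO bO ae (tw i) tpsi.
  have e1 := sipBl S (Lw i) Lu LDpsi; have e2 := sipBl S (LD e i ae) Lg Lpsi.
  have -> : ip u ('D_e psi) + ip g psi =
      - ip (w i - u) ('D_e psi) - ip ('D_e (w i) - g) psi.
    by rewrite e1 e2 h; ring.
  apply: le_trans (ler_normB _ _) _; rewrite normrN mulrDl.
  have c1 := sip_cauchy_schwarz_norm S (sip_memB S (Lw i) Lu) LDpsi.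
  have c2 := sip_cauchy_schwarz_norm S (sip_memB S (LD e i ae) Lg) Lpsi.
  apply: lerD.
    apply: (le_trans c1); rewrite mulrC; apply: (ler_wpM2l (sqrtr_ge0 _)).
    by have := wu i; rewrite mul1r.
  apply: (le_trans c2); rewrite mulrC; apply: (ler_wpM2l (sqrtr_ge0 _)).
  by have := wg i; rewrite mul1r.
have [g1 w1 n1] := lim_partial ex axex; have [g2 w2 n2] := lim_partial ey axey.
have hu : H1 Omega u.
  by split => // e [] ->; [exists g1|exists g2].
(* Two partial derivatives, each within [1 / 2 ^+ i], have a joint norm below twice that; hence the
   numerator 2. *)
have bound i : l2norm (u - w i) <= 2 / 2 ^+ i /\ sip_norm grad_ip (u - w i) <= 2 / 2 ^+ i.
  have p0 : 0 <= 1 / 2 ^+ i :> R by rewrite divr_ge0// exprn_ge0.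
  have p2 : 2 / 2 ^+ i = 2 * (1 / 2 ^+ i) :> R by rewrite mulrA mulr1.
  split.
    by rewrite symm// p2; apply: le_trans (wu i) _; rewrite ler_peMl// ler1n.
  rewrite -[leRHS]ger0_norm; last by rewrite p2 mulr_ge0.
  rewrite -sqrtr_sqr; apply: ler_wsqrtr.
  have hui : H1 Omega (u - w i) by exact: (sip_memB (grad_semi_ip oO bO)).
  have W e g : axis e -> is_weak_deriv Omega e u g -> l2norm ('D_e (w i) - g) <= 1 / 2 ^+ i ->
      ip (wder Omega e (u - w i)) (wder Omega e (u - w i)) <= (1 / 2 ^+ i) ^+ 2.
    move=> ae wg ng; have Lg := wg.1.
    have Lgw := sip_memB S Lg (LD e i ae); have Lgw' := sip_memB S (LD e i ae) Lg.
    have ww : is_weak_deriv Omega e (u - w i) (g - 'D_e (w i)).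
      have := weak_lin oO bO (-1) ae (Lw i) Lu (weak_test oO bO ae (tw i)) wg.
      by rewrite !scaleN1r ![- _ + _]addrC.
    have Lww := H1_wder_L2 ae hui.
    have E := weak_unique oO bO (H1_weak ae hui) ww.
    rewrite (ip_ae2 oO Lww Lgw Lww Lgw E E).
    rewrite -(l2norm_sqr oO Lgw) (symm _ _ Lg (LD e i ae)).
    by rewrite lerXn2r ?nnegrE ?sqrtr_ge0.
  apply: (le_trans (lerD (W ex g1 axex w1 (n1 i)) (W ey g2 axey w2 (n2 i)))).
  by rewrite p2 exprMn; have := sqr_ge0 (1 / 2 ^+ i : R); lra.
exists u => //; split => // eps e0.
have [i hi] : exists i, 4 / 2 ^+ i < eps.
  have H : geometric 4 2^-1 @ \oo --> (0 : R).
    by apply: cvg_geometric; rewrite ger0_norm ?invr_ge0// invf_lt1// ltr1n.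
  have /cvgr0Pnorm_lt/(_ _ e0)[i _ /(_ i (leqnn i))] := H.
  rewrite /geometric/= exprVn => hi; exists i; exact: le_lt_trans (ler_norm _) hi.
exists (w i) => //; apply: le_lt_trans hi.
have hui : H1 Omega (u - w i) by exact: (sip_memB (grad_semi_ip oO bO)).
have p2 : 0 <= 2 / 2 ^+ i :> R by rewrite divr_ge0// exprn_ge0.
have p4 : 4 / 2 ^+ i = 2 * (2 / 2 ^+ i) :> R by rewrite mulrA -natrM.
rewrite p4 -[leRHS]ger0_norm ?mulr_ge0// -sqrtr_sqr.
rewrite (H1normE oO hui); apply: ler_wsqrtr; rewrite /h1_ip.
have [b1 b2] := bound i.
rewrite -(l2norm_sqr oO (H1_L2 hui)) -(gradnorm_sqr oO bO hui) exprMn.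
have h1 : l2norm (u - w i) ^+ 2 <= (2 / 2 ^+ i) ^+ 2 by rewrite lerXn2r ?nnegrE ?sqrtr_ge0.
have h2 : gradnorm Omega (u - w i) ^+ 2 <= (2 / 2 ^+ i) ^+ 2 by rewrite lerXn2r ?nnegrE ?sqrtr_ge0.
apply: (le_trans (lerD h1 h2)); have := sqr_ge0 (2 / 2 ^+ i : R); lra.
Qed.

Lemma poincare_dirichlet (lam : R) : min_dirichlet_eigenvalue Omega lam ->
  forall v, H10 Omega v -> lam * ip v v <= grad_ip v v.
Proof.
move=> [[phi [hphi nphi _]] lam_min] v hv.
have SB := ip_semi_ip_H10 oO bO; have SG := grad_semi_ip_H10 oO bO.
(* The eigenfunction of [lam] supplies an element of nonzero norm, without which the Rayleigh
   quotient would have no values. *)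
have nt : exists2 v, H10 Omega v & ip v v != 0.
  exists phi => //; apply: contra nphi => /eqP h0.
  by rewrite /Defs.l2norm h0 sqrtr0.
have dense u eps : H10 Omega u -> 0 < eps ->
    exists2 f, test f & sip_norm ip (u - f) < eps /\ sip_norm grad_ip (u - f) < eps.
  exact: H10_approx.
have [m [u [hu u1 eig mv]]] := ground_state SB SG (H10_test oO bO) (test0 Omega)
  (@test_lin R Omega) dense nt test_precompact H10_closed.
apply: le_trans (mv v hv); apply: ler_wpM2r; first exact: (sip_ge0 SB hv).
apply: lam_min; exists u; split => //.
by rewrite /Defs.l2norm u1 sqrtr1 oner_eq0.
Qed.

End DirichletEigenvalue.

(** * Absolutely continuous functions of time *)

Section AbsolutelyContinuous.
Context {R : realType}.
Local Notation leb := (@lebesgue_measure R).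
Local Notation mu := (@mu2 R).
Implicit Types (f g df dg : R -> R) (T t : R).

(** Absolute continuity in integral form, the form in which [time_derivative] provides it at each
    point of the plane. *)
Definition primitive_on T f df : Prop :=
  leb.-integrable `[0, T] (EFin \o df) /\
  forall t, 0 <= t <= T -> f t = f 0 + \int[leb]_(s in `[0, t]) df s.

Let mI a b : @measurable _ (line R) (`[a, b]%classic : set R).
Proof. exact: measurable_itv. Qed.

Let sub0 T t : t <= T -> (`[0, t]%classic : set R) `<=` `[0, T]%classic.
Proof. by move=> tT s /=; rewrite !in_itv/= => /andP[-> /le_trans]; apply. Qed.

Lemma primitive_measurable T f df : 0 <= T -> primitive_on T f df ->
  @measurable_fun _ _ (line R) (line R) `[0, T]%classic f.
Proof.
move=> T0 [idf fE].
have c := @parameterized_integral_continuous R 0 T df T0 idf.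
have m := subspace_continuous_measurable_fun (mI 0 T) c.
apply: (@eq_measurable_fun _ _ (line R) (line R) _
  (fun t => f 0 + \int[leb]_(s in `[0, t]) df s)).
  by move=> t; rewrite inE/= in_itv/= => h; exact/esym/fE.
exact: measurable_funD.
Qed.

Lemma primitive_bounded T f df : primitive_on T f df ->
  forall t, 0 <= t <= T -> `|f t| <= `|f 0| + \int[leb]_(s in `[0, T]) `|df s|.
Proof.
move=> [idf fE] t tT; rewrite (fE t tT); have /andP[t0 tT'] := tT.
apply: le_trans (ler_normD _ _) _; rewrite lerD2l.
have idt := integrableS (mI 0 T) (mI 0 t) (sub0 tT') idf.
apply: le_trans (le_normr_Rintegral (mI 0 t) idt) _.
apply: (Rintegral_subset (mI 0 t) (mI 0 T)) => //; last exact: sub0.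
exact: (integrable_norm idf).
Qed.

Lemma primitive_mul_integrable T f df g : 0 <= T -> primitive_on T f df ->
  leb.-integrable `[0, T] (EFin \o g) ->
  leb.-integrable `[0, T] (EFin \o (fun t => f t * g t)).
Proof.
move=> T0 pf ig; have mf := primitive_measurable T0 pf.
have bf := primitive_bounded pf; set M := _ + _ in bf.
apply: (@le_integrable _ _ _ leb _ (mI 0 T) _ (EFin \o (fun t => M * g t))).
- apply/measurable_EFinP; apply: measurable_funM => //.
  by have /measurable_int/measurable_EFinP := ig.
- move=> t /=; rewrite in_itv/= => tT; rewrite lee_fin !normrM.
  by apply: ler_wpM2r => //; rewrite (le_trans (bf t tT)) ?ler_norm.
- exact: (integrableZl (mI 0 T) M ig).
Qed.

Lemma primitive_integrable T f df : 0 <= T -> primitive_on T f df ->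
  leb.-integrable `[0, T] (EFin \o f).
Proof.
move=> T0 pf; have i1 : leb.-integrable `[0, T] (EFin \o (cst 1 : R -> R)).
  by apply: continuous_compact_integrable; [exact: segment_compact|move=> x; exact: cvg_cst].
have := primitive_mul_integrable T0 pf i1.
by congr (_.-integrable _ _); apply/funext => t /=; rewrite mulr1.
Qed.

Lemma primitive_lin T (a : R) f df g dg : primitive_on T f df -> primitive_on T g dg ->
  primitive_on T (fun t => a * f t + g t) (fun t => a * df t + dg t).
Proof.
move=> [idf fE] [idg gE].
have iaf := integrableZl (mI 0 T) a idf.
split; first exact: (integrableD (mI 0 T) iaf idg).
move=> t tT; have /andP[t0 tT'] := tT.
have S := integrableS (mI 0 T) (mI 0 t) (sub0 tT').
rewrite RintegralD//; [|exact: S iaf|exact: S].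
rewrite RintegralZl//; last exact: S.
rewrite (fE t tT) (gE t tT); ring.
Qed.

Lemma tensor_integrable (A : set R) df dg : @measurable _ (line R) A ->
  leb.-integrable A (EFin \o df) -> leb.-integrable A (EFin \o dg) ->
  mu.-integrable (A `*` A) (EFin \o (fun p => df p.1 * dg p.2)).
Proof.
move=> mA idf idg.
have mAA : @measurable _ (plane R) (A `*` A) by exact: measurableX.
pose F := df \_ A; pose G := dg \_ A.
have iF : leb.-integrable setT (EFin \o F).
  by have /(integrable_mkcond _ mA) := idf; rewrite restrict_EFin.
have iG : leb.-integrable setT (EFin \o G).
  by have /(integrable_mkcond _ mA) := idg; rewrite restrict_EFin.
have mF : @measurable_fun _ _ (line R) (line R) setT F.
  by have /measurable_int/measurable_EFinP := iF.
have mG : @measurable_fun _ _ (line R) (line R) setT G.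
  by have /measurable_int/measurable_EFinP := iG.
apply/(integrable_mkcond _ mAA).
have -> : (EFin \o (fun p : plane R => df p.1 * dg p.2)) \_ (A `*` A) =
    EFin \o (fun p : plane R => F p.1 * G p.2).
  apply/funext => p; rewrite patchE /F /G /= !patchE.
  case: ifPn => [|/negP h].
    by rewrite inE => -[h1 h2]; rewrite !mem_set.
  have [h1|h1] := boolP (p.1 \in A); last by rewrite mul0r.
  have [h2|h2] := boolP (p.2 \in A); last by rewrite mulr0.
  by exfalso; apply: h; rewrite inE; split; [rewrite inE in h1|rewrite inE in h2].
have mFG : @measurable_fun _ _ (plane R) _ setT (EFin \o (fun p : plane R => F p.1 * G p.2)).
  apply/measurable_EFinP; apply: measurable_funM.
    exact: (measurableT_comp mF measurable_fst).
  exact: (measurableT_comp mG measurable_snd).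
apply/(@integrable12ltyP _ _ (line R) (line R) R leb leb _ mFG).
have inner (x : line R) : (\int[leb]_y `|(F x * G y)%:E| = `|F x|%:E * \int[leb]_y `|G y|%:E)%E.
  under eq_integral do rewrite /= normrM EFinM.
  rewrite ge0_integralZl_EFin//; last by do 2 apply: measurableT_comp => //.
rewrite /=; under eq_integral do rewrite inner.
rewrite ge0_integralZr//; last 2 first.
- by do 2 apply: measurableT_comp => //.
- by apply: integral_ge0 => y _; rewrite lee_fin.
have /integrableP[_ fF] := iF; have /integrableP[_ fG] := iG.
apply: lte_mul_pinfty => //; first by apply: integral_ge0 => y _; rewrite lee_fin.
by rewrite ge0_fin_numE//; apply: integral_ge0.
Qed.

Lemma Rintegral_indic_le h (t a : R) : 0 <= a <= t ->
  \int[leb]_(s in `[0, t]) (h s * \1_`[0, a] s) = \int[leb]_(s in `[0, a]) h s.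
Proof.
move=> /andP[a0 at_]; transitivity (\int[leb]_(s in `[0, t] `&` `[0, a]) h s).
  rewrite Rintegral_mkcondr; apply: eq_Rintegral => s _; rewrite patchE indicE.
  by case: (s \in _); rewrite ?mulr1 ?mulr0.
by congr (Rintegral _ _ _); apply/setIidPr; exact: sub0.
Qed.

Lemma integrable_mul_indic h (t : R) (B : set R) : @measurable _ (line R) B ->
  leb.-integrable `[0, t] (EFin \o h) ->
  leb.-integrable `[0, t] (EFin \o (fun s => h s * \1_B s)).
Proof.
move=> mB ih; apply: (@le_integrable _ _ _ leb _ (mI 0 t) _ (EFin \o h)) => //.
  apply/measurable_EFinP; apply: measurable_funM.
    by have /measurable_int/measurable_EFinP := ih.
  exact: measurable_indic.
move=> s _; rewrite lee_fin normrM indicE.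
by case: (_ \in _); rewrite ?normr1 ?normr0 ?mulr1 ?mulr0.
Qed.

(* Fubini on the two halves of the square [0, t]^2. *)
Lemma integral_by_parts_triangles df dg t : 0 <= t ->
  leb.-integrable `[0, t] (EFin \o df) -> leb.-integrable `[0, t] (EFin \o dg) ->
  (\int[leb]_(s in `[0, t]) df s) * (\int[leb]_(s in `[0, t]) dg s) =
  \int[leb]_(s in `[0, t]) (dg s * \int[leb]_(r in `[0, s]) df r) +
  \int[leb]_(s in `[0, t]) (df s * \int[leb]_(r in `[0, s]) dg r).
Proof.
move=> t0 idf idg; set A : set R := `[0, t]%classic.
have mA : @measurable _ (line R) A by exact: mI.
have mAA : @measurable _ (plane R) (A `*` A) by exact: measurableX.
pose Up : set (R * R) := [set p | p.2 < p.1].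
have mUp : @measurable _ (plane R) Up.
  apply: open_measurable2; rewrite (_ : Up = (fun p : R * R => p.1 - p.2) @^-1` [set x | 0 < x]).
    apply: open_comp; last exact: open_gt.
    by move=> p _; apply: cvgB; [exact: cvg_fst|exact: cvg_snd].
  by apply/seteqP; split => p; rewrite /Up/= subr_gt0.
have inUp p : (p \in Up) = (p.2 < p.1) by apply/idP/idP; rewrite inE.
pose X (p : R * R) := df p.1 * dg p.2.
have iX : mu.-integrable (A `*` A) (EFin \o X) by exact: tensor_integrable.
have mX : @measurable_fun _ _ (plane R) (line R) (A `*` A) X.
  by have /measurable_int/measurable_EFinP := iX.
have iXB (B : set (R * R)) : @measurable _ (plane R) B ->
    mu.-integrable (A `*` A) (EFin \o (fun p => X p * \1_B p)).
  move=> mB; have m1 := @measurable_indic _ (plane R) R (A `*` A) B mB.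
  apply: (@le_integrable _ (plane R) _ mu _ mAA _ (EFin \o X)) => //.
    by apply/measurable_EFinP; exact: (measurable_funM mX m1).
  move=> p _; rewrite lee_fin normrM indicE.
  by case: (_ \in _); rewrite ?normr1 ?normr0 ?mulr1 ?mulr0.
have mLo := measurableC mUp.
have EX : \int[mu]_(p in A `*` A) X p =
    \int[mu]_(p in A `*` A) (X p * \1_(~` Up) p) + \int[mu]_(p in A `*` A) (X p * \1_Up p).
  rewrite -RintegralD//; [|exact: iXB..].
  apply: eq_Rintegral => p _; rewrite -mulrDr (_ : _ + _ = 1) ?mulr1//.
  by rewrite !indicE in_setC; case: (_ \in _); rewrite ?addr0 ?add0r.
have sl1 y : leb.-integrable A (fun x => (X (x, y))%:E).
  have := integrableZr mA (dg y) idf; congr (_.-integrable _ _).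
have sl2 x : leb.-integrable A (fun y => (X (x, y))%:E).
  exact: (integrableZl mA (df x) idg).
have [_ E0] := Rfubini21 mA mA iX (fun y _ => sl1 y).
have slU x : leb.-integrable A (fun y => (X (x, y) * \1_Up (x, y))%:E).
  have -> : (fun y => (X (x, y) * \1_Up (x, y))%:E) =
      EFin \o (fun y => X (x, y) * \1_`]-oo, x[ y).
    by apply/funext => y /=; congr (_ * _)%:E; rewrite !indicE; congr (nat_of_bool _)%:R.
  by apply: (integrable_mul_indic _ (sl2 x)); exact: measurable_itv.
have slL y : leb.-integrable A (fun x => (X (x, y) * \1_(~` Up) (x, y))%:E).
  have -> : (fun x => (X (x, y) * \1_(~` Up) (x, y))%:E) =
      EFin \o (fun x => X (x, y) * \1_`]-oo, y] x).
    apply/funext => x /=; congr (_ * _)%:E; rewrite !indicE; congr (nat_of_bool _)%:R.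
    by rewrite in_setC inUp -leNgt; apply/idP/idP; rewrite inE/= in_itv.
  by apply: (integrable_mul_indic _ (sl1 y)); exact: measurable_itv.
have [_ E1] := Rfubini12 mA mA (iXB _ mUp) (fun x _ => slU x).
have [_ E2] := Rfubini21 mA mA (iXB _ mLo) (fun y _ => slL y).
rewrite [LHS](_ : _ = \int[mu]_(p in A `*` A) X p); last first.
  rewrite E0; transitivity (\int[leb]_(y in A) ((\int[leb]_(x in A) df x) * dg y)).
    by rewrite RintegralZl.
  by apply: eq_Rintegral => y _; rewrite -(RintegralZr _ mA idf).
rewrite EX E1 E2; congr (_ + _); apply: eq_Rintegral => s; rewrite inE => As.
  rewrite -(Rintegral_indic_le _ As) -RintegralZl//; last exact: integrable_mul_indic.
  apply: eq_Rintegral => r; rewrite inE /A/= in_itv/= => /andP[r0 _].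
  rewrite /X/= [df r * dg s]mulrC -mulrA; congr (_ * (_ * _)).
  rewrite !indicE; congr (nat_of_bool _)%:R.
  by rewrite in_setC inUp -leNgt; apply/idP/idP; rewrite inE/= in_itv/= r0.
rewrite -(Rintegral_indic_le _ As) -RintegralZl//; last exact: integrable_mul_indic.
transitivity (\int[leb]_(y in A) (df s * (dg y * \1_`[0, s[ y))).
  apply: eq_Rintegral => r; rewrite inE /A/= in_itv/= => /andP[r0 _].
  rewrite /X/= -mulrA; congr (_ * (_ * _)).
  rewrite !indicE; congr (nat_of_bool _)%:R.
  by rewrite inUp; apply/idP/idP; rewrite inE/= in_itv/= r0.
(* The open triangle gives the integral up to [s] with [s] excluded; the excluded point is null. *)
have ae0 : ae_eq leb A (fun y => (df s * (dg y * \1_`[0, s[ y))%:E)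
   (fun y => (df s * (dg y * \1_`[0, s] y))%:E).
  exists [set s]; split; [exact: measurable_set1|exact: lebesgue_measure_set1|].
  move=> y /= /not_implyP[Ay]; apply: contra_notP => ys; congr (_ * (_ * _))%:E.
  rewrite !indicE; congr (nat_of_bool _)%:R.
  apply/idP/idP; rewrite !inE/= !in_itv/= => /andP[-> h].
    exact: ltW.
  by rewrite lt_neqAle h andbT; apply/eqP.
congr fine; apply: ae_eq_integral => //.
- apply/measurable_EFinP; apply: measurable_funM => //; apply: measurable_funM.
    by have /measurable_int/measurable_EFinP := idg.
  by apply: measurable_indic; exact: measurable_itv.
- apply/measurable_EFinP; apply: measurable_funM => //; apply: measurable_funM.
    by have /measurable_int/measurable_EFinP := idg.
  by apply: measurable_indic; exact: measurable_itv.
Qed.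

(** Writing [f] as [f 0] plus the integral of [df] inside [f * dg], and likewise for [g], leaves the
    two triangle integrals, whose sum is the product of the integrals of [df] and [dg]. *)
Lemma primitive_mul T f df g dg : 0 <= T -> primitive_on T f df -> primitive_on T g dg ->
  primitive_on T (fun t => f t * g t) (fun t => f t * dg t + g t * df t).
Proof.
move=> T0 pf pg; have [idf fE] := pf; have [idg gE] := pg.
have i1 := primitive_mul_integrable T0 pf idg.
have i2 := primitive_mul_integrable T0 pg idf.
split; first exact: (integrableD (mI 0 T) i1 i2).
move=> t tT; have /andP[t0 tT'] := tT.
have S h := @integrableS _ _ _ leb _ _ h (mI 0 T) (mI 0 t) (sub0 tT').
have idft := S _ idf; have idgt := S _ idg.
have j1 : leb.-integrable `[0, t] (EFin \o (fun s => dg s * \int[leb]_(r in `[0, s]) df r)).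
  have := integrableB (mI 0 t) (S _ i1) (integrableZl (mI 0 t) (f 0) idgt).
  apply: eq_integrable => //= s; rewrite inE/= in_itv/= => /andP[s0 st].
  rewrite -EFinB (fE s) ?s0 ?(le_trans st)//; congr EFin; ring.
have j2 : leb.-integrable `[0, t] (EFin \o (fun s => df s * \int[leb]_(r in `[0, s]) dg r)).
  have := integrableB (mI 0 t) (S _ i2) (integrableZl (mI 0 t) (g 0) idft).
  apply: eq_integrable => //= s; rewrite inE/= in_itv/= => /andP[s0 st].
  rewrite -EFinB (gE s) ?s0 ?(le_trans st)//; congr EFin; ring.
have k1 := integrableZl (mI 0 t) (f 0) idgt.
have k2 := integrableZl (mI 0 t) (g 0) idft.
rewrite RintegralD//; [|exact: S..].
have -> : \int[leb]_(s in `[0, t]) (f s * dg s) =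
    f 0 * \int[leb]_(s in `[0, t]) dg s +
    \int[leb]_(s in `[0, t]) (dg s * \int[leb]_(r in `[0, s]) df r).
  rewrite -RintegralZl// -RintegralD//; apply: eq_Rintegral => s.
  rewrite inE/= in_itv/= => /andP[s0 st]; rewrite (fE s) ?s0 ?(le_trans st)//; ring.
have -> : \int[leb]_(s in `[0, t]) (g s * df s) =
    g 0 * \int[leb]_(s in `[0, t]) df s +
    \int[leb]_(s in `[0, t]) (df s * \int[leb]_(r in `[0, s]) dg r).
  rewrite -RintegralZl// -RintegralD//; apply: eq_Rintegral => s.
  rewrite inE/= in_itv/= => /andP[s0 st]; rewrite (gE s) ?s0 ?(le_trans st)//; ring.
have := integral_by_parts_triangles t0 idft idgt.
rewrite (fE t tT) (gE t tT) => H.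
rewrite addrACA -H; ring.
Qed.

End AbsolutelyContinuous.

(** * The finite element space *)

Section ClampedFiniteElements.
Context {R : realType}.
Variables (Omega : set (R * R)) (k N : nat) (K : 'I_N -> set (R * R))
  (sigma h : R) (Sh : set (R * R -> R)).
Hypotheses (hK : shape_regular_partition Omega sigma h K) (hS : C1_fe_space Omega k K Sh).
Local Notation V := (clamped_part Omega Sh).

Lemma clamped_part0 : V 0.
Proof.
split; first exact: (fes_0 hS).
move=> z _; split => // n _.
rewrite (_ : (fun s => _) = cst 0); first exact: cvg_cst.
by apply/funext => s /=; rewrite subrr mulr0.
Qed.

Lemma clamped_part_lin (a : R) u v : V u -> V v -> V (a *: u + v).
Proof.
move=> [Su cu] [Sv cv]; split; first exact: (fes_lin hS).
move=> z hz; have [u0 du] := cu z hz; have [v0 dv] := cv z hz.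
have E p : (a *: u + v) p = a * u p + v p by [].
split; first by rewrite E u0 v0 mulr0 addr0.
move=> n hn; have d1 := du n hn; have d2 := dv n hn.
rewrite (_ : (fun s => _) = (fun s => a * (s^-1 * (u z - u (z - s *: n))) +
    s^-1 * (v z - v (z - s *: n)))); last first.
  by apply/funext => s; rewrite !E; ring.
have E0 : a * 0 + 0 = 0 :> R by rewrite mulr0 addr0.
have H := cvgD (cvgM (cvg_cst a) d1) d2; rewrite E0 in H; exact: H.
Qed.

(* A boundary point may lie in several elements; it is attached to the first. *)
Let owner (i : 'I_N) (z : R * R) : Prop := K i z /\ forall j : 'I_N, (j < i)%N -> ~ K j z.

Let owner_uniq i j z : owner i z -> owner j z -> i = j.
Proof.
move=> [Ki hi] [Kj hj]; apply/val_inj; case: (ltngtP i j) => // ij.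
- by case: (hj i ij).
- by case: (hi j ij).
Qed.

Let owner_exists z : closure Omega z -> exists i, owner i z.
Proof.
rewrite -(elt_cover hK) => -[i0 _ Ki0].
have ex : exists n : nat, `[< exists i : 'I_N, (i : nat) = n /\ K i z >].
  by exists i0; apply/asboolP; exists i0.
case: (ex_minnP ex) => n /asboolP[i [<- Ki]] imin; exists i; split => // j ji Kj.
have : (i <= j)%N by apply: imin; apply/asboolP; exists j.
by rewrite leqNgt ji.
Qed.

Let idx := ('I_N * ('I_k.+1 * 'I_k.+1))%type.
Let mono (q : idx) (z : R * R) : R :=
  (if `[< owner q.1 z >] then 1 else 0) * (z.1 ^+ q.2.1 * z.2 ^+ q.2.2).

(** The [mono q], monomials cut off outside the points owned by one element, need not lie in the
    space: a spanning family is enough. A point of the closure has exactly one owner, where [v] is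
    the polynomial of that element; any other point has none, and there [v] is 0. *)
Let clamped_span_idx v : V v -> exists c : idx -> R, v = \sum_(q : idx) c q *: mono q.
Proof.
move=> [Sv _].
have /choice[p Hp] i : exists p, polynomial2 k p /\ {in K i, v =1 p}.
  by have [p] := fes_poly hS Sv i; exists p.
have /choice[c Hc] i : exists c : nat -> nat -> R, forall z, p i z =
    \sum_(i < k.+1) \sum_(j < k.+1 | (i + j <= k)%N) c i j * z.1 ^+ i * z.2 ^+ j.
  by have [[c]] := Hp i; exists c.
(* The index set contains all pairs of exponents up to [k]; those of total degree above [k] get the
   coefficient 0. *)
pose C (q : idx) := if (q.2.1 + q.2.2 <= k)%N then c q.1 q.2.1 q.2.2 else 0.
exists C; apply/funext => z; rewrite fct_sumE.
rewrite (eq_bigr (fun q : idx => C (q.1, q.2) * mono (q.1, q.2) z)); last by case.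
rewrite -(pair_bigA _ (fun i ab => C (i, ab) * mono (i, ab) z))/=.
have inner i : \sum_(ab : 'I_k.+1 * 'I_k.+1) C (i, ab) * mono (i, ab) z =
    (if `[< owner i z >] then 1 else 0) * p i z.
  rewrite Hc mulr_sumr.
  rewrite (eq_bigr (fun ab : 'I_k.+1 * 'I_k.+1 =>
    C (i, (ab.1, ab.2)) * mono (i, (ab.1, ab.2)) z)); last by case.
  rewrite -(pair_bigA _ (fun a b => C (i, (a, b)) * mono (i, (a, b)) z))/=.
  apply: eq_bigr => a _; rewrite mulr_sumr [RHS]big_mkcond/=; apply: eq_bigr => b _.
  rewrite /C /mono/=; case: ifP => _; last by rewrite mul0r.
  by rewrite mulrCA !mulrA.
under eq_bigr do rewrite inner.
have [Oz|Oz] := pselect (closure Omega z); last first.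
  rewrite (fes_out hS Sv Oz) big1// => i _; case: asboolP => [[Ki _]|]; last by rewrite mul0r.
  by exfalso; apply: Oz; rewrite -(elt_cover hK); exists i.
have [i oi] := owner_exists Oz; rewrite (bigD1 i)//= asboolT// mul1r big1 ?addr0.
  by have [_ ->] := Hp i => //; rewrite inE; case: oi.
move=> j ji; case: asboolP => [oj|]; last by rewrite mul0r.
by move: ji; rewrite (owner_uniq oi oj) eqxx.
Qed.

Lemma clamped_part_span : exists D (b : 'I_D -> R * R -> R),
  forall v, V v -> exists c : 'I_D -> R, v = \sum_i c i *: b i.
Proof.
exists #|{: idx}|, (fun d => mono (enum_val d)) => v /clamped_span_idx[c ->].
exists (fun d => c (enum_val d)).
by rewrite (reindex _ (onW_bij _ (@enum_val_bij idx))).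
Qed.

End ClampedFiniteElements.

(** * The energy estimate *)

Section StaticBounds.
Context {R : realType}.
Variable Omega : set (R * R).
Hypotheses (oO : open Omega) (bO : bounded_set Omega).
Implicit Types (v w psi : R * R -> R).
Local Notation ip := (ip Omega).
Local Notation grad_ip := (grad_ip Omega).
Local Notation lap := (lap Omega).
Local Notation l2norm := (l2norm Omega).

Lemma ipC v w : ip v w = ip w v.
Proof. by apply: eq_Rintegral => p _; rewrite mulrC. Qed.

Lemma b0_form_diag v : b0_form Omega v v = 0.
Proof. by rewrite /b0_form [X in _ - X]ipC subrr mulr0. Qed.

Lemma b_form_diag psi v : b_form Omega psi v v = 0.
Proof.
rewrite /b_form.
have -> : wder Omega ey v * wder Omega ex v - wder Omega ex v * wder Omega ey v = 0.
  by rewrite [X in X - _]mulrC subrr.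
transitivity (ip (0 : R * R -> R) 0); last exact: (sip0l (L2_semi_ip oO) (sip0 (L2_semi_ip oO))).
by apply: eq_Rintegral => p _; rewrite /= mulr0 mul0r.
Qed.

Lemma grad_le_lap (lam : R) : 0 < lam ->
  (forall v, H10 Omega v -> lam * ip v v <= grad_ip v v) ->
  forall v, H20 Omega v -> lam * grad_ip v v <= ip (lap v) (lap v).
Proof.
move=> lam0 poin v hv; have [h2 _] := hv; have h10 := H20_H10 oO bO hv.
have Lv := H1_L2 (H2_H1 h2); have Ll := lap_L2 oO h2.
have S := L2_semi_ip oO.
have cs := sip_cauchy_schwarz S Ll Lv; have p := poin v h10.
have g := green oO bO h2 h10.
have g0 : 0 <= grad_ip v v by exact: (sip_ge0 (grad_semi_ip oO bO) (H2_H1 h2)).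
have l0 : 0 <= ip (lap v) (lap v) := sip_ge0 S Ll.
have gsq : grad_ip v v ^+ 2 = ip (lap v) v ^+ 2 by rewrite g sqrrN.
rewrite -gsq in cs; move: g0 l0 cs p {g gsq}.
move: (grad_ip v v) (ip (lap v) (lap v)) (ip v v) => x y z x0 y0 xyz lzx.
have [->|xN0] := eqVneq x 0; first by rewrite mulr0.
have xp : 0 < x by rewrite lt_def xN0.
rewrite -(ler_pM2r xp) -mulrA -expr2.
apply: (@le_trans _ _ (lam * (y * z))); first by rewrite ler_wpM2l// ltW.
by rewrite mulrCA ler_wpM2l.
Qed.

(** [Hm2norm] is a real supremum, an upper bound only when the set of values is nonempty and
    bounded; the zero function provides nonemptiness. *)
Lemma Hm2_has_sup (f : (R * R -> R) -> R) : H20 Omega 0 -> Hm2 Omega f ->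
  has_sup [set `|f v| | v in [set v | H20 Omega v /\ l2norm (lap v) <= 1]].
Proof.
move=> h0 [_ [M fM]]; have SL := lap_semi_ip oO bO.
have n0 : l2norm (lap 0) = 0.
  by have := sip_normZ SL 0 (sip0 SL); rewrite scale0r normr0 mul0r; apply.
split.
  by exists `|f 0|; exists 0; [split; [exact: h0|rewrite n0; exact: ler01]|exact: erefl].
exists `|M| => _ [w [hw w1] <-]; apply: le_trans (fM w hw) _.
apply: (@le_trans _ _ (`|M| * l2norm (lap w))).
  by apply: ler_wpM2r; [exact: sqrtr_ge0|exact: ler_norm].
by rewrite -[leRHS]mulr1; apply: ler_wpM2l; [exact: normr_ge0|exact: w1].
Qed.

(** Homogeneity reduces to a [v] of unit norm, which requires the multiples of [v] to be in [H20];
    the discrete space provides them. When [lap v] has norm 0, the bound in [Hm2] already forces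
    [f v = 0]. *)
Lemma Hm2_bound (f : (R * R -> R) -> R) v : Hm2 Omega f -> H20 Omega 0 ->
  (forall a : R, H20 Omega (a *: v)) ->
  `|f v| <= Hm2norm Omega f * l2norm (lap v).
Proof.
move=> hf h0 hv; have hs := Hm2_has_sup h0 hf; have [flin [M fM]] := hf.
have hv1 : H20 Omega v by have := hv 1; rewrite scale1r.
have f0 : f 0 = 0.
  have := flin 1 0 0 h0 h0; rewrite scale1r addr0 mul1r => /eqP.
  by rewrite -subr_eq subrr => /eqP.
have fZ a : f (a *: v) = a * f v.
  by have := flin a v 0 hv1 h0; rewrite addr0 f0 addr0.
have SL := lap_semi_ip oO bO.
have nZ a : l2norm (lap (a *: v)) = `|a| * l2norm (lap v).
  exact: (sip_normZ SL a hv1.1).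
have [n0|nN0] := eqVneq (l2norm (lap v)) 0.
  by rewrite n0 mulr0; have := fM v hv1; rewrite n0 mulr0.
have np : 0 < l2norm (lap v) by rewrite lt_def nN0 sqrtr_ge0.
have ni : `|(l2norm (lap v))^-1| = (l2norm (lap v))^-1 by rewrite ger0_norm// invr_ge0 ltW.
rewrite -ler_pdivrMr// mulrC -[X in X * _]ni -normrM -fZ.
apply: sup_upper_bound; first exact: hs.
exists ((l2norm (lap v))^-1 *: v); [split|exact: erefl]; first exact: hv.
by rewrite nZ ni mulVf.
Qed.

End StaticBounds.

(** * Primitives in time and quadratic forms of the solution *)

Section TimeCalculus.
Context {R : realType}.
Local Notation leb := (@lebesgue_measure R).
Implicit Types (f g df dg : R -> R) (T t : R).

Lemma eq_primitive_on T f g df dg : 0 <= T ->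
  (forall t, 0 <= t <= T -> f t = g t) -> (forall t, 0 <= t <= T -> df t = dg t) ->
  primitive_on T f df -> primitive_on T g dg.
Proof.
move=> T0 fg dfg [idf fE]; split.
  by apply: eq_integrable idf => // t; rewrite inE/= in_itv/= => /dfg ->.
move=> t tT; rewrite -(fg t tT) -fg ?lexx// (fE t tT); congr (_ + _).
apply: eq_Rintegral => s; rewrite inE/= in_itv/= => /andP[s0 st]; apply: dfg.
by rewrite s0 (le_trans st)//; case/andP: tT.
Qed.

Lemma primitive_on0 T : primitive_on T (fun=> 0) (fun=> 0 : R).
Proof.
split; first exact: integrable0.
by move=> t tT; rewrite add0r /Rintegral integral0.
Qed.

Lemma primitive_sum T I (s : seq I) (a : I -> R) (f df : I -> R -> R) :
  (forall i, primitive_on T (f i) (df i)) ->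
  primitive_on T (fun t => \sum_(i <- s) a i * f i t) (fun t => \sum_(i <- s) a i * df i t).
Proof.
move=> pf; elim: s => [|i s ih].
  have -> : (fun t => \sum_(i <- [::]) a i * f i t) = fun=> 0.
    by apply/funext => t; rewrite big_nil.
  have -> : (fun t => \sum_(i <- [::]) a i * df i t) = fun=> 0.
    by apply/funext => t; rewrite big_nil.
  exact: primitive_on0.
have -> : (fun t => \sum_(j <- i :: s) a j * f j t) =
    fun t => a i * f i t + \sum_(j <- s) a j * f j t by apply/funext => t; rewrite big_cons.
have -> : (fun t => \sum_(j <- i :: s) a j * df j t) =
    fun t => a i * df i t + \sum_(j <- s) a j * df j t by apply/funext => t; rewrite big_cons.
exact: primitive_lin.
Qed.

Lemma primitive_expR T (c : R) :
  primitive_on T (fun t => expR (c * t)) (fun t => c * expR (c * t)).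
Proof.
have cE : continuous (fun t => c * expR (c * t)).
  move=> t; apply: cvgM; first exact: cvg_cst.
  apply: (@continuous_comp _ _ _ (fun t => c * t) expR); last exact: continuous_expR.
  by apply: cvgM; [exact: cvg_cst|exact: cvg_id].
split.
  by apply: continuous_compact_integrable; [exact: segment_compact|exact: continuous_subspaceT].
move=> t /andP[t0 _]; rewrite -Rintegral_itv_bndo_bndc; last exact: continuous_integrable_co.
have dE x : is_derive x (1 : R) (fun t => expR (c * t)) (c * expR (c * x)).
  have dm : is_derive x (1 : R) (fun t => c * t) c.
    have := @is_deriveZ _ _ _ (id : R -> R) c x 1 1 (is_derive_id _ _).
    by rewrite /GRing.scale/= mulr1.
  have := @is_derive1_comp _ expR (fun t => c * t) x _ _ (is_derive_expR _) dm.
  by rewrite mulrC.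
by rewrite (FTC2_co t0 cE dE) addrC subrK.
Qed.

Lemma ae_le_Rintegral d (X : measurableType d) (m : {measure set X -> \bar R}) (A : set X)
    (f g : X -> R) : measurable A -> m.-integrable A (EFin \o f) ->
  m.-integrable A (EFin \o g) -> {ae m, forall x, A x -> f x <= g x} ->
  \int[m]_(x in A) f x <= \int[m]_(x in A) g x.
Proof.
move=> mA If Ig fg; rewrite -subr_ge0 -RintegralB//.
have Igf := integrableB mA Ig If.
have mgf : measurable_fun A (fun x => g x - f x).
  by have /measurable_int/measurable_EFinP := Igf.
rewrite (_ : \int[m]_(x in A) _ = \int[m]_(x in A) `|g x - f x|).
  exact: Rintegral_ge0.
congr fine; apply: ae_eq_integral => //.
- exact/measurable_EFinP.
- by apply/measurable_EFinP; apply: measurableT_comp.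
- by apply: filterS fg => x h Ax; rewrite ger0_norm// subr_ge0 h.
Qed.

End TimeCalculus.

Section QuadraticPrimitive.
Context {R : realType} {X : Type}.
Variables (V : set (X -> R)) (B : (X -> R) -> (X -> R) -> R).
Hypothesis SB : semi_ip V B.
Variables (d : nat) (z : 'I_d -> X) (chi : 'I_d -> X -> R).
Hypotheses (Vchi : forall i, V (chi i))
  (nodal : forall v, V v -> v = \sum_i v (z i) *: chi i).

Lemma nodal_form u v : V u -> V v ->
  B u v = \sum_(p : 'I_d * 'I_d) B (chi p.1) (chi p.2) * (u (z p.1) * v (z p.2)).
Proof.
move=> Vu Vv.
have VZ (a : R) i : V (a *: chi i) := sip_memZ SB a (Vchi i).
have E1 : B u v = \sum_i u (z i) * B (chi i) v.
  rewrite [in LHS](nodal Vu) (sip_suml SB)//; apply: eq_bigr => i _.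
  by rewrite (sipZl SB).
have E2 i : B (chi i) v = \sum_j v (z j) * B (chi i) (chi j).
  rewrite [in LHS](nodal Vv) (sip_sumr SB)//; apply: eq_bigr => j _.
  by rewrite (sipZr SB).
rewrite E1 -(pair_bigA _ (fun i j => B (chi i) (chi j) * (u (z i) * v (z j)))) /=.
apply: eq_bigr => i _; rewrite E2 mulr_sumr; apply: eq_bigr => j _.
by rewrite mulrA mulrC.
Qed.

(** In a nodal basis the form is a combination, with coefficients independent of time, of products
    of point values; [primitive_mul] differentiates each product. *)
Lemma form_primitive (T : R) (psi psit : R -> X -> R) : 0 <= T ->
  (forall t, 0 <= t <= T -> V (psi t) /\ V (psit t)) ->
  (forall x, primitive_on T (psi^~ x) (psit^~ x)) ->
  primitive_on T (fun t => B (psi t) (psi t)) (fun t => 2 * B (psit t) (psi t)).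
Proof.
move=> T0 Vpsi dpsi.
pose f (p : 'I_d * 'I_d) t := psi t (z p.1) * psi t (z p.2).
pose df (p : 'I_d * 'I_d) t := psi t (z p.1) * psit t (z p.2) + psi t (z p.2) * psit t (z p.1).
have pf p : primitive_on T (f p) (df p) := primitive_mul T0 (dpsi _) (dpsi _).
have := primitive_sum (index_enum _) (fun p : 'I_d * 'I_d => B (chi p.1) (chi p.2)) pf.
apply: eq_primitive_on => // t /Vpsi[Vp Vpt]; first by rewrite nodal_form.
have -> : 2 * B (psit t) (psi t) = B (psi t) (psit t) + B (psit t) (psi t).
  by rewrite (sipC SB Vp Vpt) mulr_natl.
rewrite !nodal_form// -big_split/=; apply: eq_bigr => p _.
by rewrite -mulrDr; congr (_ * (_ + _)); rewrite mulrC.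
Qed.

End QuadraticPrimitive.

Section Energy.
Context {R : realType}.
Local Notation leb := (@lebesgue_measure R).
Variable Omega : set (R * R).
Hypotheses (oO : open Omega) (bO : bounded_set Omega).
Local Notation ip := (ip Omega).
Local Notation grad_ip := (grad_ip Omega).
Local Notation lap := (lap Omega).
Local Notation H20 := (H20 Omega).
Variables (V : set (R * R -> R)) (nu mu lam : R).
Hypotheses (nu0 : 0 < nu) (mu0 : 0 < mu) (lam0 : 0 < lam).
Hypotheses (V0 : V 0) (Vlin : forall (a : R) u v, V u -> V v -> V (a *: u + v)).
Hypothesis VH20 : V `<=` H20.
Hypothesis poincare : forall v, H10 Omega v -> lam * ip v v <= grad_ip v v.

Let Vgrad : semi_ip V grad_ip.
Proof.
apply: (semi_ip_sub (grad_semi_ip oO bO)); [|exact: V0|exact: Vlin].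
by move=> v /VH20[h _]; exact: H2_H1.
Qed.

Let Vlap : semi_ip V (fun u v => ip (lap u) (lap v)).
Proof.
by apply: (semi_ip_sub (lap_semi_ip oO bO)); [move=> v /VH20[]|exact: V0|exact: Vlin].
Qed.

Lemma dissipation (f : (R * R -> R) -> R) (v w : R * R -> R) (alpha : R) :
  0 < alpha -> Hm2 Omega f -> V v ->
  grad_ip w v + nu * a_form Omega v v + b_form Omega v v v + mu * b0_form Omega v v = mu * f v ->
  2 * alpha * grad_ip v v + 2 * grad_ip w v + (nu - 2 * alpha / lam) * ip (lap v) (lap v)
    <= mu ^+ 2 / nu * Hm2norm Omega f ^+ 2.
Proof.
move=> al0 hf Vv; rewrite (b_form_diag oO) b0_form_diag mulr0 !addr0.
have Hv : H20 v by exact: VH20.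
have hb : `|f v| <= Hm2norm Omega f * l2norm Omega (lap v).
  apply: (Hm2_bound oO bO hf); first exact: VH20.
  by move=> a; apply: VH20; rewrite -[a *: v]addr0; exact: Vlin.
have n2 : l2norm Omega (lap v) ^+ 2 = ip (lap v) (lap v).
  by apply: (l2norm_sqr oO); apply: (lap_L2 oO); exact: Hv.1.
have gl := grad_le_lap oO bO lam0 poincare Hv.
rewrite (_ : a_form Omega v v = l2norm Omega (lap v) ^+ 2); last by rewrite n2.
rewrite -n2 in gl *.
move: (l2norm Omega (lap v)) (grad_ip v v) (grad_ip w v) (f v) (Hm2norm Omega f) hb gl.
move=> n y g fv H hb gl e; have {e} -> : g = mu * fv - nu * n ^+ 2 by rewrite -e addrK.
have hy : 2 * alpha * y <= 2 * alpha / lam * n ^+ 2.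
  by rewrite -[leRHS]mulrA ler_pM2l ?mulr_gt0// ler_pdivlMl.
have hfv : mu * fv <= mu * (H * n).
  by rewrite ler_pM2l//; exact: le_trans (ler_norm _) hb.
(* The slack in [2 * mu * H * n <= nu * n ^+ 2 + mu ^+ 2 / nu * H ^+ 2], which is the origin of the
   factor [mu ^+ 2 / nu]. *)
have sq : 0 <= nu * (n - mu / nu * H) ^+ 2 by rewrite mulr_ge0 ?sqr_ge0 ?(ltW nu0).
have e : nu * (n - mu / nu * H) ^+ 2 = nu * n ^+ 2 - 2 * (mu * (H * n)) + mu ^+ 2 / nu * H ^+ 2.
  by field; rewrite gt_eqF.
by rewrite e in sq; lra.
Qed.

Variables (T : R) (psi psit : R -> R * R -> R) (F : R -> (R * R -> R) -> R) (phi : R -> R).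
Hypotheses (Vspan : exists (D : nat) (b : 'I_D -> R * R -> R), forall v, V v ->
  exists c : 'I_D -> R, v = \sum_i c i *: b i).
Hypothesis dpsi : time_derivative V T psi psit.
Hypothesis FHm2 : forall t, 0 < t -> Hm2 Omega (F t).
Hypothesis phiE : forall t, 0 < t -> phi t = Hm2norm Omega (F t) ^+ 2.
Hypothesis phi_int : leb.-integrable setT (EFin \o phi).
Hypothesis scheme : {ae leb, forall t, 0 < t <= T -> forall chi, V chi ->
  grad_ip (psit t) chi + nu * a_form Omega (psi t) chi + b_form Omega (psi t) (psi t) chi
    + mu * b0_form Omega (psi t) chi = mu * F t chi}.

Lemma energy_inequality (t alpha : R) : 0 < t <= T -> 0 < alpha ->
  expR (2 * alpha * t) * grad_ip (psi t) (psi t)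
    + (nu - 2 * alpha / lam) *
      \int[leb]_(s in `[0, t]) (expR (2 * alpha * s) * ip (lap (psi s)) (lap (psi s)))
  <= grad_ip (psi 0) (psi 0)
    + mu ^+ 2 / nu * \int[leb]_(s in `[0, t]) (expR (2 * alpha * s) * phi s).
Proof.
move=> /andP[t0 tT] al0; have T0 : 0 < T := lt_le_trans t0 tT.
have [D [b spanb]] := Vspan.
have [d [z [chi [Vchi nodal]]]] := nodal_basis V0 Vlin spanb.
have [Vpsi dpsix] := dpsi.
have py := form_primitive Vgrad Vchi nodal (ltW T0) Vpsi dpsix.
(* This serves to make the squared norm of the Laplacian integrable in time. *)
have pa := form_primitive Vlap Vchi nodal (ltW T0) Vpsi dpsix.
have pE := primitive_expR T (2 * alpha).
have [iEy EyE] := primitive_mul (ltW T0) pE py.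
have mt : @measurable _ (line R) `[0, t]%classic by exact: measurable_itv.
have mT : @measurable _ (line R) `[0, T]%classic by exact: measurable_itv.
have tsub : `[0, t] `<=` `[0, T] by apply: subset_itvl; rewrite bnd_simp.
have iEa := primitive_mul_integrable (ltW T0) pE (primitive_integrable (ltW T0) pa).
have iEp := primitive_mul_integrable (ltW T0) pE
  (integrableS measurableT mT (@subsetT _ _) phi_int).
have iEy' := integrableS mT mt tsub iEy.
have iEa' := integrableS mT mt tsub iEa.
have iEp' := integrableS mT mt tsub iEp.
have tT' : 0 <= t <= T by rewrite (ltW t0).
rewrite (EyE t tT') mulr0 expR0 mul1r -addrA lerD2l.
set be := nu - _; set c := mu ^+ 2 / nu.
have iA : leb.-integrable `[0, t]
    (EFin \o (fun s => be * (expR (2 * alpha * s) * ip (lap (psi s)) (lap (psi s))))).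
  exact: (integrableZl mt be iEa').
have iP : leb.-integrable `[0, t] (EFin \o (fun s => c * (expR (2 * alpha * s) * phi s))).
  exact: (integrableZl mt c iEp').
have -> : be * \int[leb]_(s in `[0, t]) (expR (2 * alpha * s) * ip (lap (psi s)) (lap (psi s))) =
    \int[leb]_(s in `[0, t]) (be * (expR (2 * alpha * s) * ip (lap (psi s)) (lap (psi s)))).
  by apply/esym; exact: RintegralZl.
have -> : c * \int[leb]_(s in `[0, t]) (expR (2 * alpha * s) * phi s) =
    \int[leb]_(s in `[0, t]) (c * (expR (2 * alpha * s) * phi s)).
  by apply/esym; exact: RintegralZl.
rewrite -lerBrDr -(RintegralB mt iP iA).
apply: ae_le_Rintegral => //; first exact: (integrableB mt iP iA).
(* The equation and the bounds on [F] hold at positive times only, so the null set containing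
   [s = 0] is removed. *)
have n0 : {ae leb, forall s : R, s <> 0}.
  exists [set 0]; split; [exact: measurable_set1|exact: lebesgue_measure_set1|].
  by move=> s /contrapT.
have aeF := ae_filter_ringOfSetsType (leb : {measure set (line R) -> \bar R}).
move: scheme n0; apply: (@filterS2 _ _ aeF) => s hs sN0; rewrite /= in_itv/= => /andP[s0 st].
have sp : 0 < s by rewrite lt_neqAle s0 andbT eq_sym; exact/eqP.
have sT : 0 < s <= T by rewrite sp (le_trans st).
have Vs : V (psi s) by apply: (Vpsi s _).1; rewrite s0 (le_trans st).
have := dissipation al0 (FHm2 sp) Vs (hs sT _ Vs); rewrite -(phiE sp) -/be -/c => h.
have E0 := expR_gt0 (2 * alpha * s).
move: h E0; move: (grad_ip (psi s) (psi s)) (grad_ip (psit s) _) (ip _ _) (expR _) (phi s).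
move=> y g a E p h E0.
have : E * (2 * alpha * y + 2 * g + be * a) <= E * (c * p) by rewrite ler_pM2l.
by lra.
Qed.

End Energy.

(** * Behaviour for large times *)

Section Decay.
Context {R : realType}.
Local Notation leb := (@lebesgue_measure R).

Lemma expR_mul_cvg0 (c : R) : 0 < c -> expR (- (c * t)) @[t --> +oo%R] --> (0 : R).
Proof.
move=> c0; apply: (@cvg_comp _ _ _ (fun t => c * t) (fun t => expR (- t)) _ +oo%R).
  exact: gt0_cvgMrNy || apply: gt0_cvgMry => //.
exact: cvgr_expR.
Qed.

(** Along a sequence [u n] tending to infinity, the expression is the integral over the line of
    [phi] times a kernel that is at most 1 and, at each fixed [s], tends to 0; the absolute value of
    [phi] dominates. *)
Lemma exp_convolution_cvg0 (c : R) (phi : R -> R) : 0 < c ->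
  leb.-integrable setT (EFin \o phi) ->
  expR (- (c * t)) * \int[leb]_(s in `[0, t]) (expR (c * s) * phi s) @[t --> +oo%R] --> (0 : R).
Proof.
move=> c0 iphi; apply/cvg_pinftyP => u uoo.
pose g n (s : R) := (expR (c * (s - u n)) * phi s) * \1_`[0, u n] s.
have mphi : @measurable_fun _ _ (line R) (line R) setT phi.
  by have /measurable_int/measurable_EFinP := iphi.
have mg n : @measurable_fun _ _ (line R) (line R) setT (g n).
  apply: measurable_funM; last by apply: measurable_indic; exact: measurable_itv.
  apply: measurable_funM => //; apply: (measurableT_comp (@measurable_expR R)).
  by apply: measurable_funM => //; exact: measurable_funB.
have gle n s : `|g n s| <= `|phi s|.
  rewrite /g indicE; case: (boolP (s \in _)) => [|_]; last by rewrite mulr0 normr0.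
  rewrite inE/= in_itv/= mulr1 normrM ger0_norm ?expR_ge0// => /andP[_ su].
  rewrite -[leRHS]mul1r; apply: ler_wpM2r => //.
  by rewrite -expR0 ler_expR pmulr_rle0// subr_le0.
have eu : expR (- (c * u n)) @[n --> \oo] --> (0 : R).
  by move/cvg_pinftyP : (expR_mul_cvg0 c0); exact.
have g0 s : g n s @[n --> \oo] --> (0 : R).
  apply/norm_cvg0P; apply: (@squeeze_cvgr _ _ _ _ (cst 0)
    (fun n => expR (- (c * u n)) * (expR (c * s) * `|phi s|))).
  - apply: nearW => n; rewrite normr_ge0/= /g indicE mulrBr expRD.
    case: (s \in _); last by rewrite mulr0 normr0 !mulr_ge0 ?expR_ge0.
    rewrite mulr1 normrM ger0_norm ?mulr_ge0 ?expR_ge0//.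
    by rewrite [X in X * _]mulrC mulrA.
  - exact: cvg_cst.
  - by rewrite -[X in _ --> X](mul0r (expR (c * s) * `|phi s|)); apply: cvgM => //; exact: cvg_cst.
have mT : @measurable _ (line R) [set: R] by exact: measurableT.
have [] := @dominated_convergence _ (line R) R leb setT mT
  (fun n => EFin \o g n) (cst 0%E) (fun s => `|phi s|%:E).
- by move=> n; apply/measurable_EFinP; exact: mg.
- exact: measurable_cst.
- by apply: aeW => s _; apply: cvg_EFin; [exact: nearW|exact: g0].
- exact: (integrable_abse iphi).
- by apply: aeW => s n _; rewrite lee_fin; exact: gle.
move=> _ _; rewrite integral0 => h.
have {}h := fine_cvg h.
have -> : (fun n => expR (- (c * u n)) * \int[leb]_(s in `[0, u n]) (expR (c * s) * phi s)) =
  (fun n => fine (\int[leb]_x (EFin \o g n) x)).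
  apply/funext => n; transitivity (\int[leb]_s g n s); last by [].
  have mI : @measurable _ (line R) `[0, u n]%classic by exact: measurable_itv.
  have iI : leb.-integrable `[0, u n] (EFin \o (fun s => expR (c * s) * phi s)).
    (* The first terms of [u] may be negative, and then the interval is empty. *)
    have [u0|u0] := leP 0 (u n); last first.
      by rewrite set_itv_ge ?bnd_simp -?ltNge//; exact: integrable_set0.
    apply: (primitive_mul_integrable u0 (primitive_expR (u n) c)).
    exact: (integrableS measurableT mI (@subsetT _ _) iphi).
  transitivity (\int[leb]_(s in `[0, u n]) (expR (- (c * u n)) * (expR (c * s) * phi s))).
    by apply/esym; exact: RintegralZl.
  rewrite Rintegral_mkcond; apply: eq_Rintegral => s _.
  rewrite patchE /g indicE; case: ifPn => sI; last by rewrite mulr0.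
  by rewrite mulr1 mulrBr expRD -mulrA mulrCA.
exact: h.
Qed.

Lemma limf_esup_le0 (f : R -> R) : f t @[t --> +oo%R] --> (0 : R) ->
  (limf_esup (fun t => (f t)%:E) +oo%R <= 0)%E.
Proof.
move=> f0; apply/lee_addgt0Pr => e e0; rewrite add0e.
apply: ge_ereal_inf.
exists (ereal_sup [set (f x)%:E | x in [set x | f x <= e]]).
  exists [set x | f x <= e] => //.
  move/cvgrPdist_le : f0 => /(_ e e0); apply: filterS => x /=.
  by rewrite sub0r normrN; apply: le_trans; exact: ler_norm.
by apply: ge_ereal_sup => _ [x /= xe <-]; rewrite lee_fin.
Qed.

End Decay.

Section VanishingGradient.
Context {R : realType}.
Variable Omega : set (R * R).
Hypotheses (oO : open Omega) (bO : bounded_set Omega).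

Lemma weak0 e : is_weak_deriv Omega e 0 0.
Proof.
have S := L2_semi_ip oO; split; first exact: (sip0 S).
move=> phi tphi; rewrite (_ : ip Omega 0 _ = 0); last first.
  by rewrite /ip /Rintegral; under eq_integral do rewrite mul0r; rewrite integral0.
by rewrite (sip0l S) ?oppr0//; exact: test_L2.
Qed.

Lemma wder_wder_ae0 v e : axis e -> H2 Omega v ->
  ae_eq mu2 Omega (wder Omega e v) (0 : R * R -> R) ->
  ae_eq mu2 Omega (wder Omega e (wder Omega e v)) (0 : R * R -> R).
Proof.
move=> ae hv w0; have S := L2_semi_ip oO; have h := H2_wder ae hv.
apply: (weak_unique oO bO (H1_weak ae h)).
apply: (weak_ae oO bO _ _ ae _ (weak0 e)); [exact: (sip0 S)|exact: (H1_L2 h)|].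
exact: ae_eq_sym.
Qed.

(** The condition under which [semi_ip_dominated] bounds the Laplacian by the gradient: if both
    first derivatives vanish almost everywhere, so do their own weak derivatives, by uniqueness. *)
Lemma lap_eq0 v : H2 Omega v -> grad_ip Omega v v = 0 ->
  ip Omega (lap Omega v) (lap Omega v) = 0.
Proof.
move=> hv g0; have S := L2_semi_ip oO.
have mO : @measurable _ (plane R) Omega := open_measurable2 oO.
have W e : axis e -> ip Omega (wder Omega e v) (wder Omega e v) = 0 ->
    ae_eq mu2 Omega (wder Omega e (wder Omega e v)) (0 : R * R -> R).
  move=> ae i0; apply: wder_wder_ae0 => //.
  exact: (@sq_ip_eq0_ae _ (plane R) R mu2 Omega mO _ (H1_wder_L2 ae (H2_H1 hv)) i0).
have ax : axis (ex : R * R) by left.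
have ay : axis (ey : R * R) by right.
have x0 := sip_ge0 S (H1_wder_L2 ax (H2_H1 hv)).
have y0 := sip_ge0 S (H1_wder_L2 ay (H2_H1 hv)).
have split0 (x y : R) : 0 <= x -> 0 <= y -> x + y = 0 -> x = 0 /\ y = 0.
  by move=> ? ? /eqP; rewrite paddr_eq0// => /andP[/eqP ? /eqP].
have [xe ye] := split0 _ _ x0 y0 g0; have Wx := W _ ax xe; have Wy := W _ ay ye.
have l0 : ae_eq mu2 Omega (lap Omega v) (0 : R * R -> R).
  move: Wx Wy; apply: filterS2 => p h1 h2 Op.
  exact: etrans (f_equal2 (fun x y : R => x + y) (h1 Op) (h2 Op)) (addr0 0).
have Ll := lap_L2 oO hv.
by rewrite (ip_ae oO Ll (sip0 S) Ll l0) (sip0l S).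
Qed.

End VanishingGradient.

(** * Estimates for the semi-discrete solution *)

Section Solution.
Context {R : realType}.
Local Notation leb := (@lebesgue_measure R).
Variables (Omega : set (R * R)) (V : set (R * R -> R)) (nu mu lam : R).
Hypotheses (oO : open Omega) (bO : bounded_set Omega).
Hypotheses (nu0 : 0 < nu) (mu0 : 0 < mu) (lam0 : 0 < lam).
Hypotheses (V0 : V 0) (Vlin : forall (a : R) u v, V u -> V v -> V (a *: u + v)).
Hypothesis VH20 : V `<=` H20 Omega.
Hypothesis poincare : forall v, H10 Omega v -> lam * ip Omega v v <= grad_ip Omega v v.
Hypothesis Vspan : exists (D : nat) (b : 'I_D -> R * R -> R), forall v, V v ->
  exists c : 'I_D -> R, v = \sum_i c i *: b i.
Variables (F : R -> (R * R -> R) -> R) (psi0 : R * R -> R) (psi : R -> R * R -> R).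
Hypothesis hF : L2Hm2 Omega F.

(** Nothing is known of [F t] for [t <= 0]; the extension by 0 is integrable on the whole line. *)
Let phi := (fun t : R => Hm2norm Omega (F t) ^+ 2) \_ `]0, +oo[.

Let phiE t : 0 < t -> phi t = Hm2norm Omega (F t) ^+ 2.
Proof. by move=> t0; rewrite /phi patchE ifT// inE/= in_itv/= t0. Qed.

Let phi_ge0 t : 0 <= phi t.
Proof. by rewrite /phi patchE; case: ifP => // _; exact: sqr_ge0. Qed.

Let phi_int : leb.-integrable setT (EFin \o phi).
Proof.
have [_ _ iF] := hF; rewrite /phi -restrict_EFin.
have mI : @measurable _ (line R) `]0, +oo[%classic by exact: measurable_itv.
exact: (integrable_mkcond _ mI).1 iF.
Qed.

(** The weight is largest at the final time; its value there cancels the decaying factor, which is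
    why the term in [F] carries no exponential in the estimate. *)
Lemma Rintegral_exp_le t c : 0 < t -> 0 <= c ->
  \int[leb]_(s in `[0, t]) (expR (c * s) * phi s) <= expR (c * t) * L2Hm2norm Omega F ^+ 2.
Proof.
move=> t0 c0; have mt : @measurable _ (line R) `[0, t]%classic by exact: measurable_itv.
have ip : leb.-integrable `[0, t] (EFin \o phi).
  exact: (integrableS measurableT mt (@subsetT _ _) phi_int).
have -> : L2Hm2norm Omega F ^+ 2 = \int[leb]_s phi s.
  rewrite /L2Hm2norm sqr_sqrtr; first by rewrite Rintegral_mkcond.
  by apply: Rintegral_ge0 => s _; exact: sqr_ge0.
apply: (@le_trans _ _ (\int[leb]_(s in `[0, t]) (expR (c * t) * phi s))).
  apply: le_Rintegral => //.
  - exact: (primitive_mul_integrable (ltW t0) (primitive_expR t c)).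
  - exact: (integrableZl mt (expR (c * t)) ip).
  - move=> s /=; rewrite in_itv/= => /andP[_ st]; apply: ler_wpM2r => //.
    by rewrite ler_expR ler_wpM2l.
rewrite (_ : \int[leb]_(s in _) _ = expR (c * t) * \int[leb]_(s in `[0, t]) phi s); last first.
  exact: RintegralZl.
apply: ler_wpM2l; first exact: expR_ge0.
by apply: Rintegral_subset.
Qed.

Lemma solution_energy T t alpha : semidiscrete_solution Omega V nu mu F psi0 T psi ->
  0 < t <= T -> 0 < alpha ->
  expR (2 * alpha * t) * grad_ip Omega (psi t) (psi t)
    + (nu - 2 * alpha / lam) *
      \int[leb]_(s in `[0, t])
        (expR (2 * alpha * s) * l2norm Omega (lap Omega (psi s)) ^+ 2)
  <= grad_ip Omega psi0 psi0
    + mu ^+ 2 / nu * \int[leb]_(s in `[0, t]) (expR (2 * alpha * s) * phi s).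
Proof.
move=> [<- [psit dpsi scheme]] tT al0; have [FH _ _] := hF.
apply: le_trans (energy_inequality oO bO nu0 mu0 lam0 V0 Vlin VH20 poincare Vspan dpsi
  FH phiE phi_int scheme tT al0).
rewrite lerD2l le_eqVlt; apply/orP; left; apply/eqP; congr (_ * _).
apply: eq_Rintegral => s; rewrite inE/= in_itv/= => /andP[s0 st]; congr (_ * _).
apply: (l2norm_sqr oO); apply: (lap_L2 oO).
have [Vpsi _] := dpsi; case/andP: tT => _ tT.
by have [/VH20[]] := Vpsi s (introT andP (conj s0 (le_trans st tT))).
Qed.

Lemma solution_in T t : semidiscrete_solution Omega V nu mu F psi0 T psi ->
  0 <= t <= T -> V (psi t).
Proof. by move=> [_ [psit [Vpsi _] _]] /Vpsi[]. Qed.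

(** The weighted integral of [phi] is kept as it stands: the first assertion bounds it by the norm
    of [F], while the last one needs its decay. *)
Lemma solution_bound T t alpha : semidiscrete_solution Omega V nu mu F psi0 T psi ->
  0 < t <= T -> 0 < alpha ->
  gradnorm Omega (psi t) ^+ 2
    + (nu - 2 * alpha / lam) * expR (- (2 * alpha * t)) *
      \int[leb]_(s in `[0, t])
        (expR (2 * alpha * s) * l2norm Omega (lap Omega (psi s)) ^+ 2)
  <= expR (- (2 * alpha * t)) * gradnorm Omega psi0 ^+ 2
    + mu ^+ 2 / nu *
      (expR (- (2 * alpha * t)) * \int[leb]_(s in `[0, t]) (expR (2 * alpha * s) * phi s)).
Proof.
move=> sol tT al0; have en := solution_energy sol tT al0.
have /andP[t0 tT'] := tT.
have H1V v : V v -> H1 Omega v by move=> /VH20[/H2_H1].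
have h0 : H1 Omega psi0.
  by have [<- _] := sol; apply/H1V/(solution_in sol); rewrite lexx (le_trans (ltW t0)).
have ht : H1 Omega (psi t) by apply/H1V/(solution_in sol); rewrite (ltW t0).
have e0 := gradnorm_sqr oO bO h0; have et := gradnorm_sqr oO bO ht.
have eq_le (x y : R) : x = y -> x <= y by move=> ->.
have scale (x y I y0 c J : R) : expR x * y + c * I <= y0 + mu ^+ 2 / nu * J ->
    y + c * expR (- x) * I <= expR (- x) * y0 + mu ^+ 2 / nu * (expR (- x) * J).
  rewrite -(ler_pM2l (expR_gt0 (- x))) !mulrDr [_ * (expR x * y)]mulrA -expRD addNr expR0 mul1r.
  by rewrite [expR _ * (c * I)]mulrA [expR _ * c]mulrC [expR _ * (_ / _ * J)]mulrCA.
apply: le_trans (lerD (eq_le _ _ et) (lexx _)) _; apply: le_trans (scale _ _ _ _ _ _ en) _.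
exact: (lerD (eq_le _ _ (congr1 _ (esym e0))) (lexx _)).
Qed.

Lemma solution_decay : (forall T, 0 < T -> semidiscrete_solution Omega V nu mu F psi0 T psi) ->
  gradnorm Omega (psi t) ^+ 2 @[t --> +oo] --> (0 : R).
Proof.
(* Half of the admissible bound [nu * lam / 2]; the coefficient of the dissipation is then
   [nu / 2]. *)
move=> sol; pose alpha := nu * lam / 4.
have al0 : 0 < alpha by rewrite /alpha !mulr_gt0.
have be0 : 0 <= nu - 2 * alpha / lam.
  by rewrite (_ : _ - _ = nu / 2) ?divr_ge0 ?ltW// /alpha; field; rewrite gt_eqF.
pose c := 2 * alpha; have c0 : 0 < c by rewrite /c mulr_gt0.
apply: (@squeeze_cvgr _ _ _ _ (cst 0) (fun t => expR (- (c * t)) * gradnorm Omega psi0 ^+ 2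
    + mu ^+ 2 / nu * (expR (- (c * t)) * \int[leb]_(s in `[0, t]) (expR (c * s) * phi s)))).
- near=> t; rewrite sqr_ge0/=.
  have t0 : 0 < t by near: t; exact: nbhs_pinfty_gt.
  have tt : 0 < t <= t by rewrite t0 lexx.
  apply: le_trans (solution_bound (sol t t0) tt al0); rewrite lerDl.
  rewrite !mulr_ge0// ?expR_ge0//; apply: Rintegral_ge0 => s _.
  by rewrite mulr_ge0 ?expR_ge0 ?sqr_ge0.
- exact: cvg_cst.
- have h1 := expR_mul_cvg0 c0; have h2 := exp_convolution_cvg0 c0 phi_int.
  rewrite -[X in _ --> X](addr0 0) -[X in _ --> X + _](mul0r (gradnorm Omega psi0 ^+ 2)).
  rewrite -[X in _ --> _ + X](mulr0 (mu ^+ 2 / nu)).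
  by apply: cvgD; apply: cvgM => //; exact: cvg_cst.
Unshelve. all: by end_near. Qed.

Lemma lap_solution_decay :
  (forall T, 0 < T -> semidiscrete_solution Omega V nu mu F psi0 T psi) ->
  l2norm Omega (lap Omega (psi t)) @[t --> +oo] --> (0 : R).
Proof.
move=> sol; have [D [b spanb]] := Vspan.
have VH2 v : V v -> H2 Omega v by move=> /VH20[].
have SG : semi_ip V (grad_ip Omega).
  by apply: (semi_ip_sub (grad_semi_ip oO bO)) => // v /VH2/H2_H1.
have SL : semi_ip V (fun u v => ip Omega (lap Omega u) (lap Omega v)).
  by apply: (semi_ip_sub (lap_semi_ip oO bO)).
have [M M0 hM] := semi_ip_dominated V0 Vlin spanb SG SL
  (fun v Vv => @lap_eq0 _ _ oO bO v (VH2 v Vv)).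
apply: (@squeeze_cvgr _ _ _ _ (cst 0) (fun t => M * Num.sqrt (gradnorm Omega (psi t) ^+ 2))).
- near=> t; rewrite sqrtr_ge0/=.
  have t0 : 0 < t by near: t; exact: nbhs_pinfty_gt.
  have Vt : V (psi t) by apply: (solution_in (sol t t0)); rewrite lexx ltW.
  by rewrite sqrtr_sqr ger0_norm ?sqrtr_ge0//; exact: hM.
- exact: cvg_cst.
- rewrite -[X in _ --> X](mulr0 M); apply: cvgM; first exact: cvg_cst.
  rewrite -[X in _ --> X]sqrtr0; apply: continuous_cvg (solution_decay sol).
  exact: sqrt_continuous.
Unshelve. all: by end_near. Qed.

End Solution.

Theorem lemma3p2 (R : realType) (Omega : set (R * R)) (nu mu lam1 : R)
    (k : nat) (sigma C0 : R)
    (hOmega : bounded_domain Omega) (hnu : 0 < nu) (hmu : 0 < mu)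
    (hlam1 : 0 < lam1) (hlam1min : min_dirichlet_eigenvalue Omega lam1)
    (hk : (3 <= k)%N) (hsigma : 0 < sigma) (hC0 : 0 < C0) :
  exists2 C : R, 0 < C &
  forall (h : R) (N : nat) (K : 'I_N -> set (R * R)) (Sh : set (R * R -> R)),
    shape_regular_partition Omega sigma h K ->
    C1_fe_space Omega k K Sh ->
  forall (psi0 psi0h : R * R -> R) (F : R -> (R * R -> R) -> R)
    (psih : R -> R * R -> R),
    H10 Omega psi0 ->
    L2Hm2 Omega F ->
    clamped_part Omega Sh psi0h ->
    gradnorm Omega psi0h <= C0 * gradnorm Omega psi0 ->
  (forall T : R, 0 < T ->
     semidiscrete_solution Omega (clamped_part Omega Sh) nu mu F psi0h T psih ->
     forall t alpha : R, 0 < t <= T -> 0 < alpha < nu * lam1 / 2 ->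
     let beta := nu - 2 * alpha / lam1 in
     0 < beta /\
     gradnorm Omega (psih t) ^+ 2
       + beta * expR (- (2 * alpha * t))
         * \int[lebesgue_measure]_(s in `[0, t])
             (expR (2 * alpha * s) * l2norm Omega (lap Omega (psih s)) ^+ 2)
     <= C * expR (- (2 * alpha * t)) * gradnorm Omega psi0 ^+ 2
        + mu ^+ 2 / nu * L2Hm2norm Omega F ^+ 2) /\
  ((forall T : R, 0 < T ->
      semidiscrete_solution Omega (clamped_part Omega Sh) nu mu F psi0h T psih) ->
   (limf_esup (fun t : R => (l2norm Omega (lap Omega (psih t)))%:E) +oo%R
      <= (mu ^+ 2 / nu * L2Hm2norm Omega F)%:E)%E).
Proof.
(* The constant comes from squaring the assumption on [psi0h]; it depends on [C0] alone, hence
   neither on the mesh nor on time. *)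
have [oO _ _ bO] := hOmega; exists (C0 ^+ 2); first exact: exprn_gt0.
move=> h N K Sh hK hS psi0 psi0h F psih hpsi0 hF hpsi0h hC.
have V0 := clamped_part0 hS; have Vlin := clamped_part_lin hS.
have Vspan := clamped_part_span hK hS.
have VH20 := fes_H20 hS; have poinc := poincare_dirichlet oO bO hlam1min.
have E := solution_bound oO bO hnu hmu hlam1 V0 Vlin VH20 poinc Vspan hF.
split=> [T T0 sol t alpha tT /andP[al0 al1] /=|sol]; last first.
  have dec := lap_solution_decay oO bO hnu hmu hlam1 V0 Vlin VH20 poinc Vspan hF sol.
  apply: (le_trans (limf_esup_le0 dec)); rewrite lee_fin; apply: mulr_ge0.
    by apply: divr_ge0; [exact: sqr_ge0|exact: ltW].
  exact: sqrtr_ge0.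
have /andP[t0 _] := tT.
split; first by rewrite subr_gt0 ltr_pdivrMr//; move: al1; rewrite ltr_pdivlMr// mulrC.
apply: (le_trans (E psi0h psih T t alpha sol tT al0)); apply: lerD.
  rewrite [C0 ^+ 2 * _]mulrC -[leRHS]mulrA; apply: ler_wpM2l; first exact: expR_ge0.
  rewrite -exprMn; apply: lerXn2r; [exact: sqrtr_ge0| |exact: hC].
  by apply: mulr_ge0; [exact: ltW|exact: sqrtr_ge0].
apply: ler_wpM2l; first by apply: divr_ge0; [exact: sqr_ge0|exact: ltW].
have al2 : 0 <= 2 * alpha by rewrite mulr_ge0 ?ltW.
have key := Rintegral_exp_le hF t0 al2.
apply: (le_trans (ler_wpM2l (expR_ge0 _) key)).
by rewrite mulrA -expRD addNr expR0 mul1r.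
Qed.
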